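(* Let $R\subset\mathbb R^n$ be a nonempty strongly eutactic root system of norm $2$ spanning $\mathbb R^n$. For $j\ge1$ consider the condition $(C_{2j})$: $\sum_{x\in R}f(x)=0$ for all $f\in\mathrm{Harm}_{2j}(\mathbb R^n)$. Then (equivalence meaning isometry of root systems): (i) $(C_2)$ always holds (i.e. $R$ is a spherical $3$-design); (ii) $(C_4)$ holds iff $R$ is equivalent to one of $A_1,A_2,D_4,E_6,E_7,E_8$; (iii) $(C_6)$ holds iff $R$ is equivalent to one of $A_1,\ 2A_1,\ E_8,\ 2E_8,\ D_{16}$; (iv) $(C_8)$ holds iff $R$ is equivalent to $A_1$ or $A_2$; (v) $(C_{10})$ holds iff $R$ is equivalent to one of $A_1,\ 2A_1,\ A_2,\ D_4,\ E_8$; (vi) $(C_{12})$ holds iff $R$ is equivalent to $A_1$.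
   Context: A root system is a finite subset $R\subset\mathbb R^n$ not containing $0$, closed under the reflections $s_y$ ($y\in R$), with $2\langle x,y\rangle/\langle x,x\rangle\in\mathbb Z$; norm $2$ means $\langle x,x\rangle=2$ for all $x\in R$. Orthogonal unions and irreducible components are as usual; $kR$ denotes the orthogonal union of $k$ copies of $R$. The Coxeter number of an irreducible root system $R\subset\mathbb R^n$ is $h=|R|/n$; $R$ is strongly eutactic if all irreducible components have the same Coxeter number. $A_n,D_n,E_6,E_7,E_8$ are the standard irreducible simply laced root systems normalized to norm 2 (Coxeter numbers $n+1$, $2(n-1)$, $12$, $18$, $30$). $\mathrm{Harm}_{j}(\mathbb R^n)$ denotes the homogeneous harmonic polynomials of degree $j$ on $\mathbb R^n$. *)

(* Defs.v *)
From HB Require Import structures.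
From mathcomp Require Import all_boot all_order all_algebra.
From mathcomp Require Import reals.
From mathcomp Require Import mpoly.

Set Implicit Arguments.
Unset Strict Implicit.
Unset Printing Implicit Defensive.

Import Order.TTheory GRing.Theory Num.Theory.
Local Open Scope ring_scope.

(* Euclidean space R^n is modelled by row vectors 'rV[R]_n over a realType R.
   A finite subset of R^n is a duplicate-free sequence. *)

Section RootSystems.
Variable R : realType.

Definition dotv {n} (x y : 'rV[R]_n) : R := (x *m y^T) 0 0.

Definition refl {n} (y x : 'rV[R]_n) : 'rV[R]_n :=
  x - ((2 * dotv x y) / dotv y y) *: y.

Definition root_system {n} (Phi : seq 'rV[R]_n) : Prop :=
  [/\ uniq Phi, (0 : 'rV[R]_n) \notin Phi,
      {in Phi &, forall x y, refl y x \in Phi} &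
      {in Phi &, forall x y, (2 * dotv x y) / dotv x x \is a Num.int}].

Definition norm2 {n} (Phi : seq 'rV[R]_n) : Prop :=
  {in Phi, forall x, dotv x x = 2}.

Definition rows_mx {n} (s : seq 'rV[R]_n) : 'M[R]_(size s, n) :=
  \matrix_(i < size s) nth 0 s i.

Definition span_dim {n} (s : seq 'rV[R]_n) : nat := \rank (rows_mx s).

Definition spans {n} (Phi : seq 'rV[R]_n) : Prop := span_dim Phi = n.

(* irreducible components: connected components of the graph on Phi
   whose edges join non-orthogonal roots *)
Definition nonorth {n} : rel 'rV[R]_n := fun x y => dotv x y != 0.

Definition connected_in {n} (Phi : seq 'rV[R]_n) (x y : 'rV[R]_n) : bool :=
  [exists k : 'I_(size Phi).+1,
     [exists t : k.-tuple 'I_(size Phi),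
        let s := [seq nth 0 Phi (val i) | i : 'I_(size Phi) <- t] in
        path nonorth x s && (last x s == y)]].

Definition component {n} (Phi : seq 'rV[R]_n) (x : 'rV[R]_n) : seq 'rV[R]_n :=
  [seq y <- Phi | connected_in Phi x y].

Definition coxeter_number {n} (C : seq 'rV[R]_n) : R :=
  (size C)%:R / (span_dim C)%:R.

Definition strongly_eutactic {n} (Phi : seq 'rV[R]_n) : Prop :=
  {in Phi &, forall x y,
     coxeter_number (component Phi x) = coxeter_number (component Phi y)}.

Definition evalv {n} (p : {mpoly R[n]}) (x : 'rV[R]_n) : R :=
  p.@[fun i => x 0 i].

Definition homogeneous {n} (d : nat) (p : {mpoly R[n]}) : bool :=
  all (fun m => mdeg m == d) (msupp p).

Definition laplacian {n} (p : {mpoly R[n]}) : {mpoly R[n]} :=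
  \sum_(i < n) mderiv i (mderiv i p).

Definition harmonic {n} (d : nat) (p : {mpoly R[n]}) : Prop :=
  homogeneous d p /\ laplacian p = 0.

Definition design_cond {n} (Phi : seq 'rV[R]_n) (d : nat) : Prop :=
  forall p : {mpoly R[n]}, harmonic d p -> \sum_(x <- Phi) evalv p x = 0.

(* equivalence (isometry) of root systems: an isometric linear embedding
   R^n -> R^m (x |-> x *m M with M M^T = 1) mapping Phi onto Psi *)
Definition rs_equiv {n m} (Phi : seq 'rV[R]_n) (Psi : seq 'rV[R]_m) : Prop :=
  exists M : 'M[R]_(n, m),
    M *m M^T = 1%:M /\ Psi =i [seq x *m M | x <- Phi].

Definition ev {n} (i : 'I_n) : 'rV[R]_n := delta_mx 0 i.

Definition rsA (k : nat) : seq 'rV[R]_(k.+1) :=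
  [seq ev p.1 - ev p.2 | p <- enum [pred p : 'I_k.+1 * 'I_k.+1 | p.1 != p.2]].

Definition rsD (k : nat) : seq 'rV[R]_k :=
  flatten [seq [:: ev p.1 + ev p.2; ev p.1 - ev p.2; - ev p.1 + ev p.2;
                   - ev p.1 - ev p.2]
          | p <- enum [pred p : 'I_k * 'I_k | (p.1 < p.2)%N]].

Definition rsE8 : seq 'rV[R]_8 :=
  rsD 8 ++
  [seq \row_i (if s i then - 2^-1 else 2^-1)
   | s : {ffun 'I_8 -> bool} <- enum [pred s : {ffun 'I_8 -> bool} | ~~ odd #|[pred i | s i]|]].

Definition halfones : 'rV[R]_8 := \row_(i < 8) 2^-1.
Definition halfones' : 'rV[R]_8 :=
  \row_(i < 8) (if i == 0 :> nat then - 2^-1 else 2^-1).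

Definition rsE7 : seq 'rV[R]_8 :=
  [seq x <- rsE8 | dotv x halfones == 0].

(* E_6: roots of E_8 orthogonal to the A_2 sub-root-system spanned by the
   two E_8 roots (1/2,...,1/2) and e_0 + e_1 (inner product 1) *)
Definition a2vec : 'rV[R]_8 := ev (0 : 'I_8) + ev (1 : 'I_8).
Definition rsE6 : seq 'rV[R]_8 :=
  [seq x <- rsE8 | (dotv x halfones == 0) && (dotv x a2vec == 0)].

Definition osum {a b} (S : seq 'rV[R]_a) (T : seq 'rV[R]_b) : seq 'rV[R]_(a + b) :=
  [seq row_mx x 0 | x <- S] ++ [seq row_mx 0 y | y <- T].

End RootSystems.

(* Main.v *)
(** For a strongly eutactic root system of norm 2 spanning R^n with Coxeter
number [h], every root has exactly [2h - 4] neighbours at inner product 1, so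
the sum over the roots of the zonal harmonic of degree [2j] centred at a root
depends only on [n] and [h].  Since zonal harmonics represent point evaluation
for the Fischer product, which is positive, the vanishing of this one number is
equivalent to [(C_2j)].  For each [j] this is a diophantine equation, linear in
[h], whose solutions with [h] an admissible integer form a finite list.

It remains to see which pairs [(n, h)] occur.  When [h] is large with respect
to [n], the system contains a [D_4]; a maximal [D_k] inside it is either a
whole component, so that [h = 2k - 2], or it is joined by a half-spin root,
which yields an [E_6].  A root outside an [E_6] or [E_7] but not orthogonal to
it can be chosen minuscule, and thus extends it to [E_7] or [E_8]; hence [h] is
12, 18 or 30.  This identifies the genuine solutions and excludes the spurious
ones. *)

Require Import Defs.
From HB Require Import structures.
From mathcomp Require Import all_boot all_order all_algebra.
From mathcomp Require Import reals.
From mathcomp Require Import mpoly ssrcomplements bigenough.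
From mathcomp Require Import ring lra zify.

Set Implicit Arguments.
Unset Strict Implicit.
Unset Printing Implicit Defensive.

Import Order.TTheory GRing.Theory Num.Theory BigEnough.
Local Open Scope ring_scope.

(** * The Fischer product *)

(** The threshold for a large [h] is [n + 1], the Coxeter number of A_n. With [N = 2h - 4]
    neighbours per root it reads [2n < N + 2], the form in which it recurs below. It is sharp for
    the argument: under it, the neighbours of a root [c] that are orthogonal to one of them are too
    numerous to be independent together with [c] and that neighbour, and this produces the D4. The
    classification of root systems is not invoked. A subsystem of type D is held as an orthonormal
    frame, one of type E as a base with prescribed Gram matrix whose roots are listed by
    computation. One component is enough to find [h], since all components share it; and once [n]
    and [h] are known, cardinality shows that the roots generated by a base exhaust [Phi]. *)

Section Fischer.
Variables (R : realType) (n : nat).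
Implicit Types (p q f : {mpoly R[n]}) (a x : 'rV[R]_n).

(** The apolar pairing: [p], read as a differential operator, is applied to [q] and evaluated at 0.
    The sum runs over the support of [p], so linearity in [p] goes through [fischerwE], which brings
    all supports under one degree bound. *)
Definition fischer p q : R := \sum_(m <- msupp p) p@_m * (q^`M[m])@_0.

Lemma fischerwE k p q : (msize p <= k)%N ->
  fischer p q = \sum_(m : 'X_{1..n < k}) p@_m * (q^`M[m])@_0.
Proof.
pose I : subFinType _ := 'X_{1..n < k}.
move=> le_pk; rewrite /fischer (big_mksub I) /=; first last.
  by move=> x /msize_mdeg_lt/leq_trans/(_ le_pk).
  by rewrite msupp_uniq.
by rewrite big_rmcond //= => j /memN_msupp_eq0 ->; rewrite mul0r.
Qed.
Arguments fischerwE k [p].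

Lemma fischer_linear q : linear_for *%R (fischer^~ q).
Proof.
move=> c p p'; pose_big_enough j; first rewrite !(fischerwE j) //.
  rewrite mulr_sumr -big_split /=; apply/eq_bigr=> k _.
  by rewrite mcoeffD mcoeffZ mulrDl mulrA.
by close.
Qed.

Lemma fischerD p1 p2 q : fischer (p1 + p2) q = fischer p1 q + fischer p2 q.
Proof. by rewrite -[p1]scale1r fischer_linear mul1r scale1r. Qed.

Lemma fischer0 q : fischer 0 q = 0.
Proof. by rewrite /fischer msupp0 big_nil. Qed.

Lemma fischerZ c p q : fischer (c *: p) q = c * fischer p q.
Proof. by rewrite -[c *: p]addr0 fischer_linear fischer0 addr0. Qed.

Lemma fischer_suml (I : Type) (r : seq I) (F : I -> {mpoly R[n]}) q :
  fischer (\sum_(i <- r) F i) q = \sum_(i <- r) fischer (F i) q.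
Proof.
by elim: r => [|i r IH]; rewrite ?big_nil ?fischer0 // !big_cons fischerD IH.
Qed.

Lemma fischerX m q : fischer 'X_[m] q = (q^`M[m])@_0.
Proof. by rewrite /fischer msuppX big_seq1 mcoeffX eqxx mul1r. Qed.

Lemma fischer_sumr (I : Type) (r : seq I) (P : pred I) p (F : I -> {mpoly R[n]}) :
  fischer p (\sum_(i <- r | P i) F i) = \sum_(i <- r | P i) fischer p (F i).
Proof.
rewrite /fischer exchange_big /=; apply: eq_bigr => m _.
by rewrite [(\sum_(i <- r | P i) F i)^`M[m]]raddf_sum /= raddf_sum mulr_sumr.
Qed.

Lemma fischerZr c p q : fischer p (c *: q) = c * fischer p q.
Proof.
rewrite /fischer mulr_sumr; apply: eq_bigr => m _.
by rewrite mderivmZ mcoeffZ mulrCA.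
Qed.

Lemma fischer0r p : fischer p 0 = 0.
Proof. by rewrite -[0](scale0r (0 : {mpoly R[n]})) fischerZr mul0r. Qed.

(** Monomials are orthogonal, and the square norm of ['X_[m]] is the product of the factorials of
    its exponents. So [fischer p p] is a positively weighted sum of squares of coefficients. *)
Lemma fischer_gt0 p : p != 0 -> 0 < fischer p p.
Proof.
move=> p0; rewrite /fischer.
have H m : p@_m * (p^`M[m])@_0 = p@_m ^+ 2 * (\prod_(i < n) (m i)`!)%:R.
  rewrite mcoeff_mderivm addm0 (eq_bigr (fun i => (m i)`!)) => [|i _].
    by rewrite -[in LHS]mulr_natr mulrA expr2.
  by rewrite ffactnn.
have Hge m : 0 <= p@_m * (p^`M[m])@_0 by rewrite H mulr_ge0 // ?sqr_ge0 ?ler0n.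
rewrite lt_neqAle sumr_ge0 // andbT eq_sym psumr_neq0 //.
apply/hasP; exists (mlead p); first exact: mlead_supp.
rewrite H /= mulr_gt0 // ?ltr0n ?prodn_gt0 // => [|i]; last exact: fact_gt0.
by rewrite exprn_even_gt0 //= mcoeff_eq0 mlead_supp.
Qed.

(** Adjointness on variables; by linearity [lform a] is then adjoint to the derivative along [a],
    and [qform] to the Laplacian. *)
Lemma fischerMX i p q : fischer ('X_i * p) q = fischer p (q^`M(i)).
Proof.
elim/mpolyind: p => [|c m p _ _ IH]; first by rewrite mulr0 !fischer0.
rewrite mulrDr -scalerAr !fischerD !fischerZ IH -mpolyXD !fischerX.
by rewrite mderivmDm mderivmU1m.
Qed.

Definition lform a : {mpoly R[n]} := \sum_i a 0 i *: 'X_i.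
Definition qform : {mpoly R[n]} := \sum_i 'X_i ^+ 2.
Definition dderiv a q : {mpoly R[n]} := \sum_i a 0 i *: q^`M(i).

Lemma fischer_lformM a p q : fischer (lform a * p) q = fischer p (dderiv a q).
Proof.
rewrite /lform mulr_suml fischer_suml fischer_sumr; apply: eq_bigr => i _.
by rewrite -scalerAl fischerZ fischerZr fischerMX.
Qed.

Lemma fischer_qformM p q : fischer (qform * p) q = fischer p (laplacian q).
Proof.
rewrite /qform mulr_suml fischer_suml fischer_sumr; apply: eq_bigr => i _.
by rewrite expr2 -mulrA !fischerMX.
Qed.

Lemma homogeneousE d p : homogeneous d p = (p \is d.-homog for mdeg).
Proof. by []. Qed.

Lemma mderiv_homog d i p : p \is d.+1.-homog for mdeg -> p^`M(i) \is d.-homog for mdeg.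
Proof.
move=> /dhomogP hp; apply/dhomogP => m; rewrite mcoeff_msupp mcoeff_mderiv.
rewrite mulrn_eq0 negb_or /= -mcoeff_msupp => /hp /= /eqP.
by rewrite mdegD mdeg1 addn1 eqSS => /eqP.
Qed.

Lemma dderiv_homog d a p : p \is d.+1.-homog for mdeg -> dderiv a p \is d.-homog for mdeg.
Proof.
by move=> hp; apply: rpred_sum => i _; apply: rpredZ; apply: mderiv_homog.
Qed.

Lemma euler_identity d p : p \is d.-homog for mdeg ->
  \sum_i 'X_i * p^`M(i) = d%:R *: p.
Proof.
move=> hp; apply/mpolyP => m; rewrite raddf_sum /= mcoeffZ.
have H i : ('X_i * p^`M(i))@_m = (m i)%:R * p@_m.
  rewrite mulrC; case: (posnP (m i)) => [mi0|mi].
    rewrite mi0 mul0r; apply: memN_msupp_eq0; apply/negP.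
    rewrite (perm_mem (msuppMX _ _)) => /mapP [m' _ E].
    by move: mi0; rewrite E mnmDE mnm1E eqxx.
  have le : (U_(i) <= m)%MM.
    by apply/mnm_lepP => j; rewrite mnm1E; case: eqP => [<-|].
  rewrite -{1}(submK le) addmC mcoeffMX mcoeff_mderiv submK // mnmBE mnm1E eqxx.
  by rewrite subn1 prednK // mulr_natl.
rewrite (eq_bigr _ (fun i _ => H i)) -mulr_suml -natr_sum -mdegE.
case: (boolP (m \in msupp p)) => [/(dhomog_mf hp) -> //|/memN_msupp_eq0 ->].
by rewrite !mulr0.
Qed.

Lemma evalv_dderiv d a p : p \is d.-homog for mdeg ->
  evalv (dderiv a p) a = d%:R * evalv p a.
Proof.
move=> /euler_identity /(congr1 (fun q => evalv q a)); rewrite /evalv mevalZ => <-.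
rewrite /dderiv !raddf_sum /=; apply: eq_bigr => i _.
by rewrite mevalZ mevalM mevalXU.
Qed.

(** Each factor [lform a] moved to the other side becomes a derivative along [a]. Euler's identity
    evaluates it at [a], and the successive degrees multiply to [d!]. *)
Lemma fischer_lformX d a p : p \is d.-homog for mdeg ->
  fischer (lform a ^+ d) p = d`!%:R * evalv p a.
Proof.
elim: d p => [|d IH] p hp.
  rewrite expr0 -mpolyX0 fischerX mderivm0m fact0 mul1r.
  suff -> : p = (p@_0)%:MP by rewrite /evalv mevalC mcoeffC eqxx mulr1.
  apply/mpolyP => m; rewrite mcoeffC.
  have [<-|m0] := eqVneq 0%MM m; first by rewrite mulr1.
  rewrite mulr0; apply: (dhomog_nemf_coeff hp).
  by rewrite mdeg_eq0 eq_sym.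
rewrite exprS fischer_lformM IH; last exact: dderiv_homog.
by rewrite (evalv_dderiv a hp) factS natrM mulrA (mulrC _%:R d.+1%:R).
Qed.

Lemma mderiv_X i j : ('X_j : {mpoly R[n]})^`M(i) = (i == j)%:R.
Proof.
rewrite mderivX mnm1E eq_sym; case: eqP => [->|_]; last by rewrite scale0r.
have -> : (U_(j) - U_(j) = 0)%MM by apply/mnmP => l; rewrite mnmBE subnn mnm0E.
by rewrite mpolyX0 scale1r.
Qed.

Lemma mderiv_lform i a : (lform a)^`M(i) = (a 0 i)%:MP.
Proof.
rewrite /lform raddf_sum /= (bigD1 i) //= big1 ?addr0 => [|j ji].
  by rewrite mderivZ mderiv_X eqxx -mul_mpolyC mulr1.
by rewrite mderivZ mderiv_X eq_sym (negbTE ji) scaler0.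
Qed.

Lemma mderiv_qform i : qform^`M(i) = 2%:R *: 'X_i.
Proof.
rewrite /qform raddf_sum /= (bigD1 i) //= big1 ?addr0 => [|j ji].
  by rewrite expr2 mderivM mderiv_X eqxx mul1r mulr1 scaler_nat.
by rewrite expr2 mderivM mderiv_X eq_sym (negbTE ji) mul0r mulr0 addr0.
Qed.

Lemma mderiv_exp i p k : (p ^+ k)^`M(i) = k%:R *: (p ^+ k.-1 * p^`M(i)).
Proof.
elim: k => [|k IH]; first by rewrite expr0 scale0r -mpolyC1 mderivC.
rewrite exprS mderivM IH /=; case: k IH => [|k] IH.
  by rewrite !scale0r mulr0 addr0 scale1r expr0 mulrC.
rewrite -scalerAr mulrA -exprS /= mulrC -[in RHS]natr1 scalerDl scale1r addrC.
by rewrite (mulrC (p ^+ _)).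
Qed.

Lemma laplacianD p q : laplacian (p + q) = laplacian p + laplacian q.
Proof. by rewrite -big_split /=; apply: eq_bigr => i _; rewrite !mderivD. Qed.

Lemma laplacianZ c p : laplacian (c *: p) = c *: laplacian p.
Proof. by rewrite scaler_sumr; apply: eq_bigr => i _; rewrite !mderivZ. Qed.

Lemma laplacian0 : laplacian (0 : {mpoly R[n]}) = 0.
Proof. by rewrite -[in LHS](scale0r (0 : {mpoly R[n]})) laplacianZ scale0r. Qed.

Lemma laplacian_sum (I : Type) (r : seq I) (F : I -> {mpoly R[n]}) :
  laplacian (\sum_(i <- r) F i) = \sum_(i <- r) laplacian (F i).
Proof.
by elim: r => [|i r IH]; rewrite ?big_nil ?laplacian0 // !big_cons laplacianD IH.
Qed.

Lemma qformE : qform = \sum_i 'X_i * 'X_i.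
Proof. by apply: eq_bigr => i _; rewrite expr2. Qed.

End Fischer.

(** * Zonal harmonics *)

Section Zonal.
Variables (R : realType) (n : nat).
Implicit Types (p q f : {mpoly R[n]}) (a x : 'rV[R]_n).

(** Here and in the next lemma, powers with truncated exponents such as [k.-1] are independent
    letters, which turns the product rule into a plain ring identity. *)
Lemma zonal_deriv_id (A : comNzRingType) (k i l1 lk qi q1 u x : A) :
  k * (l1 * u) * qi + lk * (i * (q1 * (2 * x))) =
  k * (l1 * u * qi) + 2 * i * (lk * q1 * x).
Proof. by ring. Qed.

Lemma zonal_deriv2_id (A : comNzRingType) (k k1 i i1 l1 l2 lk qi q1 q2 u x : A) :
  k * ((k1 * (l2 * u) * u + l1 * 0) * qi + l1 * u * (i * (q1 * (2 * x)))) +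
  2 * i * ((k * (l1 * u) * q1 + lk * (i1 * (q2 * (2 * x)))) * x + lk * q1 * 1) =
  k * k1 * (l2 * qi) * (u * u) + 4 * k * i * (l1 * q1) * (u * x) +
  4 * i * i1 * (lk * q2) * (x * x) + 2 * i * (lk * q1).
Proof. by ring. Qed.

Lemma mpoly_natZ k p : k%:R *: p = k%:R * p.
Proof. by rewrite -mul_mpolyC mpolyC_nat. Qed.

(** The gradients of [lform a] and [qform] are [a] and twice the position vector, so the mixed term
    is again a multiple of [lform a]. Truncated predecessors do no harm: whenever one is truncated,
    its coefficient is zero. *)
Lemma laplacian_zonal_term a k i :
  laplacian (lform a ^+ k * @qform R n ^+ i) =
    (k * k.-1)%:R * dotv a a *: (lform a ^+ k.-2 * @qform R n ^+ i) +
    (2 * i * (n + 2 * i.-1 + 2 * k))%:R *: (lform a ^+ k * @qform R n ^+ i.-1).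
Proof.
have D1 i' : (lform a ^+ k * @qform R n ^+ i)^`M(i') =
    k%:R * (lform a ^+ k.-1 * (a 0 i')%:MP * @qform R n ^+ i) +
    2 * i%:R * (lform a ^+ k * @qform R n ^+ i.-1 * 'X_i').
  rewrite mderivM !mderiv_exp mderiv_lform mderiv_qform !mpoly_natZ.
  exact: zonal_deriv_id.
have D2 i' : (lform a ^+ k * @qform R n ^+ i)^`M(i')^`M(i') =
    k%:R * k.-1%:R * (lform a ^+ k.-2 * @qform R n ^+ i) * ((a 0 i')%:MP * (a 0 i')%:MP) +
    4 * k%:R * i%:R * (lform a ^+ k.-1 * @qform R n ^+ i.-1) * ((a 0 i')%:MP * 'X_i') +
    4 * i%:R * i.-1%:R * (lform a ^+ k * @qform R n ^+ i.-2) * ('X_i' * 'X_i') +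
    2 * i%:R * (lform a ^+ k * @qform R n ^+ i.-1).
  have DN (k' : nat) p : (k'%:R * p)^`M(i') = k'%:R * p^`M(i').
    by rewrite -!mpoly_natZ mderivZ.
  rewrite -zonal_deriv2_id D1 mderivD -natrM !DN.
  rewrite !mderivM !mderiv_exp mderivC mderiv_lform mderiv_qform mderiv_X eqxx.
  by rewrite !mpoly_natZ natrM.
rewrite /laplacian (eq_bigr _ (fun i' _ => D2 i')) !big_split /= -!mulr_sumr.
have -> : \sum_(i0 < n) (a 0 i0)%:MP_[n] * (a 0 i0)%:MP = (dotv a a)%:MP.
  rewrite /dotv !mxE raddf_sum /=; apply: eq_bigr => j _.
  by rewrite !mxE mpolyCM.
have -> : \sum_(i0 < n) (a 0 i0)%:MP * 'X_i0 = lform a.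
  by apply: eq_bigr => j _; rewrite mul_mpolyC.
rewrite -qformE sumr_const card_ord.
rewrite !(natrM, natrD) -!mul_mpolyC !(mpolyCM, mpolyCD, mpolyC_nat) -[_ *+ n]mulr_natl.
have -> : 4 * k%:R * i%:R * (lform a ^+ k.-1 * @qform R n ^+ i.-1) * lform a =
          4 * k%:R * i%:R * (lform a ^+ k * @qform R n ^+ i.-1).
  case: k {D1 D2} => [|k] /=; first by rewrite mulr0 !mul0r.
  by rewrite exprSr -!mulrA [in LHS](mulrC _ (lform a)).
have -> : 4 * i%:R * i.-1%:R * (lform a ^+ k * @qform R n ^+ i.-2) * @qform R n =
          4 * i%:R * i.-1%:R * (lform a ^+ k * @qform R n ^+ i.-1).
  case: i {D1 D2} => [|[|i]] /=; [by rewrite mulr0 !mul0r|by rewrite mulr0 !mul0r|].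
  by rewrite exprSr -!mulrA.
have H (A : comNzRingType) (k0 k1 i0 i1 n0 s t u v w : A) : u = v * w ->
    k0 * k1 * s * t + 4 * k0 * i0 * u + 4 * i0 * i1 * u + 2 * i0 * (v * (n0 * w)) =
    k0 * k1 * t * s + 2 * i0 * (n0 + 2 * i1 + 2 * k0) * u by move=> ->; ring.
by apply: H.
Qed.

Lemma evalv_lform a x : evalv (lform a) x = dotv a x.
Proof.
rewrite /evalv /lform raddf_sum /= /dotv !mxE; apply: eq_bigr => i _.
by rewrite mevalZ mevalXU !mxE.
Qed.

Lemma evalv_qform x : evalv (@qform R n) x = dotv x x.
Proof.
rewrite /evalv /qform raddf_sum /= /dotv !mxE; apply: eq_bigr => i _.
by rewrite rmorphXn /= mevalXU !mxE expr2.
Qed.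

Lemma lform_homog a : lform a \is 1.-homog for mdeg.
Proof.
by apply: rpred_sum => i _; apply: rpredZ; rewrite dhomogX /= mdeg1.
Qed.

Lemma qform_homog : @qform R n \is 2.-homog for mdeg.
Proof.
by apply: rpred_sum => i _; rewrite -[2%N]/(1 * 2)%N dhomogMn // dhomogX /= mdeg1.
Qed.

(* Coefficients of the zonal harmonic of degree [2 j] attached to a vector of
   squared norm 2. *)
Fixpoint zcoef (j i : nat) : R :=
  if i is i'.+1 then
    - (zcoef j i' * ((2 * (j - i'))%:R * (2 * (j - i')).-1%:R) /
       (i%:R * (n%:R + (2 * i' + 4 * (j - i))%:R)))
  else 1.

Definition zonal j a : {mpoly R[n]} :=
  \sum_(i < j.+1) zcoef j i *: (lform a ^+ (2 * (j - i)) * @qform R n ^+ i).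

Lemma zonal_homog j a : homogeneous (2 * j) (zonal j a).
Proof.
rewrite homogeneousE; apply: rpred_sum => i _; apply: rpredZ.
have -> : (2 * j = 1 * (2 * (j - i)) + 2 * i)%N by have := ltn_ord i; lia.
apply: dhomogM; first exact: dhomogMn (lform_homog a).
exact: dhomogMn qform_homog.
Qed.

Lemma laplacian_zonal j a : (0 < n)%N -> dotv a a = 2 -> laplacian (zonal j a) = 0.
Proof.
move=> n0 a2; rewrite /zonal laplacian_sum.
under eq_bigr => i _ do rewrite laplacianZ laplacian_zonal_term a2 scalerDr.
(* The last term has no factor [lform a] and the first no factor [qform], so one half of each drops
   out. After a shift, equal monomials face each other, and the recursion of [zcoef] makes them
   cancel. *)
rewrite big_split /= big_ord_recr [in X in _ + X]big_ord_recl /= subnn muln0 mul0n.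
rewrite mul0r scale0r scaler0 mul0n scale0r scaler0 add0r addr0 -big_split big1 //= => i _.
rewrite !scalerA /bump /= !add1n !add0n.
have -> : (2 * (j - i)).-2 = (2 * (j - i.+1))%N by lia.
rewrite -scalerDl; set A := zcoef j i.
pose d : R := i.+1%:R * (n%:R + (2 * i + 4 * (j - i.+1))%:R).
pose e : R := (2 * (j - i))%:R * (2 * (j - i)).-1%:R.
rewrite [(2 * (j - i) * _)%:R]natrM -/e -/d.
have dE : d = (i.+1 * (n + (2 * i + 4 * (j - i.+1))))%:R by rewrite natrM natrD.
have d0 : d != 0 by rewrite dE pnatr_eq0 muln_eq0; lia.
have -> : (2 * i.+1 * (n + 2 * i + 2 * (2 * (j - i.+1))))%:R = 2 * d :> R.
  by rewrite dE -natrM; congr _%:R; lia.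
suff -> : A * (e * 2) + - (A * e / d) * (2 * d) = 0 by rewrite scale0r.
by clearbody A d e; field.
Qed.

Lemma harmonic_zonal j a : (0 < n)%N -> dotv a a = 2 -> harmonic (2 * j) (zonal j a).
Proof. by move=> n0 a2; split; [exact: zonal_homog|exact: laplacian_zonal]. Qed.

Lemma evalv_zonal j a x :
  evalv (zonal j a) x =
  \sum_(i < j.+1) zcoef j i * (dotv a x ^+ (2 * (j - i)) * dotv x x ^+ i).
Proof.
rewrite -evalv_lform -evalv_qform /evalv /zonal raddf_sum /=; apply: eq_bigr => i _.
by rewrite mevalZ mevalM !rmorphXn.
Qed.

(** All terms but the first contain [qform], whose adjoint kills the harmonic [f]; the first is a
    pure power of [lform a]. *)
Lemma fischer_zonal j a f : harmonic (2 * j) f ->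
  fischer (zonal j a) f = (2 * j)`!%:R * evalv f a.
Proof.
move=> [hf lf]; rewrite /zonal big_ord_recl /= subn0 scale1r expr0 mulr1.
rewrite fischerD fischer_lformX // fischer_suml big1 ?addr0 // => i _.
by rewrite fischerZ /bump /= add1n exprS [lform a ^+ _ * _]mulrCA fischer_qformM lf fischer0r mulr0.
Qed.

(** For the converse, the sum [H] of the zonal harmonics of all roots is its own test function:
    [fischer H H] is a multiple of the sum of [H] over [Phi], which vanishes. So [H = 0], and
    pairing [H] with [f] gives the sum of [f]. *)
Lemma design_cond_zonal j (Phi : seq 'rV[R]_n) :
  (0 < n)%N -> {in Phi, forall a, dotv a a = 2} ->
  design_cond Phi (2 * j) <->
  {in Phi, forall a, \sum_(x <- Phi) evalv (zonal j a) x = 0}.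
Proof.
move=> n0 Phi2; split=> [D a /Phi2 a2|Z f hf]; first exact: D (harmonic_zonal j n0 a2).
pose H := \sum_(a <- Phi) zonal j a.
have hH : harmonic (2 * j) H.
  split; last by rewrite laplacian_sum big1_seq // => a /Phi2 /(laplacian_zonal j n0).
  by rewrite homogeneousE; apply: rpred_sum => a _; exact: zonal_homog.
have FH g : harmonic (2 * j) g ->
    fischer H g = (2 * j)`!%:R * \sum_(a <- Phi) evalv g a.
  move=> hg; rewrite fischer_suml mulr_sumr; apply: eq_bigr => a _.
  exact: fischer_zonal.
have H0 : H = 0.
  apply/eqP/negPn/negP => /fischer_gt0; rewrite FH // /H.
  under eq_bigr => a _ do rewrite /evalv raddf_sum /=.
  rewrite exchange_big /= big1_seq ?mulr0 ?ltxx //.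
apply/eqP; have /eqP := FH f hf; rewrite H0 fischer0 eq_sym mulf_eq0 pnatr_eq0.
by rewrite -leqn0 leqNgt fact_gt0.
Qed.

End Zonal.

(** * Simply laced root systems *)

Section Dot.
Variables (R : realType) (n : nat).
Implicit Types (x y z : 'rV[R]_n) (Phi : seq 'rV[R]_n).

Lemma dotvE x y : dotv x y = \sum_i x 0 i * y 0 i.
Proof. by rewrite /dotv mxE; apply: eq_bigr => i _; rewrite mxE. Qed.

Lemma dotvC x y : dotv x y = dotv y x.
Proof. by rewrite !dotvE; apply: eq_bigr => i _; rewrite mulrC. Qed.

Lemma dotvDl x y z : dotv (x + y) z = dotv x z + dotv y z.
Proof. by rewrite /dotv mulmxDl mxE. Qed.

Lemma dotvZl c x y : dotv (c *: x) y = c * dotv x y.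
Proof. by rewrite /dotv -scalemxAl mxE. Qed.

Lemma dotvNl x y : dotv (- x) y = - dotv x y.
Proof. by rewrite -scaleN1r dotvZl mulN1r. Qed.

Lemma dotvBl x y z : dotv (x - y) z = dotv x z - dotv y z.
Proof. by rewrite dotvDl dotvNl. Qed.

Lemma dotv0l x : dotv 0 x = 0.
Proof. by rewrite /dotv mul0mx mxE. Qed.

Lemma dotvDr x y z : dotv z (x + y) = dotv z x + dotv z y.
Proof. by rewrite dotvC dotvDl !(dotvC z). Qed.

Lemma dotvZr c x y : dotv x (c *: y) = c * dotv x y.
Proof. by rewrite dotvC dotvZl dotvC. Qed.

Lemma dotvNr x y : dotv x (- y) = - dotv x y.
Proof. by rewrite dotvC dotvNl dotvC. Qed.

Lemma dotvBr x y z : dotv z (x - y) = dotv z x - dotv z y.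
Proof. by rewrite dotvDr dotvNr. Qed.

Lemma dotv0r x : dotv x 0 = 0.
Proof. by rewrite dotvC dotv0l. Qed.

Definition dotvL := (dotvDl, dotvBl, dotvNl, dotvZl, dotv0l,
  dotvDr, dotvBr, dotvNr, dotvZr, dotv0r).

Lemma dotv_suml (I : Type) (r : seq I) (P : pred I) (F : I -> 'rV[R]_n) x :
  dotv (\sum_(i <- r | P i) F i) x = \sum_(i <- r | P i) dotv (F i) x.
Proof. by rewrite /dotv mulmx_suml summxE. Qed.

Lemma dotv_ge0 x : 0 <= dotv x x.
Proof. by rewrite dotvE sumr_ge0 // => i _; rewrite -expr2 sqr_ge0. Qed.

Lemma dotv_eq0 x : (dotv x x == 0) = (x == 0).
Proof.
apply/idP/eqP => [|->]; last by rewrite dotv0l.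
rewrite dotvE psumr_eq0 => [/allP H|i _]; last by rewrite -expr2 sqr_ge0.
apply/rowP => i; rewrite mxE; apply/eqP.
by have := H i; rewrite mem_index_enum -expr2 sqrf_eq0 => /(_ isT).
Qed.

Lemma dotv_mulmx m (M : 'M[R]_(n, m)) x y :
  M *m M^T = 1%:M -> dotv (x *m M) (y *m M) = dotv x y.
Proof. by move=> HM; rewrite /dotv trmx_mul mulmxA -(mulmxA x) HM mulmx1. Qed.

(** The axioms specialised to norm 2. This form is inherited by the roots orthogonal to a given set,
    which need not span. *)
Definition simply_laced Phi := [/\ uniq Phi, norm2 Phi,
  {in Phi &, forall x y, x - dotv x y *: y \in Phi} &
  {in Phi &, forall x y, dotv x y \is a Num.int}].

Lemma root_system_simply_laced Phi : root_system Phi -> norm2 Phi -> simply_laced Phi.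
Proof.
move=> [U _ C I] N; split=> // x y xP yP.
  by have := C x y xP yP; rewrite /refl (N y yP) mulrAC divff ?mul1r ?pnatr_eq0.
by have := I x y xP yP; rewrite (N x xP) mulrAC divff ?mul1r ?pnatr_eq0.
Qed.

End Dot.

Section SimplyLaced.
Variables (R : realType) (n : nat) (Phi : seq 'rV[R]_n).
Hypothesis slP : simply_laced Phi.
Implicit Types (x y z a b : 'rV[R]_n).

Let PhiU : uniq Phi. Proof. by case: slP. Qed.
Let Phi2 : norm2 Phi. Proof. by case: slP. Qed.
Let PhiC x y : x \in Phi -> y \in Phi -> x - dotv x y *: y \in Phi.
Proof. by case: slP => _ _ C _; exact: C. Qed.

Lemma root_opp x : x \in Phi -> - x \in Phi.
Proof.
move=> xP; have := PhiC xP xP; rewrite (Phi2 xP) -[X in X - _]scale1r -scalerBl.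
by rewrite (_ : 1 - 2 = -1); [rewrite scaleN1r|ring].
Qed.

Lemma root_oppE x : (- x \in Phi) = (x \in Phi).
Proof. by apply/idP/idP => /root_opp //; rewrite opprK. Qed.

Lemma root_sub x y : x \in Phi -> y \in Phi -> dotv x y = 1 -> x - y \in Phi.
Proof. by move=> xP yP xy; have := PhiC xP yP; rewrite xy scale1r. Qed.

Lemma root_dot_le x y : x \in Phi -> y \in Phi -> dotv x y <= 2.
Proof.
move=> xP yP; have := dotv_ge0 (x - y).
by rewrite !dotvL (dotvC y x) (Phi2 xP) (Phi2 yP); lra.
Qed.

Lemma root_dot_eq2 x y : x \in Phi -> y \in Phi -> dotv x y = 2 -> x = y.
Proof.
move=> xP yP xy; apply/eqP; rewrite -subr_eq0 -dotv_eq0 !dotvL (dotvC y x).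
by rewrite (Phi2 xP) (Phi2 yP) xy; apply/eqP; ring.
Qed.

(** The bound by 2, applied to [y] and to [- y], leaves five integers; the extreme ones force
    equality in Cauchy-Schwarz. *)
Lemma root_dot_cases x y : x \in Phi -> y \in Phi ->
  x = y \/ x = - y \/ dotv x y = 1 \/ dotv x y = -1 \/ dotv x y = 0.
Proof.
move=> xP yP; have l1 := root_dot_le xP yP.
have l2 := root_dot_le xP (root_opp yP); rewrite dotvNr in l2.
have [m E] : exists m : int, dotv x y = m%:~R.
  by apply/intrP; case: slP => _ _ _; apply.
have {l1} m2 : (m <= 2)%R by rewrite -(ler_int R) -E.
have {l2} m2' : (- m <= 2)%R by rewrite -(ler_int R) rmorphN /= -E.
have : m = 2 \/ m = -2 \/ m = 1 \/ m = -1 \/ m = 0 by lia.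
case=> [|[|[|[|]]]] mE; rewrite mE in E.
- by left; apply: root_dot_eq2.
- right; left; apply: root_dot_eq2 => //; first exact: root_opp.
  by rewrite dotvNr E; ring.
- by do 2 right; left.
- by do 3 right; left; rewrite E.
- by do 4 right.
Qed.

Lemma root_neq0 x : x \in Phi -> x != 0.
Proof. by move=> xP; rewrite -dotv_eq0 (Phi2 xP) pnatr_eq0. Qed.

Lemma root_neq_opp x : x \in Phi -> x != - x.
Proof.
move=> xP; apply/eqP => E; have := Phi2 xP; rewrite {1}E dotvNl (Phi2 xP); lra.
Qed.

Definition reflv a x := x - dotv x a *: a.

Lemma reflvK a : a \in Phi -> involutive (reflv a).
Proof.
move=> aP x; rewrite /reflv !dotvL (Phi2 aP) -addrA -opprD -scalerDl.
by rewrite (_ : dotv x a + (_ - _) = 0); [rewrite scale0r subr0|ring].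
Qed.

Lemma reflv_dot a x y : dotv (reflv a x) y = dotv x (reflv a y).
Proof. by rewrite /reflv !dotvL (dotvC y a); ring. Qed.

Lemma reflv_perm a : a \in Phi -> perm_eq (map (reflv a) Phi) Phi.
Proof.
move=> aP; have inj := can_inj (reflvK aP).
have U : uniq (map (reflv a) Phi) by rewrite map_inj_uniq.
have sub : {subset map (reflv a) Phi <= Phi}.
  by move=> y /mapP [z zP ->]; exact: PhiC.
apply: uniq_perm => //.
by have [|_] := uniq_min_size U sub; rewrite ?size_map.
Qed.

(** The frame operator of [Phi]. Division by 2, the norm of a root, makes [root_lam] its eigenvalue
    at a root. *)
Definition root_frame x : 'rV[R]_n := \sum_(z <- Phi) dotv z x *: z.
Definition root_lam x : R := (\sum_(z <- Phi) dotv z x ^+ 2) / 2.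

(** The reflection in [a] permutes [Phi], so it commutes with the frame operator. The image of [a]
    is therefore negated by this reflection, hence proportional to [a]. *)
Lemma root_frameE a : a \in Phi -> root_frame a = root_lam a *: a.
Proof.
move=> aP.
have E : reflv a (root_frame a) = - root_frame a.
  have -> : reflv a (root_frame a) = \sum_(z <- Phi) dotv z a *: reflv a z.
    rewrite /reflv /root_frame dotv_suml scaler_suml -sumrB.
    apply: eq_bigr => z _; rewrite dotvZl scalerBr scalerA; congr (_ - _ *: _).
  rewrite -(perm_big _ (reflv_perm aP)) big_map /= /root_frame -sumrN.
  apply: eq_bigr => z _; rewrite reflv_dot reflvK // -scaleNr; congr (_ *: _).
  by rewrite /reflv !dotvL (Phi2 aP); ring.
have D : dotv (root_frame a) a = 2 * root_lam a.
  rewrite /root_frame dotv_suml /root_lam mulrC divfK ?pnatr_eq0 //.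
  by apply: eq_bigr => z _; rewrite dotvZl expr2.
move: E; rewrite /reflv D => /eqP; rewrite subr_eq addrC -subr_eq opprK -mulr2n.
rewrite -scaler_nat -scalerA => /eqP /scalerI -> //.
by rewrite pnatr_eq0.
Qed.

(** The frame operator is self-adjoint, so eigenvectors with distinct eigenvalues are orthogonal. *)
Lemma root_lam_adj a b : a \in Phi -> b \in Phi -> dotv a b != 0 ->
  root_lam a = root_lam b.
Proof.
move=> aP bP ab; apply: (mulIf ab).
have : dotv (root_frame a) b = dotv (root_frame b) a.
  rewrite /root_frame !dotv_suml; apply: eq_bigr => z _.
  by rewrite !dotvZl mulrC.
by rewrite !root_frameE // !dotvZl (dotvC b a).
Qed.

Lemma root_lam_gt0 a : a \in Phi -> 0 < root_lam a.
Proof.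
move=> aP; rewrite /root_lam divr_gt0 ?ltr0n // (bigD1_seq a) //= (Phi2 aP).
by rewrite ltr_pwDl ?exprn_gt0 ?ltr0n // sumr_ge0 // => z _; rewrite sqr_ge0.
Qed.

End SimplyLaced.

(** * Traces of frame operators and Coxeter numbers *)

Lemma mxtrace_idempotent (F : fieldType) (n : nat) (Q : 'M[F]_n) :
  Q *m Q = Q -> \tr Q = (\rank Q)%:R.
Proof.
move=> QQ; have E := mulmx_base Q.
(* In the rank factorization of [Q], idempotence cancels down to the statement that the product in
   the other order is an identity matrix, of size the rank. *)
have {}QQ : row_base Q *m col_base Q = 1%:M.
  apply: (row_free_inj (row_base_free Q)); rewrite mul1mx.
  have Hc : row_free (col_base Q)^T by rewrite /row_free mxrank_tr; apply: col_base_full.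
  apply: trmx_inj; apply: (row_free_inj Hc).
  rewrite -!trmx_mul; congr (_^T).
  by rewrite -[row_base Q *m _ *m _]mulmxA (mulmxA (col_base Q)) !E QQ.
by rewrite -{1}E mxtrace_mulC QQ mxtrace1.
Qed.

Section Trace.
Variables (R : realType) (n : nat).
Implicit Types (C : seq 'rV[R]_n).

Lemma mulmx_rows_mx C (u : 'rV[R]_(size C)) :
  u *m rows_mx C = \sum_(i < size C) u 0 i *: nth 0 C i.
Proof.
rewrite mulmx_sum_row; apply: eq_bigr => i _; congr (_ *: _).
by rewrite /rows_mx rowK.
Qed.

(** The matrix [A^T *m A] divided by [l] is the projector onto the span of [C]: its rank is the
    dimension of the span, and its trace is the sum of the norms divided by [l]. *)
Lemma frame_trace C (l : R) : l != 0 -> norm2 C ->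
  {in C, forall v, \sum_(x <- C) dotv x v *: x = l *: v} ->
  2 * (size C)%:R = l * (span_dim C)%:R.
Proof.
move=> l0 C2 HC; set A := rows_mx C.
have AA : A *m (A^T *m A) = l *: A.
  apply/row_matrixP => i; rewrite row_mul linearZ /= /A rowK mulmxA mulmx_rows_mx.
  rewrite -HC ?mem_nth // [in RHS](big_nth 0) big_mkord; apply: eq_bigr => j _.
  congr (_ *: _); rewrite dotvC /dotv !mxE; apply: eq_bigr => k _.
  by rewrite !mxE.
pose Q := l^-1 *: (A^T *m A).
have QQ : Q *m Q = Q.
  rewrite /Q -scalemxAl -scalemxAr -mulmxA AA -scalemxAr scalerA scalerA.
  by rewrite mulVf // mulr1.
have AQ : A *m Q = A by rewrite /Q -scalemxAr AA scalerA mulVf // scale1r.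
have rQ : \rank Q = \rank A.
  apply/eqP; rewrite eqn_leq; apply/andP; split; last first.
    by rewrite -{1}AQ; exact: mxrankM_maxr.
  by rewrite /Q scalemxAl; exact: mxrankM_maxr.
have := mxtrace_idempotent QQ; rewrite rQ /span_dim -/A => <-.
rewrite /Q linearZ /= mulrA divff // mul1r mxtrace_mulC /mxtrace.
rewrite (eq_bigr (fun=> 2)) => [|i _].
  by rewrite sumr_const card_ord -[RHS]mulr_natr.
rewrite -(C2 (nth 0 C i)) ?mem_nth // /dotv !mxE.
by apply: eq_bigr => k _; rewrite !mxE.
Qed.

End Trace.

Section Components.
Variables (R : realType) (n : nat) (Phi : seq 'rV[R]_n).
Hypothesis slP : simply_laced Phi.
Implicit Types (x y z a b : 'rV[R]_n).

Lemma connected_inP x y :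
  reflect (exists2 s : seq 'rV[R]_n, (size s <= size Phi)%N /\ {subset s <= Phi} &
             path (@nonorth R n) x s /\ last x s = y)
          (connected_in Phi x y).
Proof.
apply: (iffP existsP) => [[k /existsP [t /andP [p /eqP l]]]|[s [sz sP] [p l]]].
  exists [seq nth 0 Phi (val i) | i : 'I_(size Phi) <- t] => //.
  split; first by rewrite size_map size_tuple -ltnS.
  by move=> z /mapP [i _ ->]; apply: mem_nth; exact: ltn_ord i.
exists (Ordinal (n:=(size Phi).+1) (m:=size s) sz); apply/existsP.
have H i : (i < size s)%N -> (index (nth 0%R s i) Phi < size Phi)%N.
  by move=> ?; rewrite index_mem sP // mem_nth.
exists [tuple Ordinal (H i (ltn_ord i)) | i < size s] => /=.
suff -> : [seq nth 0 Phi (val i) | i : 'I_(size Phi) <-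
     [seq Ordinal (H i (ltn_ord i)) | i : 'I_(size s) ]] = s by rewrite p l eqxx.
rewrite /image_mem; apply: (@eq_from_nth _ 0) => [|i]; rewrite !size_map -enumT size_enum_ord // => si.
rewrite (nth_map (Ordinal (H i si))) ?size_map -?enumT ?size_enum_ord //.
rewrite (nth_map (Ordinal si)) -?enumT ?size_enum_ord //= nth_enum_ord // nth_index //.
by rewrite sP // mem_nth.
Qed.

Lemma connected_in_step x y z : x \in Phi -> z \in Phi -> connected_in Phi x y ->
  nonorth y z -> connected_in Phi x z.
Proof.
move=> xP zP /connected_inP [s [_ sP] [p l]] yz.
have p' : path (@nonorth R n) x (rcons s z) by rewrite rcons_path p l.
have l' : last x (rcons s z) = z by rewrite last_rcons.
(* Appending [z] may break the length bound built into [connected_in], so the path is cut down to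
   one without repetition. *)
case: {p'}(shortenP p') l' => s' p' U sub l'.
apply/connected_inP; exists s' => //; split.
  apply: uniq_leq_size; first by move: U => /= /andP [].
  move=> w /sub; rewrite mem_rcons inE => /orP [/eqP -> //|]; exact: sP.
by move=> w /sub; rewrite mem_rcons inE => /orP [/eqP -> //|]; exact: sP.
Qed.

Lemma connected_in_refl x : connected_in Phi x x.
Proof. by apply/connected_inP; exists [::]. Qed.

Lemma connected_in_lam x y : x \in Phi -> connected_in Phi x y ->
  y \in Phi /\ root_lam Phi x = root_lam Phi y.
Proof.
move=> xP /connected_inP [s [_ sP] [p <-]] {y}.
elim: s x xP sP p => [|z s IH] x xP sP //= /andP [xz p].
have zP : z \in Phi by apply: sP; rewrite mem_head.
have [|||lP <-] := IH z => //; first by move=> w ws; apply: sP; rewrite inE ws orbT.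
by split=> //; exact: root_lam_adj.
Qed.

(** Roots outside the component are orthogonal to it, so the frame operator of [Phi] restricts to
    that of the component, and [frame_trace] applies there. *)
Lemma component_coxeter a : a \in Phi ->
  root_lam Phi a = 2 * coxeter_number (component Phi a).
Proof.
move=> aP; set C := component Phi a.
have CP x : x \in C -> x \in Phi by rewrite mem_filter => /andP [].
have l0 : root_lam Phi a != 0 by rewrite gt_eqF // root_lam_gt0.
have C2 : norm2 C by move=> x /CP; case: slP => _ N _ _; exact: N.
have E := frame_trace l0 C2.
have {E} E : 2 * (size C)%:R = root_lam Phi a * (span_dim C)%:R.
  apply: E => x xC; have xP := CP _ xC; move: (xC); rewrite mem_filter => /andP [ax _].
  have [_ ->] := connected_in_lam aP ax.
  rewrite -(root_frameE slP xP) /root_frame /C /component big_filter big_mkcond.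
  apply: eq_big_seq => z zP; case: ifP => // /negbT H.
  suff -> : dotv z x = 0 by rewrite scale0r.
  apply/eqP/negPn; apply: contra H => zx.
  by apply: (connected_in_step aP zP ax); rewrite /nonorth dotvC.
rewrite /coxeter_number mulrA E mulfK //.
rewrite pnatr_eq0; apply/eqP => d0; move: E; rewrite d0 mulr0 => /eqP.
rewrite mulf_eq0 !pnatr_eq0 /= size_eq0 => /eqP CE.
have : a \in C by rewrite mem_filter connected_in_refl.
by rewrite CE.
Qed.

(* [h] is the common Coxeter number of the irreducible components. *)
Lemma strongly_eutactic_regular : strongly_eutactic Phi -> spans Phi -> Phi != [::] ->
  exists2 h : R, {in Phi, forall a, \sum_(x <- Phi) dotv x a ^+ 2 = 4 * h} &
    (size Phi)%:R = n%:R * h.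
Proof.
move=> SE sp; case E: Phi => [//|a0 s] _; rewrite -E.
have a0P : a0 \in Phi by rewrite E mem_head.
pose h := coxeter_number (component Phi a0).
have L a : a \in Phi -> root_lam Phi a = 2 * h.
  by move=> aP; rewrite component_coxeter // (SE a a0).
exists h => [a aP|].
  have := L a aP; rewrite /root_lam => /(congr1 ( *%R 2)).
  by rewrite mulrC divfK ?pnatr_eq0 // => ->; ring.
have h0 : 2 * h != 0 by rewrite -(L _ a0P) gt_eqF // root_lam_gt0.
have := @frame_trace R n Phi (2 * h) h0; rewrite sp => H.
have {H} H : 2 * (size Phi)%:R = 2 * h * n%:R.
  apply: H; first by case: slP.
  by move=> v vP; rewrite -(L v vP) -root_frameE.
by move: H; lra.
Qed.

End Components.

(** * The design equations *)

Lemma sum_natr_eq (R : realType) (T : eqType) (s : seq T) a : uniq s -> a \in s ->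
  \sum_(x <- s) (x == a)%:R = 1 :> R.
Proof.
move=> U aP; rewrite (bigD1_seq a) //= eqxx big1 ?addr0 // => x /negbTE ->.
by [].
Qed.

Section PowerSums.
Variables (R : realType) (n : nat) (Phi : seq 'rV[R]_n) (h : R).
Hypothesis slP : simply_laced Phi.
Hypothesis hreg : {in Phi, forall a, \sum_(x <- Phi) dotv x a ^+ 2 = 4 * h}.
Implicit Types (x y z a b : 'rV[R]_n).

Let PhiU : uniq Phi. Proof. by case: slP. Qed.
Let Phi2 : norm2 Phi. Proof. by case: slP. Qed.

(** Inner products 0, 1 and -1 contribute equally to all positive even powers. Only [a] and [- a]
    differ from the sum of squares, each by [4 ^+ j.+1 - 4]. *)
Lemma power_sum a j : a \in Phi ->
  \sum_(x <- Phi) dotv a x ^+ (2 * j.+1) = 4 * h + 2 * (4 ^+ j.+1 - 4).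
Proof.
move=> aP; have aP' := root_opp slP aP; set c := _ - 4.
have -> : 4 * h + 2 * c = \sum_(x <- Phi) (dotv x a ^+ 2 + ((x == a)%:R + (x == - a)%:R) * c).
  by rewrite big_split /= -mulr_suml big_split /= (hreg aP) !sum_natr_eq.
apply: eq_big_seq => x xP; rewrite (dotvC a x) exprM.
have [|[|[|[]]]] := root_dot_cases slP xP aP.
- move=> ->; rewrite (Phi2 aP) eqxx (negbTE (root_neq_opp slP aP)).
  by rewrite addr0 mul1r -natrX /c; ring.
- move=> ->; rewrite dotvNl (Phi2 aP) eqxx sqrrN eq_sym (negbTE (root_neq_opp slP aP)).
  by rewrite add0r mul1r -natrX /c; ring.
all: move=> E; rewrite E.
all: have -> : (x == a) = false by apply/eqP => xa; move: E; rewrite xa (Phi2 aP); lra.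
all: have -> : (x == - a) = false by apply/eqP => xa; move: E; rewrite xa dotvNl (Phi2 aP); lra.
all: by rewrite addr0 mul0r addr0 ?sqrrN ?expr1n // expr0n /= exprS mul0r.
Qed.

(** Negation balances the inner products 1 and -1, and [a], [- a] give 4 each: the sum of squares
    [4 * h] is twice the count plus 8. *)
Lemma count_dot1 a : a \in Phi ->
  (count (fun x => dotv x a == 1) Phi)%:R = 2 * h - 4 :> R.
Proof.
move=> aP; have aP' := root_opp slP aP.
set N := count _ _.
have E1 : \sum_(x <- Phi) (dotv x a == 1)%:R = N%:R :> R.
  by rewrite -natr_sum /N -sum1_count [in RHS]big_mkcond.
have E2 : \sum_(x <- Phi) (dotv x a == -1)%:R = N%:R :> R.
  have P : perm_eq (map -%R Phi) Phi.
    have U : uniq (map -%R Phi) by rewrite (map_inj_uniq oppr_inj).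
    have sub : {subset map -%R Phi <= Phi}.
      by move=> y /mapP [z zP ->]; exact: root_opp.
    by apply: uniq_perm => //; have [|_] := uniq_min_size U sub; rewrite ?size_map.
  rewrite -E1 -(perm_big _ P) big_map; apply: eq_bigr => x _.
  by rewrite dotvNl eqr_opp.
suff : 4 * h = N%:R + N%:R + 4 * 1 + 4 * 1 :> R by lra.
have -> : N%:R + N%:R + 4 * 1 + 4 * 1 = \sum_(x <- Phi) ((dotv x a == 1)%:R +
    (dotv x a == -1)%:R + 4 * (x == a)%:R + 4 * (x == - a)%:R) :> R.
  by rewrite !big_split /= -!mulr_sumr E1 E2 !sum_natr_eq.
rewrite -(hreg aP); apply: eq_big_seq => x xP.
have F1 : (1 == 2 :> R) = false by apply/eqP; lra.
have F2 : (-1 == 2 :> R) = false by apply/eqP; lra.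
have F3 : (1 == -1 :> R) = false by apply/eqP; lra.
have F4 : (2 == -1 :> R) = false by apply/eqP; lra.
have [|[|[|[]]]] := root_dot_cases slP xP aP.
- move=> ->; rewrite (Phi2 aP) eqxx (negbTE (root_neq_opp slP aP)) (eq_sym 2 1) F1 F4 /=.
  by rewrite mulr0 mulr1 !addr0 !add0r; ring.
- move=> ->; rewrite dotvNl (Phi2 aP) eqxx (eq_sym (- a)) (negbTE (root_neq_opp slP aP)) /=.
  rewrite eqr_opp (eq_sym 2 1) F1 (_ : (-2 == 1) = false) /=; last by apply/eqP; lra.
  by rewrite mulr0 mulr1 !addr0 !add0r; ring.
all: move=> E; rewrite E.
all: have -> : (x == a) = false by apply/eqP => xa; move: E; rewrite xa (Phi2 aP); lra.
all: have -> : (x == - a) = false by apply/eqP => xa; move: E; rewrite xa dotvNl (Phi2 aP); lra.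
all: rewrite ?eqxx /= ?mulr0 ?addr0.
- by rewrite F3 /= expr1n addr0.
- by rewrite eq_sym F3 /= sqrrN expr1n add0r.
- rewrite eq_sym oner_eq0 eq_sym oppr_eq0 oner_eq0 /=.
  by rewrite expr0n /= addr0.
Qed.

(** The sum over [Phi] of the zonal harmonic of a root. The last term stands apart because it
    carries the zeroth power, which counts the [n * h] roots. *)
Definition zrel j : R :=
  \sum_(i < j) zcoef R n j i * 2 ^+ i * (4 * h + 2 * (4 ^+ (j - i) - 4)) +
  zcoef R n j j * 2 ^+ j * (n%:R * h).

Lemma design_cond_zrel j : (0 < n)%N -> Phi != [::] -> (size Phi)%:R = n%:R * h ->
  design_cond Phi (2 * j) <-> zrel j = 0.
Proof.
move=> n0 Phi0 sz; rewrite design_cond_zonal //.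
have E a : a \in Phi -> \sum_(x <- Phi) evalv (zonal j a) x = zrel j.
  move=> aP; under eq_bigr => x _ do rewrite evalv_zonal.
  rewrite exchange_big /= big_ord_recr /=; congr (_ + _); last first.
    rewrite -sz subnn muln0 -mulr_sumr -mulrA; congr (_ * _).
    rewrite -sum1_size natr_sum mulr_sumr; apply: eq_big_seq => x xP.
    by rewrite (Phi2 xP) expr0 mul1r mulr1.
  apply: eq_bigr => i _; have lt := ltn_ord i.
  have -> : (j - i = (j - i).-1.+1)%N by lia.
  rewrite -(power_sum _ aP) mulr_sumr; apply: eq_big_seq => x xP.
  by rewrite (Phi2 xP) -!mulrA [2 ^+ i * _]mulrC.
split=> [H|H a aP]; last by rewrite E.
by move: E H Phi0; case: (Phi) => [//|a s] E H _; rewrite -(E a) ?H ?mem_head.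
Qed.

(** Numerators of [zrel j]. For [j = 5] the factor [t - 2] makes the condition empty in the plane.
    Large literals are unary naturals underneath, hence the splitting at the thousands. *)
Definition zpoly (j : nat) : R :=
  let t := n%:R in
  match j with
  | 2 => (t - 10) * h + (6 * t + 12)
  | 3 => (t ^+ 2 - 48 * t + 272) * h + (30 * t ^+ 2 - 480)
  | 4 => (t ^+ 3 - 84 * t ^+ 2 + (1 * 1000 + 820) * t - (6 * 1000 + 0)) * h +
         (126 * t ^+ 3 + 168 * t ^+ 2 - (1 * 1000 + 848) * t + (10 * 1000 + 80))
  | 5 => (t - 2) * ((t ^+ 3 - 128 * t ^+ 2 + (4 * 1000 + 624) * t - (51 * 1000 + 72)) * h +
         (510 * t ^+ 3 + (3 * 1000 + 840) * t ^+ 2 + (8 * 1000 + 160) * t + (80 * 1000 + 640)))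
  | 6 => (t ^+ 5 - 186 * t ^+ 4 + (10 * 1000 + 852) * t ^+ 3 - (228 * 1000 + 504) * t ^+ 2 + (1659 * 1000 + 232) * t - (967 * 1000 + 680)) * h +
         ((2 * 1000 + 46) * t ^+ 5 + (24 * 1000 + 948) * t ^+ 4 + (103 * 1000 + 224) * t ^+ 3 + (432 * 1000 + 432) * t ^+ 2 - (1510 * 1000 + 80) * t)
  | _ => 1
  end.

Lemma zrel1 : (0 < n)%N -> zrel 1 = 0.
Proof.
move=> n0; rewrite /zrel big_ord_recl big_ord0 /= subn0 subnn.
have t0 : n%:R != 0 :> R by rewrite pnatr_eq0 -lt0n.
rewrite muln0 muln1 add0n [n%:R + 0]addr0; move: t0; set t := n%:R; clearbody t => t0.
by field.
Qed.

(** Over the common denominator the numerator is divisible by [t + 4], and by [t + 2 j] in the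
    analogues below; this factor is left uncancelled. All factors are positive since [t] is
    nonnegative. *)
Lemma zrel2 : zrel 2 =
  let t := n%:R in 4 * (t + 4) / ((t + 4) * (t + 2)) * zpoly 2.
Proof.
rewrite /zrel -(big_mkord xpredT (fun i => zcoef R n 2 i * 2 ^+ i * (4 * h + 2 * (4 ^+ (2 - i) - 4)))) unlock /=.
pose t : R := n%:R; have t0 : 0 <= t := ler0n R n.
(* The recursion of [zcoef] with its literal coefficients, which holds by conversion; a rational
   identity in [t] and [h] remains. *)
transitivity (
  let c0 : R := 1 in
  let c1 : R := - (c0 * (4 * 3) / (1 * (t + 4))) in
  let c2 : R := - (c1 * (2 * 1) / (2 * (t + 2))) in
  c0 * 2 ^+ 0 * (4 * h + 2 * (4 ^+ 2 - 4)) + (c1 * 2 ^+ 1 * (4 * h + 2 * (4 ^+ 1 - 4)) + 0) + c2 * 2 ^+ 2 * (t * h)); first by [].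
rewrite /zpoly -/t /=; clearbody t.
field; do ?[apply/andP; split]; apply: lt0r_neq0; lra.
Qed.

Lemma zrel3 : zrel 3 =
  let t := n%:R in 4 * (t + 6) / ((t + 8) * (t + 6) * (t + 4)) * zpoly 3.
Proof.
rewrite /zrel -(big_mkord xpredT (fun i => zcoef R n 3 i * 2 ^+ i * (4 * h + 2 * (4 ^+ (3 - i) - 4)))) unlock /=.
pose t : R := n%:R; have t0 : 0 <= t := ler0n R n.
transitivity (
  let c0 : R := 1 in
  let c1 : R := - (c0 * (6 * 5) / (1 * (t + 8))) in
  let c2 : R := - (c1 * (4 * 3) / (2 * (t + 6))) in
  let c3 : R := - (c2 * (2 * 1) / (3 * (t + 4))) in
  c0 * 2 ^+ 0 * (4 * h + 2 * (4 ^+ 3 - 4)) + (c1 * 2 ^+ 1 * (4 * h + 2 * (4 ^+ 2 - 4)) + (c2 * 2 ^+ 2 * (4 * h + 2 * (4 ^+ 1 - 4)) + 0)) + c3 * 2 ^+ 3 * (t * h)); first by [].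
rewrite /zpoly -/t /=; clearbody t.
field; do ?[apply/andP; split]; apply: lt0r_neq0; lra.
Qed.

Lemma zrel4 : zrel 4 =
  let t := n%:R in 4 * (t + 8) / ((t + 12) * (t + 10) * (t + 8) * (t + 6)) * zpoly 4.
Proof.
rewrite /zrel -(big_mkord xpredT (fun i => zcoef R n 4 i * 2 ^+ i * (4 * h + 2 * (4 ^+ (4 - i) - 4)))) unlock /=.
pose t : R := n%:R; have t0 : 0 <= t := ler0n R n.
transitivity (
  let c0 : R := 1 in
  let c1 : R := - (c0 * (8 * 7) / (1 * (t + 12))) in
  let c2 : R := - (c1 * (6 * 5) / (2 * (t + 10))) in
  let c3 : R := - (c2 * (4 * 3) / (3 * (t + 8))) in
  let c4 : R := - (c3 * (2 * 1) / (4 * (t + 6))) in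
  c0 * 2 ^+ 0 * (4 * h + 2 * (4 ^+ 4 - 4)) + (c1 * 2 ^+ 1 * (4 * h + 2 * (4 ^+ 3 - 4)) + (c2 * 2 ^+ 2 * (4 * h + 2 * (4 ^+ 2 - 4)) + (c3 * 2 ^+ 3 * (4 * h + 2 * (4 ^+ 1 - 4)) + 0))) + c4 * 2 ^+ 4 * (t * h)); first by [].
rewrite /zpoly -/t /=; clearbody t.
field; do ?[apply/andP; split]; apply: lt0r_neq0; lra.
Qed.

Lemma zrel5 : zrel 5 =
  let t := n%:R in 4 * (t + 10) / ((t + 16) * (t + 14) * (t + 12) * (t + 10) * (t + 8)) * zpoly 5.
Proof.
rewrite /zrel -(big_mkord xpredT (fun i => zcoef R n 5 i * 2 ^+ i * (4 * h + 2 * (4 ^+ (5 - i) - 4)))) unlock /=.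
pose t : R := n%:R; have t0 : 0 <= t := ler0n R n.
transitivity (
  let c0 : R := 1 in
  let c1 : R := - (c0 * (10 * 9) / (1 * (t + 16))) in
  let c2 : R := - (c1 * (8 * 7) / (2 * (t + 14))) in
  let c3 : R := - (c2 * (6 * 5) / (3 * (t + 12))) in
  let c4 : R := - (c3 * (4 * 3) / (4 * (t + 10))) in
  let c5 : R := - (c4 * (2 * 1) / (5 * (t + 8))) in
  c0 * 2 ^+ 0 * (4 * h + 2 * (4 ^+ 5 - 4)) + (c1 * 2 ^+ 1 * (4 * h + 2 * (4 ^+ 4 - 4)) + (c2 * 2 ^+ 2 * (4 * h + 2 * (4 ^+ 3 - 4)) + (c3 * 2 ^+ 3 * (4 * h + 2 * (4 ^+ 2 - 4)) + (c4 * 2 ^+ 4 * (4 * h + 2 * (4 ^+ 1 - 4)) + 0)))) + c5 * 2 ^+ 5 * (t * h)); first by [].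
rewrite /zpoly -/t /=; clearbody t.
field; do ?[apply/andP; split]; apply: lt0r_neq0; lra.
Qed.

Lemma zrel6 : zrel 6 =
  let t := n%:R in 4 * (t + 12) / ((t + 20) * (t + 18) * (t + 16) * (t + 14) * (t + 12) * (t + 10)) * zpoly 6.
Proof.
rewrite /zrel -(big_mkord xpredT (fun i => zcoef R n 6 i * 2 ^+ i * (4 * h + 2 * (4 ^+ (6 - i) - 4)))) unlock /=.
pose t : R := n%:R; have t0 : 0 <= t := ler0n R n.
transitivity (
  let c0 : R := 1 in
  let c1 : R := - (c0 * (12 * 11) / (1 * (t + 20))) in
  let c2 : R := - (c1 * (10 * 9) / (2 * (t + 18))) in
  let c3 : R := - (c2 * (8 * 7) / (3 * (t + 16))) in
  let c4 : R := - (c3 * (6 * 5) / (4 * (t + 14))) in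
  let c5 : R := - (c4 * (4 * 3) / (5 * (t + 12))) in
  let c6 : R := - (c5 * (2 * 1) / (6 * (t + 10))) in
  c0 * 2 ^+ 0 * (4 * h + 2 * (4 ^+ 6 - 4)) + (c1 * 2 ^+ 1 * (4 * h + 2 * (4 ^+ 5 - 4)) + (c2 * 2 ^+ 2 * (4 * h + 2 * (4 ^+ 4 - 4)) + (c3 * 2 ^+ 3 * (4 * h + 2 * (4 ^+ 3 - 4)) + (c4 * 2 ^+ 4 * (4 * h + 2 * (4 ^+ 2 - 4)) + (c5 * 2 ^+ 5 * (4 * h + 2 * (4 ^+ 1 - 4)) + 0))))) + c6 * 2 ^+ 6 * (t * h)); first by [].
rewrite /zpoly -/t /=; clearbody t.
field; do ?[apply/andP; split]; apply: lt0r_neq0; lra.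
Qed.

Lemma zrel_zpoly j : (1 < j < 7)%N -> (zrel j == 0) = (zpoly j == 0).
Proof.
have t0 : 0 <= n%:R :> R := ler0n _ _.
have t k : n%:R + k.+1%:R != 0 :> R by apply: lt0r_neq0; rewrite ltr_wpDl ?ltr0Sn.
have n4 : 4 != 0 :> R by rewrite pnatr_eq0.
case: j => [|[|[|[|[|[|[|j]]]]]]] // _.
- by rewrite zrel2 mulf_eq0 !(mulf_eq0, invr_eq0) !(negbTE (t _)) /= (negbTE n4).
- by rewrite zrel3 mulf_eq0 !(mulf_eq0, invr_eq0) !(negbTE (t _)) /= (negbTE n4).
- by rewrite zrel4 mulf_eq0 !(mulf_eq0, invr_eq0) !(negbTE (t _)) /= (negbTE n4).
- by rewrite zrel5 mulf_eq0 !(mulf_eq0, invr_eq0) !(negbTE (t _)) /= (negbTE n4).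
- by rewrite zrel6 mulf_eq0 !(mulf_eq0, invr_eq0) !(negbTE (t _)) /= (negbTE n4).
Qed.

End PowerSums.

(** * Integral solutions of the design equations *)

(* Pairs [(n, h)] that no root system realizes: the unwanted integral solutions of
   the design equations are all of this form. *)
Definition spurious (n h : nat) :=
  [&& (n.+1 < h)%N, (n.*2 <= h)%N, h != 12%N, h != 18%N & h != 30%N].

Lemma zpoly2_int (R : realType) (n h : nat) :
  zpoly n (h%:R : R) 2 =
  ((n%:Z - 10) * h%:Z + (6 * n%:Z + 12))%:~R.
Proof. by rewrite /zpoly; ring. Qed.

(** From the threshold on, the coefficient of [h] is nonnegative and the other term positive, so
    nothing vanishes. Below it, each [n] leaves a numerical linear equation in [h]. The higher
    degrees follow the same scheme. *)
Lemma zpoly2_sol (R : realType) (n h : nat) : (0 < n)%N -> (1 < h)%N ->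
  zpoly n (h%:R : R) 2 = 0 ->
  [|| (n == 1) && (h == 2), (n == 2) && (h == 3), (n == 4) && (h == 6), (n == 6) && (h == 12), (n == 7) && (h == 18), (n == 8) && (h == 30) | spurious n h]%N.
Proof.
move=> n0 h2 /eqP; rewrite zpoly2_int intr_eq0 => /eqP; rewrite /spurious.
have [le|gt] := leqP 10 n.
  have [m ->] : exists m, n = (10 + m)%N by exists (n - 10)%N; lia.
  have : (0 <= m * h)%N /\ (0 <= m)%N by [].
  by move=> *; lia.
move: n0 gt ; do 10 (case: n => [|n]; [lia|]); lia.
Qed.

Lemma zpoly3_int (R : realType) (n h : nat) :
  zpoly n (h%:R : R) 3 =
  ((n%:Z ^+ 2 - 48 * n%:Z + 272) * h%:Z + (30 * n%:Z ^+ 2 - 480))%:~R.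
Proof. by rewrite /zpoly; ring. Qed.

Lemma zpoly3_sol (R : realType) (n h : nat) : (0 < n)%N -> (1 < h)%N ->
  zpoly n (h%:R : R) 3 = 0 ->
  [|| (n == 1) && (h == 2), (n == 2) && (h == 2), (n == 8) && (h == 30), (n == 16) && (h == 30) | spurious n h]%N.
Proof.
move=> n0 h2 /eqP; rewrite zpoly3_int intr_eq0 => /eqP; rewrite /spurious.
have [le|gt] := leqP 42 n.
  have [m ->] : exists m, n = (42 + m)%N by exists (n - 42)%N; lia.
  (* After the shift by the threshold, the coefficient of [h] has nonnegative coefficients in [m].
     The monomials are atoms for [lia], which needs only their signs. *)
  have : (0 <= m * h)%N /\ (0 <= m)%N by [].
  have : (0 <= m * m * h)%N /\ (0 <= m * m)%N by [].
  by move=> *; lia.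
move: n0 gt ; do 42 (case: n => [|n]; [lia|]); lia.
Qed.

Lemma zpoly4_int (R : realType) (n h : nat) :
  zpoly n (h%:R : R) 4 =
  ((n%:Z ^+ 3 - 84 * n%:Z ^+ 2 + (1 * 1000 + 820) * n%:Z - (6 * 1000 + 0)) * h%:Z +
   (126 * n%:Z ^+ 3 + 168 * n%:Z ^+ 2 - (1 * 1000 + 848) * n%:Z + (10 * 1000 + 80)))%:~R.
Proof. by rewrite /zpoly; ring. Qed.

Lemma zpoly4_sol (R : realType) (n h : nat) : (0 < n)%N -> (1 < h)%N ->
  zpoly n (h%:R : R) 4 = 0 ->
  [|| (n == 1) && (h == 2), (n == 2) && (h == 3) | spurious n h]%N.
Proof.
move=> n0 h2 /eqP; rewrite zpoly4_int intr_eq0 => /eqP; rewrite /spurious.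
have [le|gt] := leqP 50 n.
  have [m ->] : exists m, n = (50 + m)%N by exists (n - 50)%N; lia.
  have : (0 <= m * h)%N /\ (0 <= m)%N by [].
  have : (0 <= m * m * h)%N /\ (0 <= m * m)%N by [].
  have : (0 <= m * m * m * h)%N /\ (0 <= m * m * m)%N by [].
  by move=> *; lia.
move: n0 gt ; do 50 (case: n => [|n]; [lia|]); lia.
Qed.

Lemma zpoly5_int (R : realType) (n h : nat) :
  zpoly n (h%:R : R) 5 =
  ((n%:Z - 2) * ((n%:Z ^+ 3 - 128 * n%:Z ^+ 2 + (4 * 1000 + 624) * n%:Z - (51 * 1000 + 72)) * h%:Z +
   (510 * n%:Z ^+ 3 + (3 * 1000 + 840) * n%:Z ^+ 2 + (8 * 1000 + 160) * n%:Z + (80 * 1000 + 640))))%:~R.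
Proof. by rewrite /zpoly; ring. Qed.

Lemma zpoly5_sol (R : realType) (n h : nat) : (0 < n)%N -> (1 < h)%N ->
  zpoly n (h%:R : R) 5 = 0 ->
  [|| (n == 1) && (h == 2), n == 2, (n == 4) && (h == 6), (n == 8) && (h == 30) | spurious n h]%N.
Proof.
move=> n0 h2 /eqP; rewrite zpoly5_int intr_eq0 => /eqP; rewrite /spurious.
have [->|n2] := eqVneq n 2%N; first by rewrite orbT.
move/eqP; rewrite mulf_eq0 => /orP [/eqP|/eqP]; first by lia.
have [le|gt] := leqP 76 n.
  have [m ->] : exists m, n = (76 + m)%N by exists (n - 76)%N; lia.
  have : (0 <= m * h)%N /\ (0 <= m)%N by [].
  have : (0 <= m * m * h)%N /\ (0 <= m * m)%N by [].
  have : (0 <= m * m * m * h)%N /\ (0 <= m * m * m)%N by [].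
  by move=> *; lia.
move: n0 gt n2; do 76 (case: n => [|n]; [lia|]); lia.
Qed.

Lemma zpoly6_int (R : realType) (n h : nat) :
  zpoly n (h%:R : R) 6 =
  ((n%:Z ^+ 5 - 186 * n%:Z ^+ 4 + (10 * 1000 + 852) * n%:Z ^+ 3 - (228 * 1000 + 504) * n%:Z ^+ 2 + (1659 * 1000 + 232) * n%:Z - (967 * 1000 + 680)) * h%:Z +
   ((2 * 1000 + 46) * n%:Z ^+ 5 + (24 * 1000 + 948) * n%:Z ^+ 4 + (103 * 1000 + 224) * n%:Z ^+ 3 + (432 * 1000 + 432) * n%:Z ^+ 2 - (1510 * 1000 + 80) * n%:Z))%:~R.
Proof. by rewrite /zpoly; ring. Qed.

Lemma zpoly6_sol (R : realType) (n h : nat) : (0 < n)%N -> (1 < h)%N ->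
  zpoly n (h%:R : R) 6 = 0 ->
  [|| (n == 1) && (h == 2) | spurious n h]%N.
Proof.
move=> n0 h2 /eqP; rewrite zpoly6_int intr_eq0 => /eqP; rewrite /spurious.
have [le|gt] := leqP 96 n.
  have [m ->] : exists m, n = (96 + m)%N by exists (n - 96)%N; lia.
  have : (0 <= m * h)%N /\ (0 <= m)%N by [].
  have : (0 <= m * m * h)%N /\ (0 <= m * m)%N by [].
  have : (0 <= m * m * m * h)%N /\ (0 <= m * m * m)%N by [].
  have : (0 <= m * m * m * m * h)%N /\ (0 <= m * m * m * m)%N by [].
  have : (0 <= m * m * m * m * m * h)%N /\ (0 <= m * m * m * m * m)%N by [].
  by move=> *; lia.
move: n0 gt ; do 96 (case: n => [|n]; [lia|]); lia.
Qed.

(** * Finding a D4 *)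

Section Independent.
Variables (R : realType) (n : nat).

Lemma independent_size (s : seq 'rV[R]_n) :
  (forall u : nat -> R, \sum_(i < size s) u i *: s`_i = 0 ->
     forall i, (i < size s)%N -> u i = 0) -> (size s <= n)%N.
Proof.
move=> H; have : row_free (rows_mx s).
  apply: inj_row_free => v; rewrite mulmx_rows_mx => E.
  apply/rowP => i; rewrite mxE.
  pose u j := if insub j is Some k then v 0 k else 0.
  have uE (k : 'I_(size s)) : u k = v 0 k by rewrite /u valK.
  rewrite -uE; apply: H => //.
  by rewrite -[RHS]E; apply: eq_bigr => k _; rewrite uE.
by rewrite /row_free => /eqP <-; exact: rank_leq_col.
Qed.

End Independent.

Section FindD4.
Variables (R : realType) (n : nat) (Phi : seq 'rV[R]_n).
Hypothesis slP : simply_laced Phi.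
Implicit Types (x y z c r : 'rV[R]_n) (e : seq 'rV[R]_n).

Let PhiU : uniq Phi. Proof. by case: slP. Qed.
Let Phi2 : norm2 Phi. Proof. by case: slP. Qed.

Definition orth_nbrs c x := [seq y <- Phi | (dotv y c == 1) && (dotv y x == 0)].

Lemma orth_nbrsP c x y : reflect [/\ y \in Phi, dotv y c = 1 & dotv y x = 0]
  (y \in orth_nbrs c x).
Proof.
rewrite mem_filter -andbA; apply: (iffP and3P) => [[/eqP ? /eqP ? ?]|[? -> ->]] //.
Qed.

(* [y |-> c - y] exchanges the neighbours of [c] orthogonal to [x] and those at
   inner product 1 with [x]; the two remaining neighbours are [x] and [c - x]. *)
Lemma count_orth_nbrs c x : c \in Phi -> x \in Phi -> dotv x c = 1 ->
  count (fun y => dotv y c == 1) Phi = (2 + (size (orth_nbrs c x)).*2)%N.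
Proof.
move=> cP xP xc; set O := orth_nbrs c x.
have cx : dotv c x = 1 by rewrite dotvC.
have O2 y : y \in O -> dotv (c - y) x = 1.
  by move=> /orth_nbrsP [_ _ yx]; rewrite !dotvL cx yx subr0.
have OP y : y \in O -> c - y \in Phi.
  by move=> /orth_nbrsP [yP yc _]; apply: root_sub => //; rewrite dotvC.
suff P : perm_eq [seq y <- Phi | dotv y c == 1] ([:: x; c - x] ++ O ++ map (fun y => c - y) O).
  rewrite -size_filter (perm_size P) !size_cat size_map addnn.
  by [].
apply: uniq_perm; first exact: filter_uniq.
  rewrite !cat_uniq /= !inE ?orbF filter_uniq // (map_inj_uniq (can_inj (subKr c))).
  rewrite filter_uniq // !andbT has_cat !negb_or -!andbA; apply/and4P; split.
  - apply/eqP => /(congr1 (fun v => dotv v x)); rewrite !dotvL cx (Phi2 xP); lra.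
  - apply/hasPn => y /orth_nbrsP [_ _ yx]; rewrite !inE negb_or.
    by apply/andP; split; apply/eqP => E; move: yx; rewrite E ?dotvL ?cx (Phi2 xP); lra.
  - apply/hasPn => w /mapP [y yO ->]; rewrite !inE negb_or.
    apply/andP; split; apply/eqP => E; have := O2 y yO; rewrite E ?dotvL ?cx (Phi2 xP); lra.
  - apply/hasPn => w /mapP [y yO ->]; apply/negP => /orth_nbrsP [_ _].
    by rewrite O2 //; apply/eqP; rewrite oner_eq0.
move=> y; rewrite mem_filter !mem_cat !inE; apply/idP/idP.
  move=> /andP [/eqP yc yP].
  have [|[|[|[]]]] := root_dot_cases slP yP xP.
  - by move=> ->; rewrite eqxx.
  - by move=> E; move: yc; rewrite E dotvNl xc; lra.
  - move=> yx; apply/or3P; apply: Or33; apply/mapP; exists (c - y); last by rewrite subKr.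
    apply/orth_nbrsP; split; first by apply: root_sub; rewrite // dotvC.
      by rewrite !dotvL (Phi2 cP) yc; ring.
    by rewrite !dotvL cx yx subrr.
  - move=> yx; suff -> : y = c - x by rewrite eqxx orbT.
    apply: (root_dot_eq2 slP) => //; first by apply: root_sub; rewrite // dotvC.
    by rewrite !dotvL yc yx; ring.
  - by move=> yx; apply/or3P; apply: Or32; apply/orth_nbrsP.
case/or3P.
- case/orP=> /eqP ->; first by rewrite xc eqxx xP.
  rewrite !dotvL (Phi2 cP) xc root_sub // andbT.
  by apply/eqP; ring.
- by move=> /orth_nbrsP [-> -> _]; rewrite eqxx.
- move=> /mapP [w wO ->]; rewrite OP // andbT; move: wO => /orth_nbrsP [_ wc _].
  by rewrite !dotvL (Phi2 cP) wc; apply/eqP; ring.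
Qed.

(** Otherwise the neighbours of [c] orthogonal to [x] have mutual inner products 1, and a Gram
    computation makes them independent together with [c] and [x]. *)
Lemma find_D4 c x : c \in Phi -> x \in Phi -> dotv x c = 1 ->
  (n < (size (orth_nbrs c x)).+2)%N ->
  exists y z, [/\ y \in Phi, z \in Phi, dotv y c = 1 & dotv z c = 1] /\
    [/\ dotv y x = 0, dotv z x = 0 & dotv y z = 0].
Proof.
move=> cP xP xc; set O := orth_nbrs c x => ltn.
have cx : dotv c x = 1 by rewrite dotvC.
case: (boolP (has (fun y => has (fun z => dotv y z == 0) O) O)).
  case/hasP => y /orth_nbrsP [yP yc yx] /hasP [z /orth_nbrsP [zP zc zx] /eqP yz].
  by exists y, z.
move=> /hasPn noD4; suff : ((size O).+2 <= n)%N by lia.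
have OO y z : y \in O -> z \in O -> y != z -> dotv y z = 1.
  move=> yO zO yz; have /hasPn /(_ z zO) yz0 := noD4 y yO.
  have [yP yc yx] := orth_nbrsP _ _ _ yO; have [zP zc zx] := orth_nbrsP _ _ _ zO.
  have [|[|[//|[]]]] := root_dot_cases slP yP zP.
  - by move=> E; move: yz; rewrite E eqxx.
  - by move=> E; move: yc; rewrite E dotvNl zc; lra.
  (* Both have inner product 1 with [c], so inner product -1 between them forces this equality, and
     [c - z] is not orthogonal to [x]. *)
  - move=> E; have : y = c - z.
      apply: (root_dot_eq2 slP) => //; first by apply: root_sub; rewrite // dotvC.
      by rewrite !dotvL yc E; ring.
    by move=> {}E; move: yx; rewrite E !dotvL cx zx; lra.
  - by move=> E; move: yz0; rewrite E eqxx.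
have OU : uniq O by exact: filter_uniq.
apply: (@independent_size R n [:: c, x & O]) => u.
rewrite !big_ord_recl /=; set S := \sum_(i < size O) _ => E.
pose t i := u i.+2; pose T := \sum_(i < size O) t i.
have SE : S = \sum_(i < size O) t i *: O`_i by [].
have Sc : dotv S c = T.
  rewrite SE dotv_suml; apply: eq_bigr => i _; rewrite dotvZl.
  by have [_ -> _] := orth_nbrsP _ _ _ (mem_nth 0 (ltn_ord i)); rewrite mulr1.
have Sx : dotv S x = 0.
  rewrite SE dotv_suml big1 // => i _; rewrite dotvZl.
  by have [_ _ ->] := orth_nbrsP _ _ _ (mem_nth 0 (ltn_ord i)); rewrite mulr0.
have SO j : (j < size O)%N -> dotv S O`_j = T + t j.
  move=> jO; rewrite SE dotv_suml /T (bigD1 (Ordinal jO)) //= [in RHS](bigD1 (Ordinal jO)) //=.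
  rewrite dotvZl Phi2; last by have [? _ _] := orth_nbrsP _ _ _ (mem_nth 0 jO).
  rewrite (eq_bigr (fun i : 'I_(size O) => t i)) => [|i ij]; first by ring.
  rewrite dotvZl OO ?mulr1 ?mem_nth // nth_uniq //.
have Ed z : dotv (u 0%N *: c + (u 1%N *: x + S)) z = 0 by rewrite E dotv0l.
have Ec : 2 * u 0%N + u 1%N + T = 0.
  by have := Ed c; rewrite !dotvL (Phi2 cP) xc Sc => <-; ring.
have Ex : u 0%N + 2 * u 1%N = 0.
  by have := Ed x; rewrite !dotvL (Phi2 xP) cx Sx => <-; ring.
have EO j : (j < size O)%N -> u 0%N + T + t j = 0.
  move=> jO; have := Ed O`_j; rewrite !dotvL SO //.
  have [_ jc jx] := orth_nbrsP _ _ _ (mem_nth 0 jO).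
  by rewrite (dotvC c) (dotvC x) jc jx => <-; ring.
have tE j : (j < size O)%N -> t j = u 0%N / 2 by move=> /EO; lra.
have TE : T = (size O)%:R * (u 0%N / 2).
  rewrite /T (eq_bigr (fun=> u 0%N / 2)) => [|i _]; last by rewrite tE.
  by rewrite sumr_const card_ord -[LHS]mulr_natl.
have u0 : u 0%N = 0.
  have s0 : 0 <= (size O)%:R :> R := ler0n _ _.
  (* The equations give [T = - 3 / 2 * u 0], whereas summing the [t j] gives [size O] halves of
     [u 0]. *)
  have : ((size O)%:R + 3) * u 0%N = 0 by move: Ec Ex; rewrite TE; lra.
  by move/eqP; rewrite mulf_eq0 => /orP [/eqP|/eqP //]; lra.
move=> [|[|i]] // lti; first by move: Ex; lra.
by have := tE i lti; rewrite /t u0 mul0r.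
Qed.

End FindD4.

(** * D-frames *)

Ltac row_lra := apply/rowP => ?; rewrite !mxE; lra.

Section Frames.
Variables (R : realType) (n : nat) (Phi : seq 'rV[R]_n).
Hypothesis slP : simply_laced Phi.
Implicit Types (x y z c r v : 'rV[R]_n) (e : seq 'rV[R]_n).

Let Phi2 : norm2 Phi. Proof. by case: slP. Qed.

(* Orthonormal vectors [e_i] such that all [e_i +- e_j] are roots: a subsystem of
   type D in standard coordinates. *)
Definition Dframe e := [/\ uniq e, {in e, forall x, dotv x x = 1},
  {in e &, forall x y, x != y -> dotv x y = 0} &
  {in e &, forall x y, x != y -> x + y \in Phi /\ x - y \in Phi}].

Lemma Dframe_size e : Dframe e -> (size e <= n)%N.
Proof.
move=> [U e1 e0 _]; apply: independent_size => u E i ie.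
have := dotv0l e`_i; rewrite -{1}E dotv_suml (bigD1 (Ordinal ie)) //= big1.
  by rewrite addr0 dotvZl e1 ?mem_nth // mulr1.
move=> j ji; rewrite dotvZl e0 ?mulr0 ?mem_nth // nth_uniq //.
Qed.

Lemma Dframe_opp e (s : pred 'rV[R]_n) : Dframe e ->
  Dframe [seq if s x then - x else x | x <- e].
Proof.
move=> [U e1 e0 eP]; pose f x := if s x then - x else x.
have f1 x : dotv (f x) (f x) = dotv x x by rewrite /f; case: ifP => _; rewrite ?dotvL ?opprK.
have f0 x y : x \in e -> y \in e -> x != y -> dotv (f x) (f y) = 0.
  by move=> xe ye xy; rewrite /f; do 2 case: ifP => _; rewrite ?dotvL e0 ?oppr0.
have inj : {in e &, injective f}.
  move=> x y xe ye E; apply/eqP/negPn/negP => xy; have := f0 x y xe ye xy.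
  by rewrite -E f1 e1 //; lra.
split.
- by rewrite map_inj_in_uniq.
- by move=> _ /mapP [x xe ->]; rewrite -[if _ then _ else _]/(f x) f1 e1.
- move=> _ _ /mapP [x xe ->] /mapP [y ye ->] xy; apply: f0 => //.
  by apply: contraNneq xy => ->.
move=> _ _ /mapP [x xe ->] /mapP [y ye ->] xy.
have {}xy : x != y by apply: contraNneq xy => ->.
have [P1 P2] := eP x y xe ye xy.
case: ifP => _; case: ifP => _; rewrite ?opprK; split=> //.
- by rewrite -opprD (root_oppE slP).
- by rewrite addrC -opprB (root_oppE slP).
- by rewrite addrC -opprB (root_oppE slP).
- by rewrite -opprD (root_oppE slP).
Qed.

(** For [z] other than [x], the vectors [v + z] and [v - z] are differences of [r] and a root of the
    frame. The case [v - x] needs a detour through a second frame vector [y]. *)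
Lemma Dframe_ext1 e x r : Dframe e -> (1 < size e)%N -> x \in e -> r \in Phi ->
  dotv r x = 1 -> {in e, forall y, y != x -> dotv r y = 0} ->
  Dframe (r - x :: e).
Proof.
move=> [U e1 e0 eP] sz xe rP rx r0; set v := r - x.
have [y ye yx] : exists2 y, y \in e & y != x.
  case: e U sz xe {e1 e0 eP r0} => [|a [|b e]] //= /andP [ab _] _.
  rewrite in_cons => /orP [/eqP ->|xe]; last first.
    by exists a; rewrite ?mem_head //; apply: contraNneq ab => ->.
  exists b; first by rewrite !inE eqxx orbT.
  by apply: contraNneq ab => <-; rewrite mem_head.
have vx : dotv v x = 0 by rewrite !dotvL rx e1 // subrr.
have v0 z : z \in e -> dotv v z = 0.
  move=> ze; have [->//|zx] := eqVneq z x.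
  by rewrite !dotvL r0 // e0 // 1?eq_sym // subrr.
have v1 : dotv v v = 1 by rewrite !dotvL (dotvC x r) rx (Phi2 rP) e1 //; ring.
have vD z : z \in e -> z != x -> z + v \in Phi /\ v - z \in Phi.
  move=> ze; rewrite eq_sym => xz; have [P1 P2] := eP x z xe ze xz.
  have rz : dotv r z = 0 by rewrite r0 // eq_sym.
  split.
    rewrite (_ : z + v = r - (x - z)); last by rewrite /v; row_lra.
    by apply: root_sub; rewrite // !dotvL rx rz subr0.
  rewrite (_ : v - z = r - (x + z)); last by rewrite /v; row_lra.
  by apply: root_sub; rewrite // !dotvL rx rz addr0.
have vX : x + v \in Phi /\ v - x \in Phi.
  rewrite {1}/v addrC subrK; split=> //.
  have [P1 _] := vD y ye yx; have [P2 _] := eP y x ye xe yx.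
  rewrite (_ : v - x = (y + v) - (y + x)); last by row_lra.
  apply: root_sub => //; rewrite dotvDl !dotvDr v0 // vx e1 // e0 //; ring.
have {vX} vD z : z \in e -> z + v \in Phi /\ v - z \in Phi.
  by move=> ze; have [->//|/vD] := eqVneq z x; apply.
have ve : v \notin e by apply/negP => /v0; rewrite v1 => /eqP; rewrite oner_eq0.
split; first by rewrite /= ve.
- by move=> z; rewrite inE => /orP [/eqP -> //|/e1].
- move=> z w; rewrite !inE => /orP [/eqP ->|ze] /orP [/eqP ->|we].
  + by rewrite eqxx.
  + by rewrite v0.
  + by rewrite dotvC v0.
  + exact: e0.
- move=> z w; rewrite !inE => /orP [/eqP ->|ze] /orP [/eqP ->|we].
  + by rewrite eqxx.
  + by move=> _; rewrite addrC; exact: vD.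
  + by move=> _; rewrite -(root_oppE slP (z - v)) opprB; exact: vD.
  + exact: eP.
Qed.

(** Up to sign, such a root is a frame vector plus a vector orthogonal to the whole frame; the
    latter becomes the new frame vector. *)
Definition Dextends e r :=
  has (fun x => ((dotv r x == 1) || (dotv r x == -1)) &&
                all (fun y => (y != x) ==> (dotv r y == 0)) e) e.

Lemma Dframe_ext e r : Dframe e -> (1 < size e)%N -> r \in Phi -> Dextends e r ->
  exists2 v, Dframe (v :: e) & exists2 x, x \in e & (v = r - x \/ v = - r - x).
Proof.
move=> De sz rP /hasP [x xe /andP [rx /allP r0]].
have {}r0 y : y \in e -> y != x -> dotv r y = 0.
  by move=> ye yx; have := r0 y ye; rewrite yx => /eqP.
case/orP: rx => /eqP rx.
  by exists (r - x); [exact: Dframe_ext1|exists x => //; left].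
exists (- r - x); last by exists x => //; right.
apply: Dframe_ext1 => //; first by rewrite (root_oppE slP).
  by rewrite dotvNl rx opprK.
by move=> y ye yx; rewrite dotvNl r0 // oppr0.
Qed.

Lemma Dframe_max e : Dframe e -> (1 < size e)%N ->
  exists e', [/\ Dframe e', (size e <= size e')%N & ~~ has (Dextends e') Phi].
Proof.
move=> De; have [k] := ubnP (n - size e)%N.
elim: k e De => // k IH e De lek sz.
case: (boolP (has (Dextends e) Phi)) => [/hasP [r rP re]|ne]; last by exists e.
have [v Dv _] := Dframe_ext De sz rP re.
have szv := Dframe_size Dv; rewrite /= in szv.
have [||e' [De' sze' ne']] := IH _ Dv; rewrite /=; [lia|lia|].
by exists e'; split=> //; move: sze' => /=; lia.
Qed.

Lemma Dframe_pair y z : y \in Phi -> z \in Phi -> dotv y z = 0 ->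
  Dframe [:: 2^-1 *: (y + z); 2^-1 *: (y - z)].
Proof.
move=> yP zP yz; set f := 2^-1 *: _; set g := 2^-1 *: _.
have zy : dotv z y = 0 by rewrite dotvC.
have f1 : dotv f f = 1 by rewrite /f !dotvL (Phi2 yP) (Phi2 zP) yz zy; field.
have g1 : dotv g g = 1 by rewrite /g !dotvL (Phi2 yP) (Phi2 zP) yz zy; field.
have fg : dotv f g = 0 by rewrite /f /g !dotvL (Phi2 yP) (Phi2 zP) yz zy; field.
have gf : dotv g f = 0 by rewrite dotvC.
have nfg : f != g.
  by apply/eqP => E; move: fg; rewrite E g1 => /eqP; rewrite oner_eq0.
have fgP : f + g = y by rewrite /f /g; row_lra.
have fgM : f - g = z by rewrite /f /g; row_lra.
split; first by rewrite /= inE nfg.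
- by move=> x; rewrite !inE => /orP [] /eqP ->.
- by move=> x w; rewrite !inE => /orP [] /eqP -> /orP [] /eqP ->; rewrite ?eqxx.
- move=> x w; rewrite !inE => /orP [] /eqP -> /orP [] /eqP ->; rewrite ?eqxx // => _.
    by rewrite fgP fgM.
  by rewrite addrC fgP -(root_oppE slP (g - f)) opprB fgM.
Qed.

(** Up to the sign of [c] this is the D4 diagram. The orthogonal pair [y], [z] gives two frame
    vectors; [c] and then [x] have a single nonzero coordinate, equal to 1, in the frame reached so
    far and extend it. *)
Lemma Dframe4 c x y z : [/\ c \in Phi, x \in Phi, y \in Phi & z \in Phi] ->
  [/\ dotv x c = 1, dotv y c = 1 & dotv z c = 1] ->
  [/\ dotv y x = 0, dotv z x = 0 & dotv y z = 0] ->
  exists2 e, Dframe e & size e = 4%N.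
Proof.
move=> [cP xP yP zP] [xc yc zc] [yx zx yz].
have D2 := Dframe_pair yP zP yz.
set f := 2^-1 *: (y + z) in D2; set g := 2^-1 *: (y - z) in D2.
have cf : dotv c f = 1 by rewrite dotvC /f !dotvL yc zc; field.
have cg : dotv c g = 0 by rewrite dotvC /g !dotvL yc zc; field.
have xf : dotv x f = 0 by rewrite dotvC /f !dotvL yx zx; field.
have xg : dotv x g = 0 by rewrite dotvC /g !dotvL yx zx; field.
have D3 : Dframe [:: c - f; f; g].
  apply: Dframe_ext1 => //; first by rewrite mem_head.
  by move=> w; rewrite !inE => /orP [] /eqP ->; rewrite ?eqxx.
exists [:: x - (c - f); c - f; f; g] => //.
apply: Dframe_ext1 => //; first by rewrite mem_head.
  by rewrite dotvBr xc xf subr0.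
by move=> w; rewrite !inE => /or3P [] /eqP ->; rewrite ?eqxx.
Qed.

(* A root with all coordinates 1/2 in a 4-frame is a vector root for another
   4-frame (triality). *)
Lemma Dframe5 a b c d r : Dframe [:: a; b; c; d] -> r \in Phi ->
  [/\ dotv r a = 2^-1, dotv r b = 2^-1, dotv r c = 2^-1 & dotv r d = 2^-1] ->
  exists2 e, Dframe e & size e = 5%N.
Proof.
move=> [U e1 e0 eP] rP [ra rb rc rd].
have ia : a \in [:: a; b; c; d] by rewrite !inE eqxx.
have ib : b \in [:: a; b; c; d] by rewrite !inE eqxx ?orbT.
have ic : c \in [:: a; b; c; d] by rewrite !inE eqxx ?orbT.
have id : d \in [:: a; b; c; d] by rewrite !inE eqxx ?orbT.
move: U; rewrite /= !inE !negb_or andbT -!andbA.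
case/and5P => nab nac nad nbc /andP [nbd ncd].
have [aa bb cc dd] := And4 (e1 _ ia) (e1 _ ib) (e1 _ ic) (e1 _ id).
have [ab ac ad] := And3 (e0 _ _ ia ib nab) (e0 _ _ ia ic nac) (e0 _ _ ia id nad).
have [bc bd cd] := And3 (e0 _ _ ib ic nbc) (e0 _ _ ib id nbd) (e0 _ _ ic id ncd).
have [ba ca da] : [/\ dotv b a = 0, dotv c a = 0 & dotv d a = 0] by rewrite !(dotvC _ a).
have [cb db dc] : [/\ dotv c b = 0, dotv d b = 0 & dotv d c = 0].
  by rewrite !(dotvC _ b) (dotvC d c).
have dE := (aa, bb, cc, dd, ab, ac, ad, bc, bd, cd, ba, ca, da, cb, db, dc).
have [_ yP] := eP _ _ ia ib nab; have [_ cP] := eP _ _ ib ic nbc.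
have [xP zP] := eP _ _ ic id ncd.
have D2 := Dframe_pair yP zP.
have {}D2 := D2 ltac:(rewrite !dotvL !dE; ring).
(* In coordinates along [a], [b], [c], [d], the frame [w], [v], [f], [g] consists of the halves of
   (1,1,1,1), (-1,-1,1,1), (1,-1,1,-1) and (1,-1,-1,1); so [r] has inner product 1 with [w] and 0
   with the rest. *)
set f := 2^-1 *: (_ + _) in D2; set g := 2^-1 *: (_ - (c - d)) in D2.
pose v := - (b - c) - f.
have D3 : Dframe [:: v; f; g].
  apply: Dframe_ext1 => //; first by rewrite mem_head.
  - by rewrite (root_oppE slP).
  - by rewrite /f !dotvL !dE; field.
  by move=> w; rewrite !inE => /orP [] /eqP ->; rewrite ?eqxx // /g !dotvL !dE => _; field.
pose w := (c + d) - v.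
have D4 : Dframe [:: w; v; f; g].
  apply: Dframe_ext1 => //; first by rewrite mem_head.
  - by rewrite /v /f !dotvL !dE; field.
  by move=> u; rewrite !inE => /or3P [] /eqP ->; rewrite ?eqxx // /f /g !dotvL !dE => _; field.
exists [:: r - w; w; v; f; g] => //.
apply: Dframe_ext1 => //; first by rewrite mem_head.
  by rewrite /w /v /f !dotvL ra rb rc rd; field.
by move=> u; rewrite !inE => /or4P [] /eqP ->; rewrite ?eqxx // /v /f /g !dotvL ra rb rc rd => _; field.
Qed.

(** The missing sign pattern is the second one with [x] and [y] exchanged. *)
Definition Droot e r := has (fun x => has (fun y => (x != y) &&
  [|| r == x + y, r == x - y | r == - x - y]) e) e.

(** Unless [r] lies in the D subsystem, sums and differences of two of its coordinates belong to 0,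
    1, -1. So a nonzero coordinate is 1 or -1, and then the others vanish, or is a half up to sign,
    and then so are all others. *)
Lemma Dframe_root_types e r : Dframe e -> (1 < size e)%N -> r \in Phi ->
  [|| Droot e r, all (fun x => dotv r x == 0) e, Dextends e r |
      all (fun x => (dotv r x == 2^-1) || (dotv r x == - 2^-1)) e].
Proof.
move=> [U e1 e0 eP] sz rP; case: (boolP (Droot e r)) => //= nD.
have key x y : x \in e -> y \in e -> x != y ->
    (dotv r x + dotv r y = 0 \/ dotv r x + dotv r y = 1 \/ dotv r x + dotv r y = -1) /\
    (dotv r x - dotv r y = 0 \/ dotv r x - dotv r y = 1 \/ dotv r x - dotv r y = -1).
  move=> xe ye xy; have [P1 P2] := eP x y xe ye xy.
  have yx : y != x by rewrite eq_sym.
  split.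
    rewrite -dotvDr; have [E|[E|[|[|]]]] := root_dot_cases slP rP P1; try tauto.
      by case/hasP: nD; exists x => //; apply/hasP; exists y => //; rewrite xy E eqxx.
    case/hasP: nD; exists x => //; apply/hasP; exists y => //.
    by rewrite xy E opprD eqxx !orbT.
  rewrite -dotvBr; have [E|[E|[|[|]]]] := root_dot_cases slP rP P2; try tauto.
    by case/hasP: nD; exists x => //; apply/hasP; exists y => //; rewrite xy E eqxx !orbT.
  case/hasP: nD; exists y => //; apply/hasP; exists x => //.
  by rewrite yx E opprB eqxx !orbT.
have other x : x \in e -> exists2 y, y \in e & x != y.
  move=> xe; case: (e) U sz xe => [|a [|b e']] //= /andP [ab _] _.
  rewrite in_cons => /orP [/eqP ->|xe]; last first.
    by exists a; rewrite ?mem_head // eq_sym; apply: contraNneq ab => ->.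
  exists b; first by rewrite !inE eqxx orbT.
  by apply: contraNneq ab => ->; rewrite mem_head.
case: (boolP (all (fun x => dotv r x == 0) e)) => //= /allPn [x xe rx0].
have [y ye xy] := other x xe; have Kxy := key x y xe ye xy.
have [rx|rx] : (dotv r x = 1 \/ dotv r x = -1) \/ (dotv r x = 2^-1 \/ dotv r x = - 2^-1).
- have rx0' : dotv r x <> 0 by apply/eqP.
  move: Kxy => [[K|[K|K]] [K'|[K'|K']]];
  (try by left; left; lra); (try by left; right; lra); (try by right; left; lra);
  (try by right; right; lra); exfalso; apply: rx0'; lra.
- apply/orP; left; apply/hasP; exists x => //; apply/andP; split.
    by case: rx => ->; rewrite eqxx ?orbT.
  apply/allP => z ze; apply/implyP => zx; rewrite eq_sym in zx; apply/eqP.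
  by case: rx => rx; case: (key x z xe ze zx) => [[K|[K|K]] [K'|[K'|K']]]; lra.
- apply/orP; right; apply/allP => z ze; have [<-|zx] := eqVneq x z.
    by case: rx => ->; rewrite eqxx ?orbT.
  suff [->|->] : dotv r z = 2^-1 \/ dotv r z = - 2^-1 by rewrite eqxx ?orbT.
  by case: rx => rx; case: (key x z xe ze zx) => [[K|[K|K]] [K'|[K'|K']]];
    ((by left; lra) || (by right; lra) || (exfalso; lra)).
Qed.

End Frames.

Lemma neg_sum2 (R : realType) (c d : R) : 0 <= c -> 0 <= d -> 0 + 0 - (c + d) = 1 -> False.
Proof. by lra. Qed.

Lemma neg_sum4 (R : realType) (a b c d : R) : 0 <= a -> 0 <= b -> 0 <= c -> 0 <= d ->
  - a - b + (- c - d) = 1 -> False.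
Proof. by lra. Qed.

(** * Closed subsystems of type D and half-spin roots *)

Section DCount.
Variables (R : realType) (n : nat) (Phi : seq 'rV[R]_n).
Hypothesis slP : simply_laced Phi.
Implicit Types (x y z c r v : 'rV[R]_n) (e : seq 'rV[R]_n).

Let PhiU : uniq Phi. Proof. by case: slP. Qed.
Lemma Dframe_sub e e' : Dframe Phi e -> uniq e' -> {subset e' <= e} -> Dframe Phi e'.
Proof.
move=> [_ e1 e0 eP] U sub; split=> //.
- by move=> x /sub; exact: e1.
- by move=> x y /sub xe /sub; exact: e0.
- by move=> x y /sub xe /sub; exact: eP.
Qed.

Definition Dclosed e := all (fun r => Droot e r || all (fun x => dotv r x == 0) e) Phi.

(** The neighbours of [x + y] are [x + z], [x - z], [y + z] and [y - z], for [z] among the other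
    frame vectors; closedness rules out any further ones. *)
Lemma Dframe_count e x y : Dframe Phi e -> Dclosed e -> x \in e -> y \in e -> x != y ->
  count (fun r => dotv r (x + y) == 1) Phi = (4 * (size e - 2))%N.
Proof.
move=> [U e1 e0 eP] /allP cl xe ye xy; have yx : y != x by rewrite eq_sym.
pose e' := [seq z <- e | (z != x) && (z != y)].
have e'P z : z \in e' -> [/\ z \in e, z != x & z != y].
  by rewrite mem_filter => /andP [/andP [-> ->] ->].
have sz : size e = (size e').+2.
  apply: (@perm_size _ e [:: x, y & e']); apply: uniq_perm => //=.
    by rewrite inE negb_or xy !mem_filter !eqxx /= andbF filter_uniq.
  move=> z; rewrite !inE mem_filter.
  have [->|zx] := eqVneq z x; first by rewrite xe.
  by have [->|zy] := eqVneq z y; rewrite ?ye.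
pose g z := [:: x + z; x - z; y + z; y - z].
pose L := flatten [seq g z | z <- e'].
have gz z w : z \in e' -> w \in e -> w \in [:: x; y; z] \/ {in g z, forall u, dotv u w = 0}.
  move=> /e'P [ze zx zy] we.
  have [->|wx] := eqVneq w x; first by left; rewrite mem_head.
  have [->|wy] := eqVneq w y; first by left; rewrite !inE eqxx orbT.
  have [->|wz] := eqVneq w z; first by left; rewrite !inE eqxx !orbT.
  have [xw yw zw] : [/\ dotv x w = 0, dotv y w = 0 & dotv z w = 0].
    by split; apply: e0; rewrite // eq_sym.
  by right=> u; rewrite !inE => /or4P [] /eqP ->; rewrite !dotvL ?xw ?yw zw ?addr0 ?subr0.
have gu z : z \in e' -> {in g z, forall u, [/\ u \in Phi, dotv u (x + y) = 1 & dotv u z != 0]}.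
  move=> /e'P [ze zx zy]; have xz : x != z by rewrite eq_sym.
  have yz : y != z by rewrite eq_sym.
  have [P1 P2] := eP x z xe ze xz; have [P3 P4] := eP y z ye ze yz.
  have D := (e0 x y xe ye xy, e0 y x ye xe yx, e0 x z xe ze xz, e0 z x ze xe zx,
    e0 y z ye ze yz, e0 z y ze ye zy, e1 x xe, e1 y ye, e1 z ze).
  move=> u; rewrite !inE => /or4P [] /eqP ->; split=> //; rewrite !dotvL !D;
    by rewrite ?addr0 ?subr0 ?add0r ?sub0r ?oppr_eq0 ?oner_eq0.
have LU : uniq L.
  have e'U : uniq e' by exact: filter_uniq.
  suff: forall s, uniq s -> {subset s <= e'} -> uniq (flatten [seq g z | z <- s]) by exact.
  elim=> // z s IH; rewrite cons_uniq => /andP [zs sU] sub.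
  have sub' : {subset s <= e'} by move=> w ws; apply: sub; rewrite inE ws orbT.
  have ze' : z \in e' by apply: sub; rewrite mem_head.
  have [ze zx zy] := e'P z ze'.
  rewrite -[flatten _]/(g z ++ flatten [seq g z | z <- s]) cat_uniq IH // andbT.
  apply/andP; split; last first.
    apply/hasPn => u /flattenP [_ /mapP [w ws ->] uw]; apply/negP => /(gu z ze') [_ _].
    have [|H] := gz w z (sub' w ws) ze; last by rewrite H ?eqxx.
    rewrite !inE (negbTE zx) (negbTE zy) /= => /eqP E.
    by move: zs; rewrite E ws.
  have xz : x != z by rewrite eq_sym.
  have yz : y != z by rewrite eq_sym.
  have D := (e0 x y xe ye xy, e0 y x ye xe yx, e0 x z xe ze xz, e0 z x ze xe zx,
    e0 y z ye ze yz, e0 z y ze ye zy, e1 x xe, e1 y ye, e1 z ze).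
  apply: (@map_uniq _ _ (fun u => (dotv u x, dotv u z))).
  rewrite /g /= !dotvL !D !inE !xpair_eqE !negb_or.
  have F1 : 1 == -1 :> R = false by apply/eqP; lra.
  by rewrite ?addr0 ?subr0 ?add0r ?sub0r !eqxx oner_eq0 F1 /= ?andbF.
have szL : size L = (4 * size e')%N.
  by rewrite /L; elim: (e') => //= z s ->; lia.
have -> : (size e - 2)%N = size e' by rewrite sz; lia.
rewrite -szL -size_filter; apply: perm_size; apply: uniq_perm => //.
  exact: filter_uniq.
move=> r; rewrite mem_filter; apply/idP/idP; last first.
  case/flattenP => _ /mapP [z ze' ->] /(gu z ze') [-> -> _].
  by rewrite eqxx.
move=> /andP [/eqP rxy rP]; have := cl r rP; case/orP; last first.
  move=> /allP r0; move: rxy; rewrite dotvDr (eqP (r0 x xe)) (eqP (r0 y ye)); lra.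
case/hasP => p pe /hasP [q qe /andP [pq E]].
have Z u w : u \in e -> w \in e -> dotv u w = (u == w)%:R.
  by move=> ue we; have [->|uw] := eqVneq u w; rewrite ?e1 ?e0.
have inL z w : z \in e -> w = x \/ w = y -> w != z -> r = w + z \/ r = w - z -> r \in L.
  move=> ze wxy wz rwz.
  have zx : z != x.
    case: wxy => wE; rewrite wE in wz rwz; first by rewrite eq_sym.
    apply/negP => /eqP zE; rewrite zE in rwz; case: rwz => rE; move: rxy.
      by rewrite rE !dotvL !Z // !eqxx (negbTE xy) (negbTE yx) /=; lra.
    by rewrite rE !dotvL !Z // !eqxx (negbTE xy) (negbTE yx) /=; lra.
  have zy : z != y.
    case: wxy => wE; rewrite wE in wz rwz; last by rewrite eq_sym.
    apply/negP => /eqP zE; rewrite zE in rwz; case: rwz => rE; move: rxy.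
      by rewrite rE !dotvL !Z // !eqxx (negbTE xy) (negbTE yx) /=; lra.
    by rewrite rE !dotvL !Z // !eqxx (negbTE xy) (negbTE yx) /=; lra.
  apply/flattenP; exists (g z); first by apply/mapP; exists z; rewrite // mem_filter zx zy.
  by rewrite !inE; case: wxy => <-; case: rwz => ->; rewrite eqxx ?orbT.
have qp : q != p by rewrite eq_sym.
have B (b : bool) : 0 <= b%:R :> R by exact: ler0n.
case/or3P: E => /eqP rE; move: (rxy); rewrite {1}rE !dotvL !Z //.
- have [px|px] := eqVneq p x.
    by move=> _; apply: (inL q p) => //; [left|left].
  have [py|py] := eqVneq p y.
    by move=> _; apply: (inL q p) => //; [right|left].
  have [qx|qx] := eqVneq q x.
    by move=> _; apply: (inL p q) => //; [left|left; rewrite addrC].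
  have [qy|qy] := eqVneq q y; last by rewrite !addr0 => /eqP; rewrite eq_sym oner_eq0.
  by move=> _; apply: (inL p q) => //; [right|left; rewrite addrC].
- have [px|px] := eqVneq p x.
    by move=> _; apply: (inL q p) => //; [left|right].
  have [py|py] := eqVneq p y.
    by move=> _; apply: (inL q p) => //; [right|right].
  by move/(neg_sum2 (B _) (B _)).
- by move/(neg_sum4 (B _) (B _) (B _) (B _)).
Qed.

(** Sign changes make all coordinates equal to one half; five frame vectors are kept, as many as an
    E6 needs. *)
Lemma all_half_Dframe e r : Dframe Phi e -> (4 < size e)%N ->
  all (fun x => (dotv r x == 2^-1) || (dotv r x == - 2^-1)) e ->
  exists2 e5, Dframe Phi e5 & size e5 = 5%N /\ {in e5, forall x, dotv r x = 2^-1}.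
Proof.
move=> De sz /allP rh; have De' := Dframe_opp slP (fun x => dotv r x == - 2^-1) De.
set e' := map _ e in De'.
have sz' : (4 < size e')%N by rewrite size_map.
have sub : {subset take 5 e' <= e'} by exact: mem_take.
exists (take 5 e').
  by apply: (Dframe_sub De') => //; rewrite take_uniq //; case: De'.
split=> [|_ /sub /mapP [x xe ->]]; first exact: size_takel.
case: ifP => [/eqP E|/eqP E]; first by rewrite dotvNr E opprK.
by have := rh x xe; case/orP => /eqP.
Qed.

(** A frame that no root extends is closed unless some root has all its coordinates equal to a half
    up to sign. For a frame of length 4, such a root yields by triality a frame of length 5, so the
    second alternative always has five frame vectors at hand. *)
Lemma D_or_E6 N : {in Phi, forall a, count (fun x => dotv x a == 1) Phi = N} ->
  Phi != [::] -> (2 * n < N + 2)%N ->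
  (exists e, [/\ Dframe Phi e, (4 <= size e)%N, Dclosed e & N = 4 * (size e - 2)]%N) \/
  (exists2 r, r \in Phi & exists2 e5, Dframe Phi e5 &
     size e5 = 5%N /\ {in e5, forall x, dotv r x = 2^-1}).
Proof.
move=> cnt Phi0 nN.
have [c cP] : exists c, c \in Phi by case: (Phi) Phi0 => // c s _; exists c; rewrite mem_head.
have [e4 De4 sz4] : exists2 e, Dframe Phi e & size e = 4%N.
  have n0 : (0 < n)%N.
    rewrite lt0n; apply/negP => /eqP n0; have := root_neq0 slP cP.
    by rewrite -dotv_eq0 dotvE; move: (c); rewrite n0 => c'; rewrite big_ord0 eqxx.
  have /hasP [x xP /eqP xc] : has (fun x => dotv x c == 1) Phi.
    by rewrite has_count cnt //; lia.
  have E := count_orth_nbrs slP cP xP xc; rewrite cnt // in E.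
  have [|y [z [[yP zP yc zc] [yx zx yz]]]] := find_D4 slP cP xP xc; first by lia.
  exact: (@Dframe4 _ _ _ slP c x y z).
pose half e := has (fun r => all (fun x => (dotv r x == 2^-1) || (dotv r x == - 2^-1)) e) Phi.
have fin e : Dframe Phi e -> (4 <= size e)%N -> ~~ has (Dextends e) Phi -> ~~ half e ->
    exists e, [/\ Dframe Phi e, (4 <= size e)%N, Dclosed e & N = 4 * (size e - 2)]%N.
  move=> De sz /hasPn nx /hasPn nh.
  have cl : Dclosed e.
    apply/allP => r rP; have := Dframe_root_types slP De _ rP.
    by rewrite (negbTE (nx r rP)) (negbTE (nh r rP)) /= !orbF; apply; lia.
  exists e; split=> //.
  case: e De sz cl {nx nh} => [|a [|b e]] // De _ cl.
  have [U _ _ eP] := De.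
  have ab : a != b by move: U => /= /andP []; rewrite inE negb_or => /andP [].
  have ia : a \in [:: a, b & e] by rewrite mem_head.
  have ib : b \in [:: a, b & e] by rewrite !inE eqxx orbT.
  rewrite -(Dframe_count De cl ia ib ab) cnt //.
  by have [] := eP a b ia ib ab.
have fin5 e : Dframe Phi e -> (4 < size e)%N ->
    (exists e, [/\ Dframe Phi e, (4 <= size e)%N, Dclosed e & N = 4 * (size e - 2)]%N) \/
    (exists2 r, r \in Phi & exists2 e5, Dframe Phi e5 &
       size e5 = 5%N /\ {in e5, forall x, dotv r x = 2^-1}).
  move=> De sz; have [|e' [De' sz' nx]] := Dframe_max slP De; first by lia.
  case: (boolP (half e')) => [/hasP [r rP rh]|nh]; last by left; apply: (fin e') => //; lia.
  by right; exists r => //; apply: (all_half_Dframe De') => //; lia.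
case: (boolP (has (Dextends e4) Phi)) => [/hasP [r rP rx]|nx].
  have [|v Dv _] := Dframe_ext slP De4 _ rP rx; first by rewrite sz4.
  by apply: (fin5 _ Dv); rewrite /= sz4.
case: (boolP (half e4)) => [/hasP [r rP rh]|nh]; last by left; apply: (fin e4); rewrite ?sz4.
pose s x := dotv r x == - 2^-1.
have De4' := Dframe_opp slP s De4.
have rh' : {in map (fun x => if s x then - x else x) e4, forall x, dotv r x = 2^-1}.
  move=> _ /mapP [x xe ->]; rewrite /s; case: ifP => [/eqP E|/eqP E]; first by rewrite dotvNr E opprK.
  by move/allP: rh => /(_ x xe) /orP [] /eqP.
move: De4' rh'; case: e4 {De4 nx rh} sz4 => [|a [|b [|c' [|d [|]]]]] //= _ De4 rh.
have [|e5 De5 sz5] := Dframe5 slP De4 rP; last by apply: (fin5 _ De5); rewrite sz5.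
by split; apply: rh; rewrite !inE eqxx ?orbT.
Qed.
End DCount.

(** * Root data of type E *)

Fixpoint idot (c g : seq int) : int :=
  match c, g with
  | x :: c', y :: g' => x * y + idot c' g'
  | _, _ => 0
  end.

Definition reflc (G : seq (seq int)) (c : seq int) (j : nat) : seq int :=
  set_nth 0 c j (c`_j - idot c (nth [::] G j)).

Definition unitc (k j : nat) : seq int := [seq Posz (i == j) | i <- iota 0 k].

(** At inner product -1 the reflection adds the base vector, so heights go up by one. *)
Definition next_level (G L : seq (seq int)) : seq (seq int) :=
  undup (flatten [seq [seq reflc G c j | j <- iota 0 (size G)
                                      & idot c (nth [::] G j) == -1] | c <- L]).

Fixpoint levels (G : seq (seq int)) (m : nat) (L : seq (seq int)) : seq (seq int) :=
  if m is m'.+1 then L ++ levels G m' (next_level G L) else [::].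

(* Roots of height at most [m], in coordinates with respect to a base of Gram
   matrix [G]. *)
Definition pos_rootsZ G m : seq (seq int) :=
  levels G m [seq unitc (size G) j | j <- iota 0 (size G)].

Definition rootsZ G m : seq (seq int) :=
  let P := pos_rootsZ G m in P ++ [seq map -%R c | c <- P].

(** Unlike coefficients, inner products with the base depend only on the vector. Distinct values
    thus certify distinct roots without knowing that the base is independent. *)
Definition dots (G : seq (seq int)) (c : seq int) := [seq idot c g | g <- G].

(** Bourbaki's numbering shifted to start at 0: node 1 hangs on node 3, and initial segments of the
    nodes give E7 and E6. *)
Definition gramE8 : seq (seq int) :=
  [:: [:: 2; 0; -1; 0; 0; 0; 0; 0];
      [:: 0; 2; 0; -1; 0; 0; 0; 0];
      [:: -1; 0; 2; -1; 0; 0; 0; 0];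
      [:: 0; -1; -1; 2; -1; 0; 0; 0];
      [:: 0; 0; 0; -1; 2; -1; 0; 0];
      [:: 0; 0; 0; 0; -1; 2; -1; 0];
      [:: 0; 0; 0; 0; 0; -1; 2; -1];
      [:: 0; 0; 0; 0; 0; 0; -1; 2]].
Definition gramE7 := [seq take 7 g | g <- take 7 gramE8].
Definition gramE6 := [seq take 6 g | g <- take 6 gramE8].

(** The bounds 11, 17 and 29 are the heights of the highest roots, one less than the Coxeter
    numbers. *)
Definition rootsE6 := rootsZ gramE6 11.
Definition rootsE7 := rootsZ gramE7 17.
Definition rootsE8 := rootsZ gramE8 29.

Definition rootsZ_ok (G S : seq (seq int)) (theta rho : seq int) (sz N : nat) :=
  [&& size S == sz, uniq [seq dots G c | c <- S],
      all (fun c => all (fun j => reflc G c j \in S) (iota 0 (size G))) S,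
      all (fun j => unitc (size G) j \in S) (iota 0 (size G)),
      (theta \in S) && (size theta == size G), all (fun z => 0 < z) theta,
      count (fun c => idot c (nth [::] G 0) == 1) S == N &
      all (fun g => (idot rho g == 2) && (size g == size G)) G].

Definition thetaE6 : seq int := [:: 1; 2; 2; 3; 2; 1].
Definition thetaE7 : seq int := [:: 2; 2; 3; 4; 3; 2; 1].
Definition thetaE8 : seq int := [:: 2; 3; 4; 6; 5; 4; 3; 2].

(** Coefficients of the sum of the positive roots, twice the Weyl vector; hence the pairing 2 with
    each base vector. *)
Definition rhoE6 : seq int := [:: 16; 22; 30; 42; 30; 16].
Definition rhoE7 : seq int := [:: 34; 49; 66; 96; 75; 52; 27].
Definition rhoE8 : seq int := [:: 92; 136; 182; 270; 220; 168; 114; 58].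

Lemma rootsE6_ok : rootsZ_ok gramE6 rootsE6 thetaE6 rhoE6 72 20.
Proof. by vm_compute. Qed.
Lemma rootsE7_ok : rootsZ_ok gramE7 rootsE7 thetaE7 rhoE7 126 32.
Proof. by vm_compute. Qed.
Lemma rootsE8_ok : rootsZ_ok gramE8 rootsE8 thetaE8 rhoE8 240 56.
Proof. by vm_compute. Qed.

(** * Minuscule extensions *)

Lemma idotE k c g : (size g <= k)%N -> idot c g = \sum_(i < k) c`_i * g`_i.
Proof.
elim: k c g => [|k IH] [|x c] [|y g] //= H; rewrite ?big_ord0 //.
- by rewrite big1 // => i _; rewrite nth_nil mul0r.
- by rewrite big1 // => i _; rewrite nth_nil mul0r.
- by rewrite big1 // => i _; rewrite (nth_nil 0 i) mulr0.
- by rewrite big_ord_recl /= (IH c g).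
Qed.

Lemma map_uniq_inj (T T' : eqType) (f : T -> T') (s : seq T) :
  uniq (map f s) -> {in s &, injective f}.
Proof.
elim: s => //= a s IH /andP [fa /IH {}IH] x y; rewrite !inE.
case/orP=> [/eqP ->|xs]; case/orP=> [/eqP ->|ys] // E; last exact: IH.
  by move: fa; rewrite E map_f.
by move: fa; rewrite -E map_f.
Qed.

Lemma exists_min (R : realType) (T : eqType) (f : T -> R) (s : seq T) : s != [::] ->
  exists2 x, x \in s & {in s, forall y, f x <= f y}.
Proof.
elim: s => // a s IH _; case: (eqVneq s [::]) => [->|/IH [x xs xm]].
  by exists a; rewrite ?mem_head // => y; rewrite inE => /eqP ->.
have [ax|xa] := leP (f a) (f x).
  exists a; rewrite ?mem_head // => y; rewrite inE => /orP [/eqP -> //|/xm].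
  exact: le_trans.
exists x; rewrite ?inE ?xs ?orbT // => y; rewrite inE => /orP [/eqP ->|/xm //].
exact: ltW.
Qed.

Section Lincomb.
Variables (R : realType) (n : nat).
Implicit Types (b : seq 'rV[R]_n) (c : seq int) (G : seq (seq int)).

Definition lincomb b c : 'rV[R]_n := \sum_(i < size b) (c`_i)%:~R *: b`_i.

Definition isgram b G := [/\ size G = size b, all (fun g => size g == size b) G &
  forall i j, (i < size b)%N -> (j < size b)%N ->
    dotv b`_i b`_j = ((nth [::] G j)`_i)%:~R].

Lemma dotv_lincomb b c v :
  dotv (lincomb b c) v = \sum_(i < size b) (c`_i)%:~R * dotv b`_i v.
Proof. by rewrite dotv_suml; apply: eq_bigr => i _; rewrite dotvZl. Qed.

Lemma lincomb_dot b G c j : isgram b G -> (j < size b)%N ->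
  dotv (lincomb b c) b`_j = (idot c (nth [::] G j))%:~R.
Proof.
move=> [sG /allP aG gG] jb; rewrite dotv_lincomb.
have sg : size (nth [::] G j) = size b by apply/eqP/aG; rewrite mem_nth // sG.
rewrite (@idotE (size b)) ?sg // rmorph_sum /=; apply: eq_bigr => i _.
by rewrite gG // rmorphM.
Qed.

Lemma lincomb_set b c j z : (j < size b)%N ->
  lincomb b (set_nth 0 c j (c`_j - z)) = lincomb b c - z%:~R *: b`_j.
Proof.
move=> jb; rewrite /lincomb (bigD1 (Ordinal jb)) //= [in RHS](bigD1 (Ordinal jb)) //=.
rewrite nth_set_nth /= eqxx addrAC rmorphB /= scalerBl; congr (_ + _).
apply: eq_bigr => i ij; rewrite nth_set_nth /= ifN //.
Qed.

Lemma lincomb_opp b c : lincomb b (map -%R c) = - lincomb b c.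
Proof.
rewrite /lincomb -sumrN; apply: eq_bigr => i _; rewrite -scaleNr -rmorphN /=.
have [ic|ci] := ltnP i (size c); first by rewrite (nth_map 0).
by rewrite [in LHS]nth_default ?size_map // [c`_i]nth_default // oppr0.
Qed.

Lemma lincomb_unit b j : (j < size b)%N -> lincomb b (unitc (size b) j) = b`_j.
Proof.
move=> jb; rewrite /lincomb (bigD1 (Ordinal jb)) //= big1 ?addr0.
  by rewrite (nth_map 0%N) ?size_iota // nth_iota // add0n eqxx scale1r.
move=> i ij; rewrite (nth_map 0%N) ?size_iota // nth_iota // add0n.
by rewrite (negbTE (ij : (i : nat) != j)) scale0r.
Qed.

Lemma isgram_rcons b G r (v : seq int) : isgram b G -> size v = size b ->
  dotv r r = 2 -> (forall i, (i < size b)%N -> dotv r b`_i = (v`_i)%:~R) ->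
  isgram (rcons b r) (rcons [seq rcons p.1 p.2 | p <- zip G v] (rcons v 2)).
Proof.
move=> [sG /allP aG gG] sv rr rb.
have sz : size (zip G v) = size b by rewrite size_zip sG sv minnn.
split; first by rewrite !size_rcons size_map sz.
  rewrite all_rcons !size_rcons sv eqxx /=; apply/allP => _ /mapP [[g z] gz ->] /=.
  rewrite size_rcons eqSS; apply: aG; move/(map_f fst): gz.
  by rewrite -/(unzip1 _) unzip1_zip // sG sv.
have aG' j : (j < size b)%N -> size (nth [::] G j) = size b.
  by move=> jb; apply/eqP/aG; rewrite mem_nth // sG.
move=> i j; rewrite !size_rcons !ltnS leq_eqVlt => /orP [/eqP ->|ib]; rewrite leq_eqVlt => /orP [/eqP ->|jb].
- rewrite !nth_rcons ltnn eqxx size_map sz ltnn eqxx nth_rcons sv ltnn eqxx rr.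
  by [].
- rewrite !nth_rcons ltnn eqxx jb size_map sz jb (nth_map ([::], 0)) ?sz //=.
  by rewrite nth_zip /= ?sG ?sv // nth_rcons aG' // ltnn eqxx rb.
- rewrite !nth_rcons ib ltnn eqxx size_map sz ltnn eqxx nth_rcons sv ib dotvC.
  exact: rb.
- rewrite !nth_rcons ib jb size_map sz jb (nth_map ([::], 0)) ?sz //=.
  by rewrite nth_zip /= ?sG ?sv // nth_rcons aG' // ib gG.
Qed.

Lemma isgram_map b G (p : seq nat) : isgram b G -> all (fun i => i < size b)%N p ->
  isgram [seq b`_i | i <- p] [seq [seq (nth [::] G j)`_i | i <- p] | j <- p].
Proof.
move=> [sG _ gG] /allP pb; split; first by rewrite !size_map.
  by apply/allP => _ /mapP [j _ ->]; rewrite !size_map.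
move=> i j; rewrite !size_map => ip jp.
rewrite !(nth_map 0%N) // gG //; apply: pb; exact: mem_nth.
Qed.

End Lincomb.

Section Dominance.
Variables (R : realType) (n : nat) (Phi : seq 'rV[R]_n).
Hypothesis slP : simply_laced Phi.
Implicit Types (x y z c r v : 'rV[R]_n) (b T : seq 'rV[R]_n).

Let PhiU : uniq Phi. Proof. by case: slP. Qed.
Let Phi2 : norm2 Phi. Proof. by case: slP. Qed.

(* Among the roots outside the subsystem [T] but not orthogonal to it, one that
   minimizes the inner product with [rho] is antidominant, and comparing it with
   the highest root [theta] shows that it is the opposite of a minuscule weight. *)
Lemma minuscule_root b T (theta : seq int) rho :
  {subset b <= T} -> {subset T <= Phi} -> (forall x, x \in T -> - x \in T) ->
  (forall x y, x \in T -> y \in b -> x - dotv x y *: y \in T) ->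
  lincomb b theta \in T -> size theta = size b -> all (fun z : int => 0 < z) theta ->
  {in b, forall y, dotv y rho = 2} ->
  forall r, r \in Phi -> r \notin T -> has (fun y => dotv r y != 0) b ->
  exists2 j, (j < size b)%N & theta`_j = 1 /\
    exists2 r', r' \in Phi & forall i, (i < size b)%N -> dotv r' b`_i = - (i == j)%:R.
Proof.
move=> bT TP To Tr thT sth /allP th0 brho r rP rT rb.
pose Q := [seq x <- Phi | (x \notin T) && has (fun y => dotv x y != 0) b].
have [|x] := @exists_min R _ (fun x => dotv x rho) Q.
  by apply/eqP => QE; have : r \in Q by [rewrite mem_filter rT rb rP]; rewrite QE.
rewrite mem_filter -andbA => /and3P [xT /hasP [y0 y0b xy0] xP] xm.
have xdot t : t \in T -> dotv x t = 1 \/ dotv x t = -1 \/ dotv x t = 0.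
  move=> tT; have [E|[E|//]] := root_dot_cases slP xP (TP t tT).
    by move: xT; rewrite E tT.
  by move: xT; rewrite E To.
(* Were the inner product 1, [x - y] would be another candidate, lower by 2 against [rho]. *)
have xb y : y \in b -> dotv x y = -1 \/ dotv x y = 0.
  move=> yb; have yP := TP y (bT y yb); have [xy|//] := xdot y (bT y yb).
  have xyP := root_sub slP xP yP xy.
  have xyb : dotv (x - y) y = -1 by rewrite dotvBl xy (Phi2 yP); ring.
  have : x - y \in Q.
    rewrite mem_filter xyP andbT; apply/andP; split.
      apply/negP => xyT; move: xT; have := Tr _ _ xyT yb.
      by rewrite xyb scaleN1r opprK subrK => ->.
    by apply/hasP; exists y => //; rewrite xyb oppr_eq0 oner_eq0.
  by move/xm; rewrite dotvBl (brho y yb) lerDl oppr_ge0 lern0.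
have [j jb xj] : exists2 j, (j < size b)%N & dotv x b`_j = -1.
  exists (index y0 b); first by rewrite index_mem.
  by rewrite nth_index //; have [//|E] := xb y0 y0b; move: xy0; rewrite E eqxx.
have thi i : (i < size b)%N -> 1 <= (theta`_i)%:~R :> R.
  move=> ib; have := th0 theta`_i; rewrite mem_nth ?sth // => /(_ isT).
  by rewrite gtz0_ge1 -(ler_int R).
have xbi i : (i < size b)%N -> dotv x b`_i = -1 \/ dotv x b`_i = 0.
  by move=> ib; apply: xb; exact: mem_nth.
pose F (i : 'I_(size b)) := - ((theta`_i)%:~R * dotv x b`_i).
have F0 i : 0 <= F i.
  have t1 := thi i (ltn_ord i); rewrite /F; case: (xbi i (ltn_ord i)) => ->; lra.
pose S := \sum_(i < size b | i != Ordinal jb) F i.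
have S0 : 0 <= S by apply: sumr_ge0 => i _; exact: F0.
have E : dotv x (lincomb b theta) = - (theta`_j)%:~R - S.
  rewrite dotvC dotv_lincomb (bigD1 (Ordinal jb)) //= dotvC xj mulrN1; congr (_ + _).
  by rewrite -sumrN; apply: eq_bigr => i _; rewrite opprK dotvC.
have tj := thi j jb.
(* The inner product with [theta] is at least -1, yet it equals minus a coefficient that is at least
   1, minus the nonnegative [S]. *)
have [tj1 SE] : (theta`_j)%:~R = 1 :> R /\ S = 0.
  by case: (xdot _ thT) => [|[|]]; rewrite E => H; split; lra.
exists j => //; split; first by apply/eqP; rewrite -(eqr_int R) tj1.
exists x => // i ib; have [->|ij] := eqVneq i j; first by rewrite xj.
have /eqP := SE; rewrite psumr_eq0 => [/allP /(_ (Ordinal ib))|k _]; last exact: F0.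
rewrite mem_index_enum => /(_ isT) /implyP /(_ ij); rewrite /F /= oppr_eq0 mulf_eq0.
case/orP=> /eqP H; last by rewrite H oppr0.
by have := thi i ib; rewrite H ler10.
Qed.

End Dominance.

Section SubsystemZ.
Variables (R : realType) (n : nat) (Phi : seq 'rV[R]_n).
Hypothesis slP : simply_laced Phi.
Variables (b : seq 'rV[R]_n) (G : seq (seq int)).
Hypotheses (bP : {subset b <= Phi}) (gG : isgram b G).

Let PhiU : uniq Phi. Proof. by case: slP. Qed.
Let sG : size G = size b. Proof. by case: gG. Qed.

Lemma lincomb_refl c j : (j < size b)%N ->
  lincomb b (reflc G c j) = lincomb b c - dotv (lincomb b c) b`_j *: b`_j.
Proof. by move=> jb; rewrite (lincomb_dot _ gG) // lincomb_set. Qed.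

Lemma lincomb_roots m c : c \in rootsZ G m -> lincomb b c \in Phi.
Proof.
suff H L : {in L, forall c, lincomb b c \in Phi} ->
    {in levels G m L, forall c, lincomb b c \in Phi}.
  have P : {in pos_rootsZ G m, forall c, lincomb b c \in Phi}.
    apply: H => d /mapP [j]; rewrite mem_iota sG => /andP [_ jb] ->.
    by rewrite lincomb_unit // bP // mem_nth.
  rewrite mem_cat => /orP [/P //|/mapP [d /P dP ->]].
  by rewrite lincomb_opp (root_oppE slP).
elim: m L => //= m IH L LP d; rewrite mem_cat => /orP [/LP //|]; apply: IH => {}d.
rewrite mem_undup => /flattenP [_ /mapP [e eL ->]] /mapP [j].
rewrite mem_filter mem_iota sG => /and3P [_ _ jb] ->.
rewrite lincomb_refl //; case: slP => _ _ C _; apply: C; first exact: LP.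
by rewrite bP // mem_nth.
Qed.

Definition sub_roots S := [seq lincomb b c | c <- S].

Lemma sub_roots_uniq S : uniq [seq dots G c | c <- S] -> uniq (sub_roots S).
Proof.
move=> U; have inj : {in S &, injective (dots G)} by exact: map_uniq_inj.
rewrite map_inj_in_uniq ?(map_uniq U) // => c d cS dS E; apply: inj => //.
apply: (@eq_from_nth _ 0); rewrite !size_map // sG => j jb.
rewrite !(nth_map [::]) ?sG //; apply/eqP; rewrite -(eqr_int R).
by rewrite -!(lincomb_dot _ gG) // E.
Qed.

Lemma sub_roots_count S : uniq (sub_roots S) -> (0 < size b)%N ->
  {subset sub_roots S <= Phi} ->
  {in Phi, forall r, r \in sub_roots S \/ {in b, forall y, dotv r y = 0}} ->
  count (fun x => dotv x b`_0 == 1) Phi =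
  count (fun c => idot c (nth [::] G 0) == 1) S.
Proof.
move=> U b0 SP H; have b0b : b`_0 \in b by exact: mem_nth.
transitivity (count (fun x => dotv x b`_0 == 1) (sub_roots S)).
  rewrite -!size_filter; apply: perm_size; apply: uniq_perm; rewrite ?filter_uniq //.
  move=> x; rewrite !mem_filter; case: eqP => //= x1.
  apply/idP/idP => [/H [//|/(_ _ b0b)]|/SP //].
  by rewrite x1 => /eqP; rewrite oner_eq0.
rewrite count_map; apply: eq_count => c /=.
by rewrite (lincomb_dot _ gG) // -(eqr_int R).
Qed.

(** A root neither in the subsystem nor orthogonal to it feeds [minuscule_root]. If there is none,
    all neighbours of the first base vector lie in the subsystem, where they are counted by
    computation. *)
Lemma sub_roots_dichotomy m theta rho sz N : (0 < size b)%N ->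
  rootsZ_ok G (rootsZ G m) theta rho sz N ->
  let T := sub_roots (rootsZ G m) in
  [/\ uniq T, size T = sz, {subset T <= Phi} & {subset b <= T}] /\
  (({in Phi, forall r, r \in T \/ {in b, forall y, dotv r y = 0}} /\
    count (fun x => dotv x b`_0 == 1) Phi = N) \/
   exists2 j, (j < size b)%N & theta`_j = 1 /\
     exists2 r, r \in Phi & forall i, (i < size b)%N -> dotv r b`_i = - (i == j)%:R).
Proof.
set S := rootsZ G m => b0 /and4P [/eqP szS U /allP refS /and5P [/allP unS /andP [thS /eqP szth] th0 /eqP cnt /allP rhoG]] T.
have TU : uniq T by exact: sub_roots_uniq.
have TP : {subset T <= Phi} by move=> _ /mapP [c cS ->]; exact: (@lincomb_roots m).
have bT : {subset b <= T}.
  move=> y /(nthP 0) [j jb <-]; apply/mapP; exists (unitc (size b) j); last by rewrite lincomb_unit.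
  by rewrite -sG; apply: unS; rewrite mem_iota sG.
split; first by split; rewrite ?size_map.
case: (boolP (all (fun r => (r \in T) || all (fun y => dotv r y == 0) b) Phi)) => [/allP H|].
  have {}H : {in Phi, forall r, r \in T \/ {in b, forall y, dotv r y = 0}}.
    by move=> r /H /orP [|/allP r0]; [left|right=> y /r0 /eqP].
  by left; split=> //; rewrite (sub_roots_count TU) // -cnt.
move=> /allPn [r rP]; rewrite negb_or -has_predC => /andP [rT rb]; right.
apply: (@minuscule_root _ _ _ slP b T theta (lincomb b rho)) rP rT rb => //.
- move=> _ /mapP [c cS ->]; rewrite -lincomb_opp; apply: map_f.
  move: cS; rewrite !mem_cat => /orP [cS|/mapP [d dS ->]]; first by rewrite map_f ?orbT.
  by rewrite mapK ?dS //; exact: opprK.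
- move=> _ y /mapP [c cS ->] /(nthP 0) [j jb <-]; rewrite -lincomb_refl //.
  by apply: map_f; have /allP := refS c cS; apply; rewrite mem_iota sG.
- exact: map_f.
- by rewrite szth.
- move=> y /(nthP 0) [j jb <-]; rewrite dotvC (lincomb_dot _ gG) //.
  have jG : nth [::] G j \in G by rewrite mem_nth // sG.
  by have /andP [/eqP -> _] := rhoG _ jG.
Qed.

End SubsystemZ.

(** * The chain E6, E7, E8 *)

Section ExceptionalChain.
Variables (R : realType) (n : nat) (Phi : seq 'rV[R]_n).
Hypothesis slP : simply_laced Phi.
Implicit Types (x y z r : 'rV[R]_n) (b : seq 'rV[R]_n).

Let Phi2 : norm2 Phi. Proof. by case: slP. Qed.

Definition has_base G := exists b, [/\ size b = size G, {subset b <= Phi} & isgram b G].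

(** The five vectors after [- r] are a base of the D5 of the frame, and the spin root [- r] is
    attached to the end node [a + b] only. *)
Lemma E6_base e5 r : Dframe Phi e5 -> size e5 = 5%N -> r \in Phi ->
  {in e5, forall x, dotv r x = 2^-1} -> has_base gramE6.
Proof.
case: e5 => [|a [|b [|c [|d [|f []]]]]] // [U e1 e0 eP] _ rP rh.
set e5 := [:: a; b; c; d; f] in U e1 e0 eP rh.
have [ia ib ic id jf] : [/\ a \in e5, b \in e5, c \in e5, d \in e5 & f \in e5].
  by split; rewrite !inE eqxx ?orbT.
move: U; rewrite /= !inE !negb_or andbT -!andbA.
case/and5P => nab nac nad naf /and5P [nbc nbd nbf ncd /andP [ncf ndf]].
have sy x y : x \in e5 -> y \in e5 -> x != y -> (dotv x y = 0) * (dotv y x = 0).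
  by move=> xe ye xy; rewrite !e0 // eq_sym.
have dE := (e1 _ ia, e1 _ ib, e1 _ ic, e1 _ id, e1 _ jf, sy _ _ ia ib nab, sy _ _ ia ic nac,
  sy _ _ ia id nad, sy _ _ ia jf naf, sy _ _ ib ic nbc, sy _ _ ib id nbd, sy _ _ ib jf nbf,
  sy _ _ ic id ncd, sy _ _ ic jf ncf, sy _ _ id jf ndf).
have rE := (rh _ ia, rh _ ib, rh _ ic, rh _ id, rh _ jf).
have rE' : (dotv a r = 2^-1) * (dotv b r = 2^-1) * (dotv c r = 2^-1) *
    (dotv d r = 2^-1) * (dotv f r = 2^-1) by rewrite !(dotvC _ r) !rE.
have [P1 P2] := eP _ _ ia ib nab.
have [_ P3] := eP _ _ ic ia ltac:(by rewrite eq_sym).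
have [_ P4] := eP _ _ id ic ltac:(by rewrite eq_sym).
have [_ P5] := eP _ _ jf id ltac:(by rewrite eq_sym).
exists [:: - r; a - b; a + b; c - a; d - c; f - d]; split=> //.
  move=> x; rewrite !inE => /or4P [/eqP ->|/eqP ->|/eqP ->|/or3P [] /eqP ->] //.
  by rewrite (root_oppE slP).
split=> //.
have H1 : (Negz 0)%:~R = -1 :> R by [].
by move=> [|[|[|[|[|[|i]]]]]] [|[|[|[|[|[|j]]]]]] //= _ _;
   rewrite !dotvL ?dE ?rE ?rE' ?(Phi2 rP) ?H1; field.
Qed.

Lemma isgramP b G : isgram b G -> forall G', G = G' -> isgram b G'.
Proof. by move=> H G' <-. Qed.

Lemma E6_step N : {in Phi, forall a, count (fun x => dotv x a == 1) Phi = N} ->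
  has_base gramE6 -> N = 20%N \/ has_base gramE7.
Proof.
move=> cnt [b [sb bP gb]]; have b0 : (0 < size b)%N by rewrite sb.
have [_ [[_]|[j jb [tj [r rP rb]]]]] := sub_roots_dichotomy slP bP gb b0 rootsE6_ok.
  by rewrite cnt ?bP ?mem_nth //; left.
right; rewrite sb in rb jb.
have [b' [sb' b'P gb' rb']] : exists b', [/\ size b' = 6%N, {subset b' <= Phi},
    isgram b' gramE6 & forall i, (i < 6)%N -> dotv r b'`_i = - (i == 5%N)%:R].
  have [j0|j5] : j = 0%N \/ j = 5%N.
    by clear rb; case: j jb tj => [|[|[|[|[|[|j]]]]]] //; [left|right].
  (* The diagram symmetry of E6 exchanges the two nodes where [thetaE6] has coefficient 1, so the
     new root can always be attached to node 5. *)
  - pose p := [:: 5; 1; 4; 3; 2; 0]%N.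
    exists [seq b`_i | i <- p]; split=> //.
    + by move=> _ /mapP [i ip ->]; apply/bP/mem_nth; rewrite sb; move: i ip; apply/allP.
    + by apply: (isgramP (isgram_map gb _)) => //; rewrite sb.
    + by rewrite j0 in rb; move=> [|[|[|[|[|[|i]]]]]] //= _; rewrite rb.
  - by exists b; split=> // i ib; rewrite rb // j5.
have gr := isgram_rcons gb' (v := [:: 0; 0; 0; 0; 0; -1]) (r := r).
exists (rcons b' r); split; first by rewrite size_rcons sb'.
  by move=> x; rewrite mem_rcons inE => /orP [/eqP -> //|/b'P].
apply: (isgramP (gr _ _ _)) => //; rewrite ?sb' ?Phi2 //.
by move=> [|[|[|[|[|[|i]]]]]] //= ib; rewrite rb' //= oppr0.
Qed.

Lemma E7_step N : {in Phi, forall a, count (fun x => dotv x a == 1) Phi = N} ->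
  has_base gramE7 -> N = 32%N \/ has_base gramE8.
Proof.
move=> cnt [b [sb bP gb]]; have b0 : (0 < size b)%N by rewrite sb.
have [_ [[_]|[j jb [tj [r rP rb]]]]] := sub_roots_dichotomy slP bP gb b0 rootsE7_ok.
  by rewrite cnt ?bP ?mem_nth //; left.
right; rewrite sb in rb jb.
have j6 : j = 6%N by clear rb; case: j jb tj => [|[|[|[|[|[|[|j]]]]]]].
have gr := isgram_rcons gb (v := [:: 0; 0; 0; 0; 0; 0; -1]) (r := r).
exists (rcons b r); split; first by rewrite size_rcons sb.
  by move=> x; rewrite mem_rcons inE => /orP [/eqP -> //|/bP].
apply: (isgramP (gr _ _ _)) => //; rewrite ?sb ?Phi2 //.
by move=> [|[|[|[|[|[|[|i]]]]]]] //= ib; rewrite rb // j6 //= oppr0.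
Qed.

Definition E8_split b := {in Phi, forall r, r \in sub_roots b rootsE8 \/
  {in b, forall y, dotv r y = 0}}.

(** No coefficient of [thetaE8] is 1, so there is no minuscule extension and the chain ends here. *)
Lemma E8_step N : {in Phi, forall a, count (fun x => dotv x a == 1) Phi = N} ->
  has_base gramE8 -> N = 56%N /\
  exists b, [/\ size b = 8%N, {subset b <= Phi}, isgram b gramE8 & E8_split b].
Proof.
move=> cnt [b [sb bP gb]]; have b0 : (0 < size b)%N by rewrite sb.
have [_ [[spl]|[j jb [tj _]]]] := sub_roots_dichotomy slP bP gb b0 rootsE8_ok.
  by rewrite cnt ?bP ?mem_nth // => NE; split=> //; exists b.
by rewrite sb in jb; case: j jb tj => [|[|[|[|[|[|[|[|j]]]]]]]].
Qed.

Lemma root_classification N :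
  {in Phi, forall a, count (fun x => dotv x a == 1) Phi = N} ->
  Phi != [::] -> (2 * n < N + 2)%N ->
  [\/ exists e, [/\ Dframe Phi e, (4 <= size e)%N, Dclosed Phi e & N = 4 * (size e - 2)]%N,
      N = 20%N /\ has_base gramE6, N = 32%N /\ has_base gramE7 |
      N = 56%N /\
      exists b, [/\ size b = 8%N, {subset b <= Phi}, isgram b gramE8 & E8_split b]].
Proof.
move=> cnt Phi0 nN; have [|[r rP [e5 De5 [sz5 rh]]]] := D_or_E6 slP cnt Phi0 nN.
  by move=> H; constructor 1.
have B6 := E6_base De5 sz5 rP rh.
have [N20|B7] := E6_step cnt B6; first by constructor 2.
have [N32|B8] := E7_step cnt B7; first by constructor 3.
by constructor 4; exact: E8_step.
Qed.

End ExceptionalChain.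

(** * Isometries from equal Gram matrices *)

Section Isometry.
Variable R : realType.

(** The witness is [pinvmx B *m B']. The defect [X] kills [B]; as the Gram matrices agree, the rows
    of [X *m B'] have norm 0 and vanish. *)
Lemma gram_isometry (n m k : nat) (B : 'M[R]_(k, n)) (B' : 'M[R]_(k, m)) :
  row_full B -> B *m B^T = B' *m B'^T ->
  exists2 M : 'M[R]_(n, m), M *m M^T = 1%:M & B *m M = B'.
Proof.
move=> fB E; have pB : pinvmx B *m B = 1%:M by exact: mulVpmx.
exists (pinvmx B *m B').
  rewrite trmx_mul mulmxA -(mulmxA (pinvmx B)) -E mulmxA pB mul1mx -trmx_mul pB.
  by rewrite trmx1.
apply/eqP; rewrite -subr_eq0; apply/eqP; pose X := B *m pinvmx B - 1%:M.
have XB : X *m B = 0 by rewrite mulmxBl mul1mx -mulmxA pB mulmx1 subrr.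
have -> : B *m (pinvmx B *m B') - B' = X *m B' by rewrite mulmxBl mul1mx mulmxA.
have XX : (X *m B') *m (X *m B')^T = 0.
  by rewrite trmx_mul mulmxA -(mulmxA X) -E mulmxA XB !mul0mx.
apply/row_matrixP => i; rewrite row0; apply/eqP; rewrite -dotv_eq0.
move/matrixP/(_ i i): XX; rewrite [RHS]mxE => <-; apply/eqP.
by rewrite /dotv ![in LHS]mxE [in RHS]mxE; apply: eq_bigr => j _; rewrite !mxE.
Qed.

Lemma lincomb_mulmx (n m : nat) (b : seq 'rV[R]_n) (b' : seq 'rV[R]_m) (M : 'M_(n, m)) c :
  size b = size b' -> (forall i, (i < size b)%N -> b`_i *m M = b'`_i) ->
  lincomb b c *m M = lincomb b' c.
Proof.
move=> sb bM; rewrite /lincomb -sb mulmx_suml; apply: eq_bigr => i _.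
by rewrite -scalemxAl bM.
Qed.

Lemma rs_equiv_gram (n m : nat) (Phi b : seq 'rV[R]_n) (Psi b' : seq 'rV[R]_m) G S :
  spans Phi -> isgram b G -> isgram b' G ->
  Phi =i sub_roots b S -> Psi =i sub_roots b' S -> rs_equiv Phi Psi.
Proof.
move=> sp [sG _ gb] [sG' _ gb'] PhiS PsiS.
have sb : size b = size b' by rewrite -sG.
pose B := \matrix_(i < size b) b`_i; pose B' := \matrix_(i < size b) b'`_i.
have rowB i : row i B = b`_i by rewrite rowK.
have fB : row_full B.
  rewrite /row_full eqn_leq rank_leq_col /=.
  move: sp; rewrite /spans /span_dim => {1}<-; apply: mxrankS.
  apply/row_subP => i; rewrite rowK.
  have := mem_nth 0 (ltn_ord i); rewrite PhiS => /mapP [c _ ->].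
  rewrite /lincomb; apply: summx_sub => j _; apply: scalemx_sub.
  by rewrite -rowB; exact: row_sub.
have gE : B *m B^T = B' *m B'^T.
  apply/matrixP => i j; have := gb i j (ltn_ord i) (ltn_ord j).
  rewrite -gb' -?sb // /dotv => E; rewrite [LHS]mxE [RHS]mxE.
  transitivity ((b`_i *m (b`_j)^T) 0 0).
    by rewrite mxE; apply: eq_bigr => k _; rewrite !mxE.
  by rewrite E mxE; apply: eq_bigr => k _; rewrite !mxE.
have [M MM BM] := gram_isometry fB gE.
exists M; split=> //.
have bM i : (i < size b)%N -> b`_i *m M = b'`_i.
  move=> ib; have /(congr1 (row (Ordinal ib))) := BM.
  by rewrite row_mul !rowK.
have LM c := lincomb_mulmx c sb bM.
move=> y; rewrite PsiS; apply/mapP/mapP => [[c cS ->]|[x]].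
  by exists (lincomb b c); [rewrite PhiS map_f|rewrite LM].
by rewrite PhiS => /mapP [c cS ->] ->; exists c; rewrite ?LM.
Qed.

(** The number of roots and of neighbours of a root are the invariants from which [n] and [h] are
    recovered. *)
Lemma rs_equiv_count (n m : nat) (Phi : seq 'rV[R]_n) (Psi b' : seq 'rV[R]_m) G S :
  simply_laced Phi -> rs_equiv Phi Psi -> isgram b' G -> (0 < size b')%N ->
  {subset b' <= Psi} -> uniq [seq dots G c | c <- S] -> Psi =i sub_roots b' S ->
  size Phi = size S /\ exists2 a, a \in Phi &
    count (fun x => dotv x a == 1) Phi = count (fun c => idot c (nth [::] G 0) == 1) S.
Proof.
move=> [U _ _ _] [M [MM PsiE]] gb b0 bP US PsiS.
have inj : injective (fun x : 'rV[R]_n => x *m M).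
  by move=> x y E; rewrite -[x]mulmx1 -MM mulmxA E -mulmxA MM mulmx1.
have TU := sub_roots_uniq gb US.
have P : perm_eq [seq x *m M | x <- Phi] (sub_roots b' S).
  apply: uniq_perm; first by rewrite map_inj_uniq.
    exact: TU.
  by move=> y; rewrite -PsiE PsiS.
split; first by have := perm_size P; rewrite !size_map.
have b0b : b'`_0 \in b' by exact: mem_nth.
have := bP _ b0b; rewrite PsiE => /mapP [a aP aE].
exists a => //; transitivity (count (fun y => dotv y b'`_0 == 1) [seq x *m M | x <- Phi]).
  by rewrite count_map; apply: eq_count => x /=; rewrite aE dotv_mulmx.
rewrite (permP P) count_map; apply: eq_count => c /=.
by rewrite (lincomb_dot _ gb) // -(eqr_int R).
Qed.

End Isometry.

(** * Coordinates of the standard root systems *)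

Definition icomb (m : nat) (B : seq (seq int)) (c : seq int) : seq int :=
  [seq idot c [seq l`_t | l <- B] | t <- iota 0 m].

Section Row2.
Variables (R : realType) (m : nat).
Implicit Types (l : seq int) (B L G : seq (seq int)).

(* Integer coordinates are doubled, so that half-integers can be represented. *)
Definition row2 l : 'rV[R]_m := \row_i ((l`_i)%:~R / 2).

Lemma dotv_row2 l l' : (size l' <= m)%N -> dotv (row2 l) (row2 l') = (idot l l')%:~R / 4.
Proof.
move=> sl; rewrite dotvE (idotE _ sl) rmorph_sum mulr_suml; apply: eq_bigr => i _.
by rewrite !mxE rmorphM /=; field.
Qed.

Lemma lincomb_row2 B c : all (fun l => size l == m) B ->
  lincomb (map row2 B) c = row2 (icomb m B c).
Proof.
move=> /allP sB; apply/rowP => t; rewrite /lincomb summxE mxE size_map.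
rewrite (nth_map 0%N) ?size_iota // nth_iota // add0n (@idotE (size B)) ?size_map //.
rewrite rmorph_sum mulr_suml; apply: eq_bigr => i _.
by rewrite !mxE (nth_map [::]) // (nth_map [::]) // mxE rmorphM mulrA.
Qed.

Lemma isgram_row2 B G : all (fun l => size l == m) B ->
  [seq [seq idot x y | x <- B] | y <- B] == [seq [seq 4 * z | z <- g] | g <- G] ->
  isgram (map row2 B) G.
Proof.
move=> /allP sB /eqP E.
have sG : size G = size B by have /(congr1 size) := E; rewrite !size_map.
have Ej j : (j < size B)%N ->
    [seq idot x (nth [::] B j) | x <- B] = [seq 4 * z | z <- nth [::] G j].
  move=> jB; have /(congr1 (fun s => nth [::] s j)) := E.
  by rewrite !(nth_map [::]) ?sG.
have sGj j : (j < size B)%N -> size (nth [::] G j) = size B.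
  by move=> /Ej /(congr1 size); rewrite !size_map.
split; rewrite ?size_map //.
  by apply/allP => g /(nthP [::]) [j]; rewrite sG => jB <-; rewrite sGj.
move=> i j iB jB; rewrite !(nth_map [::]) // dotv_row2; last first.
  by rewrite (eqP (sB _ (mem_nth _ jB))).
have /(congr1 (fun s => s`_i)) := Ej j jB.
by rewrite (nth_map [::]) // (nth_map 0) ?sGj // => ->; rewrite rmorphM /=; field.
Qed.

Definition same_rows L L' := all (fun l => l \in L') L && all (fun l => l \in L) L'.

Lemma sub_roots_row2 B L S : all (fun l => size l == m) B ->
  same_rows L [seq icomb m B c | c <- S] ->
  map row2 L =i sub_roots (map row2 B) S.
Proof.
move=> sB /andP [/allP L1 /allP L2] x; apply/mapP/mapP => [[l lL ->]|[c cS ->]].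
  by have /mapP [c cS ->] := L1 l lL; exists c; rewrite ?lincomb_row2.
by exists (icomb m B c); [exact/L2/map_f|rewrite lincomb_row2].
Qed.

End Row2.

Arguments row2 {R m}.

(* A root system [Psi] whose elements are given by integral coordinates with
   respect to a base with Gram matrix [G]. *)
Definition modelled (R : realType) (m : nat) (Psi : seq 'rV[R]_m)
    (G S : seq (seq int)) (sz N : nat) := exists b' : seq 'rV[R]_m,
  [/\ isgram b' G, {subset b' <= Psi}, Psi =i sub_roots b' S & (0 < size b')%N] /\
  [/\ uniq [seq dots G c | c <- S], size S = sz &
      count (fun c => idot c (nth [::] G 0) == 1) S = N].

Lemma modelled_row2 (R : realType) (m : nat) (Psi : seq 'rV[R]_m) (L B G S : seq (seq int)) sz N :
  Psi =i map row2 L ->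
  [&& all (fun l => size l == m) B,
      [seq [seq idot x y | x <- B] | y <- B] == [seq [seq 4 * z | z <- g] | g <- G],
      same_rows L [seq icomb m B c | c <- S], all (fun l => l \in L) B &
      [&& (0 < size B)%N, uniq [seq dots G c | c <- S], size S == sz &
          count (fun c => idot c (nth [::] G 0) == 1) S == N]] ->
  modelled Psi G S sz N.
Proof.
move=> PsiL /and5P [sB gB sL /allP BL /and4P [B0 U /eqP sz' /eqP cnt]].
exists (map row2 B); split; split=> //; last by rewrite size_map.
- exact: isgram_row2.
- by move=> _ /mapP [l lB ->]; rewrite PsiL map_f // BL.
- by move=> x; rewrite PsiL (sub_roots_row2 sB sL).
Qed.

Section Standard.
Variable R : realType.

Definition iev (m i : nat) (z : int) : seq int := [seq if t == i then z else 0 | t <- iota 0 m].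
Definition iadd (m : nat) (c d : seq int) : seq int := [seq c`_t + d`_t | t <- iota 0 m].

Lemma row2_iadd m c d : row2 (iadd m c d) = row2 c + row2 d :> 'rV[R]_m.
Proof.
apply/rowP => t; rewrite !mxE (nth_map 0%N) ?size_iota // nth_iota // add0n.
by rewrite rmorphD mulrDl.
Qed.

Lemma row2_iev m (i : 'I_m) : row2 (iev m i 2) = ev R i.
Proof.
apply/rowP => t; rewrite !mxE (nth_map 0%N) ?size_iota // nth_iota // add0n /=.
have [->|ti] := eqVneq t i; first by rewrite !eqxx /=; field.
by rewrite (negbTE (ti : (t : nat) != i)) mul0r.
Qed.

Lemma row2_ievN m (i : 'I_m) : row2 (iev m i (-2)) = - ev R i.
Proof.
apply/rowP => t; rewrite !mxE (nth_map 0%N) ?size_iota // nth_iota // add0n /=.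
have [->|ti] := eqVneq t i; last first.
  by rewrite (negbTE (ti : (t : nat) != i)) mul0r oppr0.
transitivity (-2 / 2 : R); first by rewrite !eqxx.
by rewrite mulNr divff ?pnatr_eq0 // eqxx.
Qed.

Definition rowsA k : seq (seq int) :=
  [seq iadd k.+1 (iev k.+1 p.1 2) (iev k.+1 p.2 (-2)) |
   p <- [seq (i, j) | i <- iota 0 k.+1, j <- iota 0 k.+1] & p.1 != p.2].

Lemma rsA_rows k : rsA R k =i map row2 (rowsA k).
Proof.
move=> x; rewrite -map_comp; apply/mapP/mapP.
  move=> [[i j]]; rewrite mem_enum => ij ->; exists (i : nat, j : nat).
    rewrite mem_filter; apply/andP; split; first by [].
    by apply/allpairsP; exists (i : nat, j : nat); split; rewrite // mem_iota add0n ltn_ord.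
  by rewrite [RHS]row2_iadd row2_iev row2_ievN.
move=> [[i j]]; rewrite mem_filter => /andP [ij].
case/allpairsP => [[i' j'] []]; rewrite !mem_iota !add0n => ib jb [? ?]; subst i' j'.
move=> ->; exists (Ordinal ib, Ordinal jb); first by rewrite mem_enum.
by rewrite /= row2_iadd (row2_iev (Ordinal ib)) (row2_ievN (Ordinal jb)).
Qed.

Definition rowsD k : seq (seq int) :=
  flatten [seq [seq iadd k (iev k p.1 s.1) (iev k p.2 s.2) |
                s <- [:: (2, 2); (2, -2); (-2, 2); (-2, -2)] : seq (int * int)] |
   p <- [seq (i, j) | i <- iota 0 k, j <- iota 0 k] & (p.1 < p.2)%N].

Lemma rsD_rows k : rsD R k =i map row2 (rowsD k).
Proof.
have E (i j : 'I_k) : [:: ev R i + ev R j; ev R i - ev R j; - ev R i + ev R j; - ev R i - ev R j] =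
    map row2 [seq iadd k (iev k i s.1) (iev k j s.2) |
                s <- [:: (2, 2); (2, -2); (-2, 2); (-2, -2)] : seq (int * int)].
  by rewrite /= !row2_iadd !row2_iev !row2_ievN.
move=> x; rewrite /rowsD map_flatten -map_comp; apply/flattenP/flattenP.
  move=> [s0 /mapP [[i j]]]; rewrite mem_enum => ij -> xs.
  eexists; last exact: xs; apply/mapP; exists (i : nat, j : nat); last exact: E.
  rewrite mem_filter; apply/andP; split; first by [].
  by apply/allpairsP; exists (i : nat, j : nat); split; rewrite // mem_iota add0n ltn_ord.
move=> [s0 /mapP [[i j]]]; rewrite mem_filter => /andP [/= ij].
case/allpairsP => [[i' j'] /= []]; rewrite !mem_iota !add0n => /= ib jb [? ?]; subst i' j'.
move=> -> xs; exists [:: ev R (Ordinal ib) + ev R (Ordinal jb); ev R (Ordinal ib) - ev R (Ordinal jb);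
  - ev R (Ordinal ib) + ev R (Ordinal jb); - ev R (Ordinal ib) - ev R (Ordinal jb)].
  by apply/mapP; exists (Ordinal ib, Ordinal jb); rewrite ?mem_enum.
by rewrite E.
Qed.

Fixpoint bools k : seq bitseq :=
  if k is k'.+1 then [seq b :: t | b <- [:: true; false], t <- bools k'] else [:: [::]].

Lemma mem_bools (t : bitseq) : t \in bools (size t).
Proof.
elim: t => // b t IH; apply/allpairsP; exists (b, t); split=> //.
by case: b.
Qed.

Lemma size_bools k t : t \in bools k -> size t = k.
Proof.
elim: k t => [|k IH] t; first by rewrite inE => /eqP ->.
by case/allpairsP => [[b t'] [_ /IH <- ->]].
Qed.

Definition rows_half : seq (seq int) :=
  [seq [seq if b then -1 else 1 | b : bool <- t] | t <- bools 8 & ~~ odd (count id t)].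

Definition rowsE8 := rowsD 8 ++ rows_half.

Lemma rsE8_rows : rsE8 R =i map row2 rowsE8.
Proof.
pose tt (s : {ffun 'I_8 -> bool}) : bitseq := [seq s i | i <- enum 'I_8].
have szt s : size (tt s) = 8%N by rewrite size_map size_enum_ord.
have ttE (s : {ffun 'I_8 -> bool}) (i : 'I_8) : nth false (tt s) i = s i.
  by rewrite (nth_map i) ?size_enum_ord // nth_ord_enum.
have cnt (s : {ffun 'I_8 -> bool}) : #|[pred i | s i]| = count id (tt s).
  rewrite count_map -sum1_card -sum1_count big_enum_cond /=; apply: eq_bigl => i.
  by [].
have rowE (s : {ffun 'I_8 -> bool}) : row2 [seq if b then -1 else 1 | b : bool <- tt s] =
    \row_i (if s i then - 2^-1 else 2^-1) :> 'rV[R]_8.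
  apply/rowP => i; rewrite !mxE (nth_map false) ?szt // ttE.
  by case: (s i); rewrite ?mul1r // (_ : (-1)%:~R = -1) ?mulN1r.
have ttK t : size t = 8%N -> tt [ffun i : 'I_8 => nth false t i] = t.
  move=> st; apply: (@eq_from_nth _ false); rewrite szt // => i ib.
  by rewrite (ttE _ (Ordinal ib)) ffunE.
move=> x; rewrite /rsE8 /rowsE8 map_cat !mem_cat rsD_rows; congr (_ || _).
rewrite -map_comp; apply/mapP/mapP.
  move=> [s]; rewrite mem_enum => sP ->; exists (tt s); last by rewrite /= rowE.
  rewrite mem_filter -cnt; apply/andP; split=> //.
  by have := mem_bools (tt s); rewrite szt.
move=> [t]; rewrite mem_filter => /andP [te /size_bools st] ->.
exists [ffun i : 'I_8 => nth false t i]; last by rewrite -rowE ttK.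
by rewrite mem_enum inE cnt ttK.
Qed.

Lemma halfones_row2 : halfones R = row2 (nseq 8 1).
Proof. by apply/rowP => i; rewrite !mxE nth_nseq ltn_ord mul1r. Qed.

Lemma a2vec_row2 : a2vec R = row2 [:: 2; 2; 0; 0; 0; 0; 0; 0].
Proof.
rewrite /a2vec -!row2_iev -row2_iadd; congr row2.
Qed.

Lemma size_rowsE8 : all (fun l => size l == 8%N) rowsE8.
Proof. by vm_compute. Qed.

Definition rowsE7 := [seq l <- rowsE8 | idot l (nseq 8 1) == 0].
Definition rowsE6 := [seq l <- rowsE7 | idot l [:: 2; 2; 0; 0; 0; 0; 0; 0] == 0].

Lemma row2_dot_eq0 (l l' : seq int) : (size l' <= 8)%N ->
  (dotv (row2 l : 'rV[R]_8) (row2 l') == 0) = (idot l l' == 0).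
Proof.
move=> sl; rewrite dotv_row2 // mulf_eq0 invr_eq0 (pnatr_eq0 _ 4) orbF.
by rewrite intr_eq0.
Qed.

Lemma rsE7_rows : rsE7 R =i map row2 rowsE7.
Proof.
move=> x; rewrite mem_filter halfones_row2 rsE8_rows; apply/andP/mapP.
  move=> [x0 /mapP [l lP xE]]; exists l => //; rewrite mem_filter lP andbT.
  by move: x0; rewrite xE row2_dot_eq0.
move=> [l]; rewrite mem_filter => /andP [l0 lP] ->; rewrite row2_dot_eq0 //.
by rewrite map_f.
Qed.

Lemma rsE6_rows : rsE6 R =i map row2 rowsE6.
Proof.
move=> x; rewrite mem_filter halfones_row2 a2vec_row2 rsE8_rows; apply/andP/mapP.
  move=> [x0 /mapP [l lP xE]]; exists l => //; rewrite !mem_filter lP andbT.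
  by move: x0; rewrite xE !row2_dot_eq0 // andbC.
move=> [l]; rewrite !mem_filter => /and3P [l1 l0 lP] ->; rewrite !row2_dot_eq0 //.
by rewrite l1 l0 map_f.
Qed.

Lemma osum_rows a b (S : seq 'rV[R]_a) (T : seq 'rV[R]_b) (L L' : seq (seq int)) :
  all (fun l => size l == a) L -> S =i map row2 L -> T =i map row2 L' ->
  osum S T =i map row2 ([seq l ++ nseq b 0 | l <- L] ++ [seq nseq a 0 ++ l | l <- L']).
Proof.
move=> /allP sL SL TL x.
have E1 l : l \in L -> row_mx (row2 l) 0 = row2 (l ++ nseq b 0) :> 'rV[R]_(a + b).
  move=> /sL /eqP sl; apply/rowP => i; rewrite !mxE nth_cat sl.
  case: splitP => j ->; rewrite !mxE ?ltn_ord //.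
  by rewrite ?ltnNge ?leq_addr /= nth_nseq if_same mul0r.
have E2 l : row_mx 0 (row2 l) = row2 (nseq a 0 ++ l) :> 'rV[R]_(a + b).
  apply/rowP => i; rewrite !mxE nth_cat size_nseq.
  case: splitP => j ->; rewrite !mxE ?ltn_ord ?nth_nseq ?ltn_ord ?mul0r //.
  by rewrite ?ltnNge ?leq_addr /= addKn.
rewrite map_cat !mem_cat -!map_comp; congr (_ || _); apply/mapP/mapP.
- move=> [y]; rewrite SL => /mapP [l lL ->] ->; exists l => //=; exact: E1.
- move=> [l lL ->]; exists (row2 l); rewrite ?SL ?map_f //=; exact/esym/E1.
- move=> [y]; rewrite TL => /mapP [l lL ->] ->; exists l => //=; exact: E2.
- move=> [l lL ->]; exists (row2 l); rewrite ?TL ?map_f //=; exact/esym/E2.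
Qed.

Definition gramA1 : seq (seq int) := [:: [:: 2]].
Definition gramA2 : seq (seq int) := [:: [:: 2; -1]; [:: -1; 2]].
Definition gram2 (G G' : seq (seq int)) : seq (seq int) :=
  [seq g ++ nseq (size G') 0 | g <- G] ++ [seq nseq (size G) 0 ++ g | g <- G'].

Lemma A1_modelled : modelled (rsA R 1) gramA1 (rootsZ gramA1 1) 2 0.
Proof. by apply: (@modelled_row2 R 2 (rsA R 1) _ [:: [:: 2; -2]] _ _ _ _ (@rsA_rows 1)); vm_compute. Qed.

Lemma A2_modelled : modelled (rsA R 2) gramA2 (rootsZ gramA2 2) 6 2.
Proof.
apply: (@modelled_row2 R 3 (rsA R 2) _ [:: [:: 2; -2; 0]; [:: 0; 2; -2]] _ _ _ _ (@rsA_rows 2)).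
by vm_compute.
Qed.

Lemma A1A1_modelled : modelled (osum (rsA R 1) (rsA R 1)) (gram2 gramA1 gramA1)
  (rootsZ (gram2 gramA1 gramA1) 1) 4 0.
Proof.
have sA : all (fun l => size l == 2%N) (rowsA 1) by vm_compute.
have H := osum_rows sA (@rsA_rows 1) (@rsA_rows 1).
by apply: (modelled_row2 (B := [:: [:: 2; -2; 0; 0]; [:: 0; 0; 2; -2]]) H); vm_compute.
Qed.

Definition baseE8 : seq (seq int) :=
  [:: [:: 1; -1; -1; -1; -1; -1; -1; 1];
      [:: 2; 2; 0; 0; 0; 0; 0; 0];
      [:: -2; 2; 0; 0; 0; 0; 0; 0];
      [:: 0; -2; 2; 0; 0; 0; 0; 0];
      [:: 0; 0; -2; 2; 0; 0; 0; 0];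
      [:: 0; 0; 0; -2; 2; 0; 0; 0];
      [:: 0; 0; 0; 0; -2; 2; 0; 0];
      [:: 0; 0; 0; 0; 0; -2; 2; 0]].

(** Taken orthogonal to [halfones], where [rsE7] lives: a chain of coordinate differences and, for
    node 1, a half-integral root with coordinate sum 0. The base of E6 also avoids [a2vec]. *)
Definition baseE7 : seq (seq int) :=
  [:: [:: 0; 0; 0; 0; 0; 0; 2; -2];
      [:: 1; -1; -1; -1; -1; 1; 1; 1];
      [:: 0; 0; 0; 0; 0; 2; -2; 0];
      [:: 0; 0; 0; 0; 2; -2; 0; 0];
      [:: 0; 0; 0; 2; -2; 0; 0; 0];
      [:: 0; 0; 2; -2; 0; 0; 0; 0];
      [:: 0; 2; -2; 0; 0; 0; 0; 0]].

Definition baseE6 : seq (seq int) :=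
  [:: [:: 0; 0; 2; -2; 0; 0; 0; 0];
      [:: 1; -1; -1; -1; -1; 1; 1; 1];
      [:: 0; 0; 0; 2; -2; 0; 0; 0];
      [:: 0; 0; 0; 0; 2; -2; 0; 0];
      [:: 0; 0; 0; 0; 0; 2; -2; 0];
      [:: 0; 0; 0; 0; 0; 0; 2; -2]].

Lemma E6_modelled : modelled (rsE6 R) gramE6 rootsE6 72 20.
Proof. by apply: (modelled_row2 (B := baseE6) rsE6_rows); vm_compute. Qed.

Lemma E7_modelled : modelled (rsE7 R) gramE7 rootsE7 126 32.
Proof. by apply: (modelled_row2 (B := baseE7) rsE7_rows); vm_compute. Qed.

Lemma E8_modelled : modelled (rsE8 R) gramE8 rootsE8 240 56.
Proof. by apply: (modelled_row2 (B := baseE8) rsE8_rows); vm_compute. Qed.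

End Standard.

Definition gramE8E8 := gram2 gramE8 gramE8.
Definition rootsE8E8 := rootsZ gramE8E8 29.

Lemma E8E8_modelled (R : realType) :
  modelled (osum (rsE8 R) (rsE8 R)) gramE8E8 rootsE8E8 480 56.
Proof.
have H := osum_rows size_rowsE8 (@rsE8_rows R) (@rsE8_rows R).
refine (modelled_row2 (B := gram2 baseE8 baseE8) H _).
by vm_compute.
Qed.

(** * Isometries *)

Lemma isgram_cat (R : realType) (n : nat) (b b2 : seq 'rV[R]_n) G G2 : isgram b G -> isgram b2 G2 ->
  (forall x y, x \in b -> y \in b2 -> dotv x y = 0) -> isgram (b ++ b2) (gram2 G G2).
Proof.
move=> [sG /allP aG gG] [sG2 /allP aG2 gG2] orth; split.
- by rewrite !size_cat !size_map sG sG2.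
- apply/allP => g; rewrite mem_cat size_cat => /orP [] /mapP [g' g'G ->].
    by rewrite size_cat size_nseq (eqP (aG _ g'G)) sG2.
  by rewrite size_cat size_nseq (eqP (aG2 _ g'G)) sG.
have aGj j : (j < size b)%N -> size (nth [::] G j) = size b.
  by move=> jb; apply/eqP/aG/mem_nth; rewrite sG.
move=> i j; rewrite size_cat => ib jb.
rewrite !nth_cat size_map sG; case: (ltnP j (size b)) => jb1; case: (ltnP i (size b)) => ib1.
- by rewrite (nth_map [::]) ?sG // nth_cat aGj // ib1 gG.
- rewrite (nth_map [::]) ?sG // nth_cat aGj // ltnNge ib1 /= nth_nseq if_same.
  have i2 : (i - size b < size b2)%N by lia.
  by rewrite dotvC orth ?mem_nth.
- rewrite (nth_map [::]) ?sG2; last by lia.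
  have j2 : (j - size b < size b2)%N by lia.
  by rewrite nth_cat size_nseq ib1 nth_nseq if_same orth ?mem_nth.
- rewrite (nth_map [::]) ?sG2; last by lia.
  by rewrite nth_cat size_nseq ltnNge ib1 /= gG2 //; lia.
Qed.

Section Identify.
Variables (R : realType) (n : nat) (Phi : seq 'rV[R]_n).
Hypothesis slP : simply_laced Phi.
Implicit Types (x y z r : 'rV[R]_n) (b e : seq 'rV[R]_n).

(** The roots generated by the base are distinct and lie in [Phi]; equal cardinality makes them all
    of [Phi]. *)
Lemma base_rs_equiv m (Psi : seq 'rV[R]_m) b G k sz N : spans Phi ->
  {subset b <= Phi} -> isgram b G -> modelled Psi G (rootsZ G k) sz N ->
  size Phi = sz -> rs_equiv Phi Psi.
Proof.
move=> sp bP gb [b' [[gb' _ PsiS _] [U szS _]]] sz'.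
apply: (rs_equiv_gram sp gb gb') PsiS.
have TU := sub_roots_uniq gb U.
have TP : {subset sub_roots b (rootsZ G k) <= Phi}.
  by move=> _ /mapP [c cS ->]; exact: (lincomb_roots slP bP gb cS).
by have [|_ H x] := uniq_min_size TU TP; rewrite ?H // size_map szS sz'.
Qed.

Lemma Dframe_full e x : Dframe Phi e -> size e = n -> {in e, forall y, dotv x y = 0} -> x = 0.
Proof.
move=> [U e1 e0 _] sz x0; apply/eqP/negPn/negP => xn.
suff : (size (x :: e) <= n)%N by rewrite /= sz ltnn.
apply: independent_size => u /=; rewrite big_ord_recl /= => E.
have ej j : (j < size e)%N -> u j.+1 = 0.
  move=> je; have := dotv0l e`_j; rewrite -{1}E dotvDl dotvZl x0 ?mem_nth // mulr0 add0r.
  rewrite dotv_suml (bigD1 (Ordinal je)) //= big1 => [|k kj].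
    by rewrite addr0 dotvZl e1 ?mem_nth // mulr1.
  by rewrite dotvZl add0n e0 ?mulr0 ?mem_nth // nth_uniq.
move=> [_|j jb]; last exact: ej.
have := dotv0l x; rewrite -{1}E dotvDl dotvZl dotv_suml big1 => [|k _].
  by rewrite addr0 => /eqP; rewrite mulf_eq0 dotv_eq0 (negbTE xn) orbF => /eqP.
by rewrite dotvZl add0n dotvC x0 ?mulr0 ?mem_nth.
Qed.

Lemma rsDP k (y : 'rV[R]_k) : y \in rsD R k <-> exists i j : 'I_k, i != j /\
  (y = ev R i + ev R j \/ y = ev R i - ev R j \/ y = - ev R i - ev R j).
Proof.
split.
  case/flattenP => s /mapP [[i j]]; rewrite mem_enum inE /= => ij ->.
  have nij : i != j by apply: contraTneq ij => ->; rewrite ltnn.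
  rewrite !inE => /or4P [] /eqP ->.
  - by exists i, j; split; [|left].
  - by exists i, j; split; [|right; left].
  - by exists j, i; split; [rewrite eq_sym|right; left; rewrite addrC].
  - by exists i, j; split; [|right; right].
have H (i j : 'I_k) (z : 'rV[R]_k) : (i < j)%N -> z \in [:: ev R i + ev R j; ev R i - ev R j; - ev R i + ev R j;
                   - ev R i - ev R j] -> z \in rsD R k.
  move=> ij zs; apply/flattenP; eexists; last exact: zs.
  by apply/mapP; exists (i, j); rewrite ?mem_enum.
case=> i [j [ij yE]]; have [lt|gt|E] := ltngtP i j; last by move: ij; rewrite (ord_inj E) eqxx.
  by apply: (H i j) => //; rewrite !inE; case: yE => [->|[->|->]]; rewrite eqxx ?orbT.
apply: (H j i) => //; rewrite !inE; case: yE => [->|[->|->]].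
- by rewrite addrC eqxx.
- by rewrite addrC eqxx !orbT.
- by rewrite addrC eqxx !orbT.
Qed.

Lemma Dframe_rs_equiv e d : Dframe Phi e -> size e = n -> Dclosed Phi e -> n = d ->
  rs_equiv Phi (rsD R d).
Proof.
move=> De sz /allP cl <-; have [U e1 e0 eP] := De.
pose E : 'M[R]_n := \matrix_(i < n) e`_i.
have ie (i : 'I_n) : e`_i \in e by rewrite mem_nth // sz.
have EE : E *m E^T = 1%:M.
  apply/matrixP => i j; rewrite !mxE.
  transitivity (dotv e`_i e`_j).
    by rewrite dotvE; apply: eq_bigr => k _; rewrite !mxE.
  have [->|ij] := eqVneq i j; first by rewrite e1.
  by rewrite e0 // nth_uniq // sz.
have EE' : E^T *m E = 1%:M by exact: mulmx1C.
have eM (i : 'I_n) : e`_i *m E^T = ev R i.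
  have -> : e`_i = row i E by rewrite rowK.
  by rewrite -row_mul EE row1.
have nthe x : x \in e -> exists i : 'I_n, x = e`_i.
  by move=> /(nthP 0) [i]; rewrite sz => ib <-; exists (Ordinal ib).
exists E^T; split; first by rewrite trmxK.
move=> y; apply/idP/mapP.
  move=> /rsDP [i [j [ij yE]]].
  have nij : e`_i != e`_j by rewrite nth_uniq ?sz.
  have [P1 P2] := eP _ _ (ie i) (ie j) nij.
  case: yE => [->|[->|->]].
  - by exists (e`_i + e`_j); rewrite // mulmxDl !eM.
  - by exists (e`_i - e`_j); rewrite // mulmxBl !eM.
  - exists (- (e`_i + e`_j)); first by rewrite (root_oppE slP).
    by rewrite mulNmx mulmxDl !eM opprD.
move=> [x xP ->]; have := cl x xP; case/orP; last first.
  move=> /allP x0; have xE : x = 0 by apply: (Dframe_full De sz) => z /x0 /eqP.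
  by have := root_neq0 slP xP; rewrite xE eqxx.
case/hasP => p pe /hasP [q qe /andP [pq xE]].
have [i pE] := nthe p pe; have [j qE] := nthe q qe.
apply/rsDP; exists i, j; split; first by apply: contraNneq pq => ij; rewrite pE qE ij.
case/or3P: xE => /eqP ->; rewrite pE qE.
- by left; rewrite mulmxDl !eM.
- by right; left; rewrite mulmxBl !eM.
- by right; right; rewrite mulmxBl mulNmx !eM.
Qed.

(** Each [ev i] is half the sum of [ev i + ev j] and [ev i - ev j], so it lies in the image of [M];
    a second index [j] exists because [1 < k]. The preimages form a frame, whence [k <= n], and the
    rank of [M] gives [n <= k]. *)
Lemma rsD_rs_equiv k : (1 < k)%N -> rs_equiv Phi (rsD R k) ->
  n = k /\ exists e, [/\ Dframe Phi e, size e = k & Dclosed Phi e].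
Proof.
move=> k1 [M [MM PsiE]].
have inj : injective (fun x : 'rV[R]_n => x *m M).
  by move=> x y E; rewrite -[x]mulmx1 -MM mulmxA E -mulmxA MM mulmx1.
pose f (i : 'I_k) : 'rV[R]_n := ev R i *m M^T.
have pre (y : 'rV[R]_k) : y \in rsD R k -> y *m M^T \in Phi /\ y *m M^T *m M = y.
  by rewrite PsiE => /mapP [x xP ->]; rewrite -!mulmxA MM mulmx1 -?mulmxA ?(mulmxA M) ?MM ?mul1mx.
have rD (i j : 'I_k) : i != j -> ev R i + ev R j \in rsD R k /\ ev R i - ev R j \in rsD R k.
  by move=> ij; split; apply/rsDP; exists i, j; split=> //; [left|right; left].
have other (i : 'I_k) : exists j : 'I_k, i != j.
  have k0 : (0 < k)%N by lia.
  have [E|ne] := eqVneq i (Ordinal k0); last by exists (Ordinal k0).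
  by exists (Ordinal k1); rewrite E.
have fM i : f i *m M = ev R i.
  have [j ij] := other i; have [/pre [_ H1] /pre [_ H2]] := rD i j ij.
  have -> : f i = 2^-1 *: ((ev R i + ev R j) *m M^T + (ev R i - ev R j) *m M^T).
    rewrite -mulmxDl scalemxAl; congr (_ *m _).
    by apply/rowP => t; rewrite !mxE; lra.
  by rewrite -scalemxAl mulmxDl H1 H2; apply/rowP => t; rewrite !mxE; lra.
have fD i j : dotv (f i) (f j) = (i == j)%:R.
  rewrite -(dotv_mulmx _ _ MM) !fM /dotv trmx_delta mul_delta_mx_cond.
  by rewrite mulmxnE mxE !eqxx.
have finj : injective f.
  by move=> i j E; apply/eqP/negPn/negP => ij; have := fD i j; rewrite E fD eqxx (negbTE ij) => /eqP; rewrite oner_eq0.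
pose e := [seq f i | i <- enum 'I_k].
have sz : size e = k by rewrite size_map size_enum_ord.
have De : Dframe Phi e.
  split; first by rewrite map_inj_uniq // enum_uniq.
  - by move=> _ /mapP [i _ ->]; rewrite fD eqxx.
  - move=> _ _ /mapP [i _ ->] /mapP [j _ ->] ij; rewrite fD.
    by rewrite (inj_eq finj) in ij; rewrite (negbTE ij).
  - move=> _ _ /mapP [i _ ->] /mapP [j _ ->]; rewrite (inj_eq finj) => ij.
    have [/pre [P1 _] /pre [P2 _]] := rD i j ij.
    by rewrite -mulmxDl -mulmxBl.
split.
  apply/eqP; rewrite eqn_leq -{2}sz (Dframe_size De) andbT.
  have := mxrankM_maxl M M^T; rewrite MM mxrank1 => /leq_trans; apply.
  exact: rank_leq_col.
exists e; split=> //; apply/allP => r rP; apply/orP; left.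
have : r *m M \in rsD R k by rewrite PsiE; apply/mapP; exists r.
have fe i : f i \in e by rewrite map_f // mem_enum.
move=> /rsDP [i [j [ij rE]]]; apply/hasP; exists (f i) => //; apply/hasP; exists (f j) => //.
rewrite (inj_eq finj) ij /=; apply/or3P.
case: rE => [rE|[rE|rE]]; [apply: Or31|apply: Or32|apply: Or33]; apply/eqP/inj.
- by rewrite rE mulmxDl !fM.
- by rewrite rE mulmxBl !fM.
- by rewrite rE mulmxBl mulNmx !fM.
Qed.

End Identify.

(** * Identification of the solutions *)

Lemma simply_laced_orth (R : realType) (n : nat) (Phi b : seq 'rV[R]_n) :
  simply_laced Phi -> simply_laced [seq r <- Phi | all (fun y => dotv r y == 0) b].
Proof.
move=> [U N C I]; split; first exact: filter_uniq.
- by move=> x; rewrite mem_filter => /andP [_ /N].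
- move=> x y; rewrite !mem_filter => /andP [/allP x0 xP] /andP [/allP y0 yP].
  rewrite C // andbT; apply/allP => z zb.
  by rewrite !dotvL (eqP (x0 z zb)) (eqP (y0 z zb)) mulr0 subr0.
- by move=> x y; rewrite !mem_filter => /andP [_ xP] /andP [_ yP]; exact: I.
Qed.

Section MainCases.
Variables (R : realType) (n : nat) (Phi : seq 'rV[R]_n) (h N : nat).
Hypotheses (slP : simply_laced Phi) (sp : spans Phi) (Phi0 : Phi != [::]).
Hypothesis cnt : {in Phi, forall a, count (fun x => dotv x a == 1) Phi = N}.
Hypotheses (szP : size Phi = (n * h)%N) (hN : (h.*2 = N + 4)%N).

Let PhiU : uniq Phi. Proof. by case: slP. Qed.
Let Phi2 : norm2 Phi. Proof. by case: slP. Qed.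

Let exroot : exists a, a \in Phi.
Proof. by case: (Phi) Phi0 => // a s _; exists a; rewrite mem_head. Qed.

Lemma modelled_parameters m (Psi : seq 'rV[R]_m) G S sz N' :
  rs_equiv Phi Psi -> modelled Psi G S sz N' -> (n * h = sz)%N /\ N = N'.
Proof.
move=> eqv [b' [[gb bP PsiS b0] [U szS cntS]]].
have [sz' [a aP]] := rs_equiv_count slP eqv gb b0 bP U PsiS.
by rewrite cnt // cntS -szP sz' szS.
Qed.

Lemma rsD_parameters k : (1 < k)%N -> rs_equiv Phi (rsD R k) -> n = k /\ (h = k.-1.*2)%N.
Proof.
clear szP exroot Phi0.
move=> k1 /(rsD_rs_equiv k1) [nk [e [De sz cl]]]; split=> //.
case: e De sz cl => [|a [|b e]] De sz cl; rewrite -sz in k1 => //.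
have [U _ _ eP] := De.
have ab : a != b by move: U => /= /andP []; rewrite inE negb_or => /andP [].
have ia : a \in [:: a, b & e] by rewrite mem_head.
have ib : b \in [:: a, b & e] by rewrite !inE eqxx orbT.
have [abP _] := eP a b ia ib ab.
by have := Dframe_count slP De cl ia ib ab; rewrite cnt // sz; lia.
Qed.

Lemma param_A1 : n = 1%N -> h = 2%N -> rs_equiv Phi (rsA R 1).
Proof.
move=> n1 h2; have [a aP] := exroot.
apply: (base_rs_equiv slP (b := [:: a]) sp _ _ (A1_modelled R)); last by rewrite szP n1 h2.
  by move=> x; rewrite inE => /eqP ->.
by split=> // -[|i] [|j] // _ _; rewrite /= (Phi2 aP).
Qed.

Lemma param_A1A1 : n = 2%N -> h = 2%N -> rs_equiv Phi (osum (rsA R 1) (rsA R 1)).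
Proof.
move=> n2 h2; have [a aP] := exroot.
have N0 : N = 0%N by lia.
have noadj x y : x \in Phi -> y \in Phi -> dotv x y != 1.
  move=> xP yP; have : ~~ has (fun x => dotv x y == 1) Phi by rewrite has_count cnt // N0.
  by move/hasPn; apply.
have [b bP nb] : exists2 b, b \in Phi & b \notin [:: a; - a].
  apply/hasP; rewrite has_predC; apply/negP => /allP sub.
  by have := uniq_leq_size PhiU sub; rewrite szP /=; lia.
have ab : dotv a b = 0.
  have [E|[E|[E|[E|//]]]] := root_dot_cases slP aP bP.
  - by move: nb; rewrite E inE eqxx.
  - by move: nb; rewrite E !inE opprK eqxx orbT.
  - by move: (noadj a b aP bP); rewrite E eqxx.
  - by move: (noadj (- a) b (root_opp slP aP) bP); rewrite dotvNl E opprK eqxx.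
apply: (base_rs_equiv slP (b := [:: a; b]) sp _ _ (A1A1_modelled R)); last by rewrite szP n2 h2.
  by move=> x; rewrite !inE => /orP [] /eqP ->.
by split=> // -[|[|i]] [|[|j]] // _ _; rewrite /= ?(Phi2 aP) ?(Phi2 bP) // 1?dotvC ab.
Qed.

Lemma param_A2 : n = 2%N -> h = 3%N -> rs_equiv Phi (rsA R 2).
Proof.
move=> n2 h3; have [a aP] := exroot.
have /hasP [x xP /eqP xa] : has (fun x => dotv x a == 1) Phi by rewrite has_count cnt //; lia.
have bP := root_opp slP xP; set b := - x in bP.
have ab : dotv a b = -1 by rewrite /b dotvNr dotvC xa.
apply: (base_rs_equiv slP (b := [:: a; b]) sp _ _ (A2_modelled R)); last by rewrite szP n2 h3.
  by move=> z; rewrite !inE => /orP [] /eqP ->.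
by split=> // -[|[|i]] [|[|j]] // _ _; rewrite /= ?(Phi2 aP) ?(Phi2 bP) // 1?dotvC ab.
Qed.

(** The bound [n + 1 < h] gives access to the classification. A D_k has [h = 2k - 2], below [2n],
    and type E has [h] equal to 12, 18 or 30. *)
Lemma spurious_absurd : ~~ spurious n h.
Proof.
clear szP.
apply/negP => /and5P [nh n2h h12 h18 h30].
have [|[e [De sz _ Ne]]|[N20 _]|[N32 _]|[N56 _]] := root_classification slP cnt Phi0; try lia.
by have := Dframe_size De; lia.
Qed.

(** For [h > 3] there would be a frame of at least four vectors in the plane. *)
Lemma rank2_coxeter : n = 2%N -> (1 < h)%N -> h = 2%N \/ h = 3%N.
Proof.
clear szP.
move=> n2 h1; have [h3|h4] := leqP h 3; first by lia.
exfalso; have [|[e [De sz _ _]]|[r _ [e De [sz _]]]] := D_or_E6 slP cnt Phi0; first by lia.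
  by have := Dframe_size De; lia.
by have := Dframe_size De; lia.
Qed.

Lemma param_D4 : n = 4%N -> h = 6%N -> rs_equiv Phi (rsD R 4).
Proof.
clear szP.
move=> n4 h6; have [|[e [De sz cl Ne]]|[N20 _]|[N32 _]|[N56 _]] := root_classification slP cnt Phi0; try lia.
have sze : size e = n by lia.
exact: (Dframe_rs_equiv slP De sze cl).
Qed.

Lemma param_E6 : n = 6%N -> h = 12%N -> rs_equiv Phi (rsE6 R).
Proof.
move=> n6 h12; have [|[e [De sz _ Ne]]|[_ [b [_ bP gb]]]|[N32 _]|[N56 _]] :=
  root_classification slP cnt Phi0; try lia.
  by have := Dframe_size De; lia.
by apply: (base_rs_equiv slP sp bP gb (E6_modelled R)); rewrite szP n6 h12.
Qed.

Lemma param_E7 : n = 7%N -> h = 18%N -> rs_equiv Phi (rsE7 R).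
Proof.
move=> n7 h18; have [|[e [De sz _ Ne]]|[N20 _]|[_ [b [_ bP gb]]]|[N56 _]] :=
  root_classification slP cnt Phi0; try lia.
  by have := Dframe_size De; lia.
by apply: (base_rs_equiv slP sp bP gb (E7_modelled R)); rewrite szP n7 h18.
Qed.

Lemma param_E8 : n = 8%N -> h = 30%N -> rs_equiv Phi (rsE8 R).
Proof.
move=> n8 h30; have [|[e [De sz _ Ne]]|[N20 _]|[N32 _]|[_ [b [_ bP gb _]]]] :=
  root_classification slP cnt Phi0; try lia.
  by have := Dframe_size De; lia.
by apply: (base_rs_equiv slP sp bP gb (E8_modelled R)); rewrite szP n8 h30.
Qed.

(* In dimension 16 with [h = 30], either there is a 16-frame, or the roots
   orthogonal to an E8 subsystem form a second copy of E8. *)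
Lemma param_16 : n = 16%N -> h = 30%N ->
  rs_equiv Phi (osum (rsE8 R) (rsE8 R)) \/ rs_equiv Phi (rsD R 16).
Proof.
move=> n16 h30; have [|[e [De sz cl Ne]]|[N20 _]|[N32 _]|[N56 [b [sb bP gb spl]]]] :=
  root_classification slP cnt Phi0; try lia.
  have sze : size e = n by lia.
  by right; exact: (Dframe_rs_equiv slP De sze cl).
left; pose Psi := [seq r <- Phi | all (fun y => dotv r y == 0) b].
have slPsi := simply_laced_orth b slP.
have PsiP r : r \in Psi -> r \in Phi /\ {in b, forall y, dotv r y = 0}.
  by rewrite mem_filter => /andP [/allP r0 rP]; split=> // y /r0 /eqP.
have inPsi r : r \in Phi -> r \notin sub_roots b rootsE8 -> r \in Psi.
  move=> rP rT; rewrite mem_filter rP andbT; apply/allP => y yb; apply/eqP.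
  by case: (spl r rP) => [rT'|]; [rewrite rT' in rT|apply].
have Psi0 : Psi != [::].
  apply/eqP => PsiE; have sub : {subset Phi <= sub_roots b rootsE8}.
    by move=> r rP; apply/negPn/negP => /(inPsi r rP); rewrite PsiE.
  have := uniq_leq_size PhiU sub; rewrite size_map.
  by have /and4P [/eqP -> _ _ _] := rootsE8_ok; rewrite szP; lia.
(* A neighbour of a root orthogonal to [b] is not in the E8 subsystem, so it lies in [Psi] and no
   neighbour is lost. *)
have cntPsi : {in Psi, forall a, count (fun x => dotv x a == 1) Psi = N}.
  move=> a /PsiP [aP a0]; rewrite -(cnt aP) /Psi count_filter; apply: eq_in_count => r rP /=.
  have [ra|//] := eqVneq (dotv r a) 1; rewrite andTb.
  suff : r \in Psi by rewrite mem_filter => /andP [].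
  apply: inPsi => //; apply/mapP => -[c _ rE].
  have : dotv r a = 0.
    rewrite rE dotv_lincomb big1 // => i _; rewrite dotvC a0 ?mulr0 //.
    exact: mem_nth.
  by rewrite ra => /eqP; rewrite oner_eq0.
have b0b : b`_0 \in b by rewrite mem_nth // sb.
have [|[e [De sz _ Ne]]|[N20 _]|[N32 _]|[_ [b2 [sb2 b2P gb2 _]]]] :=
  root_classification slPsi cntPsi Psi0; try lia.
  have sze : size e = n by lia.
  (* A frame of 16 vectors is full, and each of its vectors is half a sum of two roots of [Psi],
     hence orthogonal to [b]. *)
  have b00 : b`_0 = 0.
    apply: (Dframe_full De sze) => x xe; have [U _ _ eP] := De.
    have [y ye yx] : exists2 y, y \in e & x != y.
      case: (e) U sz xe => [|a [|a' e']] //= /andP [aa' _] _.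
      rewrite in_cons => /orP [/eqP ->|xe]; last first.
        by exists a; rewrite ?mem_head // eq_sym; apply: contraNneq aa' => ->.
      exists a'; first by rewrite !inE eqxx orbT.
      by apply: contraNneq aa' => ->; rewrite mem_head.
    have [/PsiP [_ /(_ _ b0b) H1] /PsiP [_ /(_ _ b0b) H2]] := eP x y xe ye yx.
    move: H1 H2; rewrite dotvDl dotvBl dotvC => H1 H2.
    have : 2 * dotv b`_0 x = 0 by lra.
    by move/eqP; rewrite mulf_eq0 pnatr_eq0 => /eqP.
  by have := root_neq0 slP (bP _ b0b); rewrite b00 eqxx.
apply: (base_rs_equiv slP (b := b ++ b2) sp _ _ (E8E8_modelled R)); last by rewrite szP n16 h30.
  by move=> x; rewrite mem_cat => /orP [/bP //|/b2P /PsiP []].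
apply: (isgram_cat gb gb2) => x y xb /b2P /PsiP [_ y0].
by rewrite dotvC y0.
Qed.

End MainCases.

Section CoxeterNumber.
Variables (R : realType) (n : nat) (Phi : seq 'rV[R]_n).
Hypotheses (slP : simply_laced Phi) (Phi0 : Phi != [::]).

(** A priori a quotient, the Coxeter number is 2 plus half the number of neighbours, which is even
    by [count_orth_nbrs]. *)
Lemma coxeter_natural (c : R) : {in Phi, forall a, \sum_(x <- Phi) dotv x a ^+ 2 = 4 * c} ->
  exists h N : nat, [/\ c = h%:R, (1 < h)%N, (h.*2 = N + 4)%N &
    {in Phi, forall a, count (fun x => dotv x a == 1) Phi = N}].
Proof.
move=> hreg; have [a aP] : exists a, a \in Phi.
  by case: (Phi) Phi0 => // a s _; exists a; rewrite mem_head.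
pose N := count (fun x => dotv x a == 1) Phi.
have cnt : {in Phi, forall a, count (fun x => dotv x a == 1) Phi = N}.
  by move=> b bP; apply/eqP; rewrite -(eqr_nat R) !(count_dot1 slP hreg).
have NE : exists k, N = k.*2.
  have [/hasP [x xP /eqP xa]|] := boolP (has (fun x => dotv x a == 1) Phi).
    exists (size (orth_nbrs Phi a x)).+1.
    by rewrite /N (count_orth_nbrs slP aP xP xa) doubleS.
  by rewrite has_count -leqNgt leqn0 => /eqP N0; exists 0%N.
have [k kE] := NE; exists k.+2, N; split=> //; last by rewrite kE; lia.
have := count_dot1 slP hreg aP; rewrite -/N kE -addnn natrD => E.
by rewrite -addn2 natrD; lra.
Qed.

End CoxeterNumber.

Theorem proposition8p5 (R : realType) (n : nat) (Phi : seq 'rV[R]_n) :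
  root_system Phi -> Phi != [::] -> norm2 Phi -> strongly_eutactic Phi ->
  spans Phi ->
  (* (i) *)
  design_cond Phi 2 /\
  [/\ (* (ii) *)
      design_cond Phi 4 <->
        (rs_equiv Phi (rsA R 1) \/ rs_equiv Phi (rsA R 2) \/
         rs_equiv Phi (rsD R 4) \/ rs_equiv Phi (rsE6 R) \/
         rs_equiv Phi (rsE7 R) \/ rs_equiv Phi (rsE8 R)),
      (* (iii) *)
      design_cond Phi 6 <->
        (rs_equiv Phi (rsA R 1) \/ rs_equiv Phi (osum (rsA R 1) (rsA R 1))  \/
            rs_equiv Phi (rsE8 R) \/ rs_equiv Phi (osum (rsE8 R) (rsE8 R))
          \/ rs_equiv Phi (rsD R 16)),
      (* (iv) *)
      design_cond Phi 8 <-> (rs_equiv Phi (rsA R 1) \/ rs_equiv Phi (rsA R 2)),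
      (* (v) *)
      design_cond Phi 10 <->
        (rs_equiv Phi (rsA R 1) \/ rs_equiv Phi (osum (rsA R 1) (rsA R 1))  \/
            rs_equiv Phi (rsA R 2) \/ rs_equiv Phi (rsD R 4)
          \/ rs_equiv Phi (rsE8 R))
    & (* (vi) *)
      design_cond Phi 12 <-> rs_equiv Phi (rsA R 1)].
Proof.
move=> rs Phi0 N2 se sp; have slP := root_system_simply_laced rs N2.
have [c hreg szR] := strongly_eutactic_regular slP se sp Phi0.
have [h [N [cE h1 hN cnt]]] := coxeter_natural slP Phi0 hreg.
have szP : size Phi = (n * h)%N.
  by apply/eqP; rewrite -(eqr_nat R) natrM szR cE.
have n0 : (0 < n)%N.
  by rewrite lt0n; apply: contraNneq Phi0 => n0; rewrite -size_eq0 szP n0.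
have D j : (1 < j < 7)%N -> design_cond Phi (2 * j) <-> zpoly n (h%:R : R) j = 0.
  move=> jb; rewrite (design_cond_zrel slP hreg j n0 Phi0 szR) cE.
  by split=> [/eqP|/eqP]; [rewrite zrel_zpoly // => /eqP|rewrite -zrel_zpoly // => /eqP].
have nsp := spurious_absurd slP Phi0 cnt hN.
have A1p := param_A1 slP sp Phi0 szP.
have A1A1p := param_A1A1 slP sp Phi0 cnt szP hN.
have A2p := param_A2 slP sp Phi0 cnt szP hN.
have D4p := param_D4 slP Phi0 cnt hN.
have E8p := param_E8 slP sp Phi0 cnt szP hN.
have mp m (Psi : seq 'rV[R]_m) G S sz N' (H : modelled Psi G S sz N') (E : rs_equiv Phi Psi) :=
  modelled_parameters slP cnt szP E H.
have nhE k m : (0 < m)%N -> (n * h = k * m)%N -> h = m -> n = k /\ h = m.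
  by move=> m0 E hE; split=> //; apply/eqP; rewrite -(eqn_pmul2r m0) -E hE.
have A1i : rs_equiv Phi (rsA R 1) -> n = 1%N /\ h = 2%N.
  by move=> /(mp _ _ _ _ _ _ (A1_modelled R)) [E1 E2]; apply: nhE => //; lia.
have A2i : rs_equiv Phi (rsA R 2) -> n = 2%N /\ h = 3%N.
  by move=> /(mp _ _ _ _ _ _ (A2_modelled R)) [E1 E2]; apply: nhE => //; lia.
have A1A1i : rs_equiv Phi (osum (rsA R 1) (rsA R 1)) -> n = 2%N /\ h = 2%N.
  by move=> /(mp _ _ _ _ _ _ (A1A1_modelled R)) [E1 E2]; apply: nhE => //; lia.
have E6i : rs_equiv Phi (rsE6 R) -> n = 6%N /\ h = 12%N.
  by move=> /(mp _ _ _ _ _ _ (E6_modelled R)) [E1 E2]; apply: nhE => //; lia.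
have E7i : rs_equiv Phi (rsE7 R) -> n = 7%N /\ h = 18%N.
  by move=> /(mp _ _ _ _ _ _ (E7_modelled R)) [E1 E2]; apply: nhE => //; lia.
have E8i : rs_equiv Phi (rsE8 R) -> n = 8%N /\ h = 30%N.
  by move=> /(mp _ _ _ _ _ _ (E8_modelled R)) [E1 E2]; apply: nhE => //; lia.
have E8E8i : rs_equiv Phi (osum (rsE8 R) (rsE8 R)) -> n = 16%N /\ h = 30%N.
  by move=> /(mp _ _ _ _ _ _ (E8E8_modelled R)) [E1 E2]; apply: nhE => //; lia.
have D4i : rs_equiv Phi (rsD R 4) -> n = 4%N /\ h = 6%N.
  exact: (rsD_parameters slP cnt hN (k := 4) isT).
have D16i : rs_equiv Phi (rsD R 16) -> n = 16%N /\ h = 30%N.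
  exact: (rsD_parameters slP cnt hN (k := 16) isT).
have zp (k m j : nat) : n = k -> h = m -> zpoly k (m%:R : R) j = 0 -> zpoly n (h%:R : R) j = 0.
  by move=> -> ->.
split; first by rewrite (design_cond_zrel slP hreg 1 n0 Phi0 szR); exact: zrel1.
split.
- rewrite (D 2%N) //; split.
    move=> /(zpoly2_sol n0 h1); rewrite (negbTE nsp) orbF.
    case/or4P=> [/andP [/eqP a /eqP b]|/andP [/eqP a /eqP b]|/andP [/eqP a /eqP b]|].
    + by left; exact: A1p.
    + by right; left; exact: A2p.
    + by do 2 right; left; exact: D4p.
    case/or3P=> /andP [/eqP a /eqP b].
    + by do 3 right; left; exact: (param_E6 slP sp Phi0 cnt szP hN).
    + by do 4 right; left; exact: (param_E7 slP sp Phi0 cnt szP hN).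
    + by do 5 right; exact: E8p.
  by case=> [/A1i|[/A2i|[/D4i|[/E6i|[/E7i|/E8i]]]]] [a b]; apply: (zp _ _ _ a b); rewrite /zpoly; ring.
- rewrite (D 3%N) //; split.
    move=> /(zpoly3_sol n0 h1); rewrite (negbTE nsp) orbF.
    case/or4P=> /andP [/eqP a /eqP b].
    + by left; exact: A1p.
    + by right; left; exact: A1A1p.
    + by do 2 right; left; exact: E8p.
    (* The only pair of parameters in the lists that two inequivalent systems share. *)
    + by case: (param_16 slP sp Phi0 cnt szP hN a b) => H; [do 3 right; left|do 4 right].
  by case=> [/A1i|[/A1A1i|[/E8i|[/E8E8i|/D16i]]]] [a b]; apply: (zp _ _ _ a b); rewrite /zpoly; ring.
- rewrite (D 4%N) //; split.
    move=> /(zpoly4_sol n0 h1); rewrite (negbTE nsp) orbF.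
    by case/orP=> /andP [/eqP a /eqP b]; [left; exact: A1p|right; exact: A2p].
  by case=> [/A1i|/A2i] [a b]; apply: (zp _ _ _ a b); rewrite /zpoly; ring.
- rewrite (D 5%N) //; split.
    move=> /(zpoly5_sol n0 h1); rewrite (negbTE nsp) orbF.
    case/or4P=> [/andP [/eqP a /eqP b]|/eqP a|/andP [/eqP a /eqP b]|/andP [/eqP a /eqP b]].
    + by left; exact: A1p.
    (* In the plane the equation leaves [h] free, but only 2 and 3 occur. *)
    + case: (rank2_coxeter slP Phi0 cnt hN a h1) => b; first by right; left; exact: A1A1p.
      by do 2 right; left; exact: A2p.
    + by do 3 right; left; exact: D4p.
    + by do 4 right; exact: E8p.
  by case=> [/A1i|[/A1A1i|[/A2i|[/D4i|/E8i]]]] [a b]; apply: (zp _ _ _ a b); rewrite /zpoly; ring.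
- rewrite (D 6%N) //; split.
    move=> /(zpoly6_sol n0 h1); rewrite (negbTE nsp) orbF.
    by case/andP=> /eqP a /eqP b; exact: A1p.
  by move=> /A1i [a b]; apply: (zp _ _ _ a b); rewrite /zpoly; ring.
Qed.
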